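(* Let $\Sigma_\Lambda=\{\Sigma_\lambda=(\gamma_\lambda,f_\lambda,g_\lambda)\}_{\lambda\in\Lambda}$ be a parametrized family of impulsive systems with inputs (with $\Lambda$ an arbitrary nonempty index set) that is weakly ISS. Suppose that there exist functions $\tilde\varphi_f,\tilde\varphi_g,\eta_f,\eta_g,\varphi_f,\varphi_g\in\mathcal{K}_\infty$ and nondecreasing continuous functions $N_f,N_g,O_f,O_g,P_f,P_g:\mathbb{R}_{\ge 0}\to\mathbb{R}_{\ge 0}$ such that, for all $\lambda\in\Lambda$, $t\ge 0$, $\xi,\xi_1,\xi_2\in\mathbb{R}^n$, $\mu,\mu_1,\mu_2\in\mathbb{R}^m$, $$|f_\lambda(t,\xi,\mu_1)-f_\lambda(t,\xi,\mu_2)|\le\tilde\varphi_f(|\mu_1-\mu_2|)\big[N_f(|\xi|)+O_f(\min\{|\mu_1|,|\mu_2|\})\big],$$ $$|f_\lambda(t,\xi_1,\mu)-f_\lambda(t,\xi_2,\mu)|\le\eta_f(|\xi_1-\xi_2|)\big[P_f(\min\{|\xi_1|,|\xi_2|\})+\varphi_f(|\mu|)\big],$$ $$|g_\lambda(t,\xi,\mu_1)-g_\lambda(t,\xi,\mu_2)|\le\tilde\varphi_g(|\mu_1-\mu_2|)\big[N_g(|\xi|)+O_g(\min\{|\mu_1|,|\mu_2|\})\big],$$ $$|g_\lambda(t,\xi_1,\mu)-g_\lambda(t,\xi_2,\mu)|\le\eta_g(|\xi_1-\xi_2|)\big[P_g(\min\{|\xi_1|,|\xi_2|\})+\varphi_g(|\mu|)\big],$$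 and such that, in addition, there is a continuous nondecreasing function $L^f:\mathbb{R}_{\ge 0}\to\mathbb{R}_{\ge 0}$, with $L^f(M)>0$ for $M>0$, satisfying $\eta_f(s)\le L^f(M)\,s$ for all $M\ge 0$ and all $0\le s\le M$. Suppose moreover that $\{\gamma_\lambda:\lambda\in\Lambda\}$ is uniformly incrementally bounded (UIB). Then $\Sigma_\Lambda$ is strongly iISS, and hence also weakly iISS.
   Context: Function classes. $\alpha\in\mathcal{K}$ if $\alpha:\mathbb{R}_{\ge 0}\to\mathbb{R}_{\ge 0}$ is continuous, strictly increasing and $\alpha(0)=0$; $\alpha\in\mathcal{K}_\infty$ if in addition $\alpha$ is unbounded. $\beta\in\mathcal{KL}$ if $\beta:\mathbb{R}_{\ge 0}\times\mathbb{R}_{\ge 0}\to\mathbb{R}_{\ge 0}$, $\beta(\cdot,t)\in\mathcal{K}_\infty$ for every $t\ge 0$, and for each fixed $r\ge 0$, $\beta(r,t)$ decreases monotonically to $0$ as $t\to\infty$. $|\cdot|$ is the Euclidean norm. Impulsive systems. $\Gamma$ is the set of impulse-time sequences $\gamma=\{\tau_k\}_{k=1}^N\subset(0,\infty)$, $N$ finite (possibly $\gamma=\emptyset$) or $N=\infty$, strictly increasing and with no finite limit point; $\gamma$ is also regarded as a set. $\mathcal{U}$ is the set of inputs, i.e. Lebesgue measurable, locally essentially bounded functions $u:[0,\infty)\to\mathbb{R}^m$. An impulsive system with inputs $\Sigma=(\gamma,f,g)$ is given by $$\dot x(t)=f(t,x(t),u(t))\ \text{ for } t\notin\gamma,\qquad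 x(t)=x(t^-)+g(t,x(t^-),u(t))\ \text{ for } t\in\gamma,$$ where $\gamma\in\Gamma$, $f,g:\mathbb{R}_{\ge 0}\times\mathbb{R}^n\times\mathbb{R}^m\to\mathbb{R}^n$, $f(t,0,0)=0$ and $g(t,0,0)=0$ for all $t\ge 0$; moreover $f(t,\xi,\mu)$ is Lebesgue measurable in $t$, continuous in $(\xi,\mu)$, and for every compact interval $I\subset\mathbb{R}_{\ge 0}$ and compact $K\subset\mathbb{R}^n\times\mathbb{R}^m$ there is an integrable $m:I\to\mathbb{R}$ with $|f(t,\xi,\mu)|\le m(t)$ on $I\times K$. The dimensions $n,m$ are the same for all members of a family. Solutions. A solution of $\Sigma$ with initial time $t_0\ge 0$, initial state $x_0\in\mathbb{R}^n$ and input $u\in\mathcal{U}$ is a function $x:[t_0,T_x)\to\mathbb{R}^n$ such that: $x(t_0)=x_0$; $x$ is locally absolutely continuous on each interval $J=[t_1,t_2)\subset[t_0,T_x)$ with no points of $\gamma$ in its interior, with $\dot x(t)=f(t,x(t),u(t))$ for almost all $t\in J$; and for every $t\in\gamma\cap(t_0,T_x)$ the left limit $x(t^-)$ exists, is finite, and $x(t)=x(t^-)+g(t,x(t^-),u(t))$. It is maximally defined if no other solution $y:[t_0,T_y)\to\mathbb{R}^n$ has $T_y>T_x$ and coincides with $x$ on $[t_0,T_x)$. $\mathcal{T}_\Sigma(t_0,x_0,u)$ denotes the set of maximally defined solutions. Norms. For an interval $I\subset[0,\infty)$, $n^\gamma_I:=\#(\gamma\cap I)$. For $u\in\mathcal{U}$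 and $\rho_1,\rho_2\in\mathcal{K}_\infty$, $$\|u_I\|_{\infty,\gamma}:=\max\Big\{\operatorname{ess\,sup}_{t\in I}|u(t)|,\ \sup_{t\in\gamma\cap I}|u(t)|\Big\},\qquad \|u_I\|_{\rho_1,\rho_2,\gamma}:=\int_I\rho_1(|u(s)|)\,ds+\sum_{s\in\gamma\cap I}\rho_2(|u(s)|)$$ (the supremum over the empty set being $0$). Stability. A family $\Sigma_\Lambda=\{\Sigma_\lambda=(\gamma_\lambda,f_\lambda,g_\lambda)\}_{\lambda\in\Lambda}$ is: - weakly ISS if there exist $\beta\in\mathcal{KL}$, $\rho\in\mathcal{K}_\infty$ such that $|x(t)|\le\beta(|x_0|,t-t_0)+\rho\big(\|u_{(t_0,t]}\|_{\infty,\gamma_\lambda}\big)$; - strongly iISS if there exist $\beta\in\mathcal{KL}$, $\alpha,\rho_1,\rho_2\in\mathcal{K}_\infty$ such that $\alpha(|x(t)|)\le\beta\big(|x_0|,t-t_0+n^{\gamma_\lambda}_{(t_0,t]}\big)+\|u_{(t_0,t]}\|_{\rho_1,\rho_2,\gamma_\lambda}$; - weakly iISS if the same holds with the second argument of $\beta$ replaced by $t-t_0$; in each case for all $\lambda\in\Lambda$, $t_0\ge 0$, $x_0\in\mathbb{R}^n$, $u\in\mathcal{U}$, $x\in\mathcal{T}_{\Sigma_\lambda}(t_0,x_0,u)$ and $t\in[t_0,T_x)$. UIB. A set $\mathcal{S}\subset\Gamma$ is uniformly incrementally bounded (UIB) if there is a continuous nondecreasing function $\phi:\mathbb{R}_{\ge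 0}\to\mathbb{R}_{\ge 0}$ such that $n^\gamma_{(t_0,t]}\le\phi(t-t_0)$ for every $\gamma\in\mathcal{S}$ and all $t>t_0\ge 0$. *)

(* Defs.v *)
From HB Require Import structures.
From mathcomp Require Import all_boot all_order all_algebra finmap.
From mathcomp Require Import all_classical all_reals all_analysis ess_sup_inf.

Set Implicit Arguments.
Unset Strict Implicit.
Unset Printing Implicit Defensive.

Import Order.TTheory GRing.Theory Num.Theory.
Import numFieldNormedType.Exports.

Local Open Scope classical_set_scope.
Local Open Scope ring_scope.

(* Functions on R_{>=0} (comparison functions, inputs, right-hand sides) are
   total functions on R that are only constrained and evaluated on [0, +oo[. *)

(* The norm `|x| of the library on 'rV[R]_n is the sup norm. *)
Definition enorm (R : realType) (n : nat) (x : 'rV[R]_n) : R :=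
  Num.sqrt (\sum_(i < n) x 0 i ^+ 2).

Section ComparisonFunctions.
Variable R : realType.
Implicit Types (alpha phi : R -> R) (beta : R -> R -> R).

Definition classK alpha : Prop :=
  [/\ {within `[0, +oo[%classic, continuous alpha},
      (forall r s : R, 0 <= r -> r < s -> alpha r < alpha s)
    & alpha 0 = 0].

Definition classKinf alpha : Prop :=
  classK alpha /\ (forall M : R, exists2 r : R, 0 <= r & M < alpha r).

Definition classKL beta : Prop :=
  (forall t : R, 0 <= t -> classKinf (beta^~ t)) /\
  (forall r : R, 0 <= r ->
     (forall s t : R, 0 <= s -> s <= t -> beta r t <= beta r s) /\
     beta r t @[t --> +oo] --> (0 : R)).

Definition cont_nondecreasing phi : Prop :=
  [/\ {within `[0, +oo[%classic, continuous phi},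
      (forall r s : R, 0 <= r -> r <= s -> phi r <= phi s)
    & (forall r : R, 0 <= r -> 0 <= phi r)].

End ComparisonFunctions.

Section ImpulseTimes.
Variable R : realType.

(* The number of terms is Some N for a finite sequence, None for an infinite
   one.  A strictly increasing sequence is determined by its set of values. *)
Definition impulse_times : set (set R) := [set gamma |
  exists (N : option nat) (tau : nat -> R),
    let dom := [set k : nat | if N is Some N' then (k < N')%N else true] in
    [/\ gamma = tau @` dom,
        (forall k, dom k -> 0 < tau k),
        (forall k l, dom k -> dom l -> (k < l)%N -> tau k < tau l)
      & limit_point gamma = set0]].

(* [fset_set] is fset0 on infinite sets; gamma `&` I is finite as soon as gamma
   is in [impulse_times] and I is bounded. *)
Definition nimp (gamma I : set R) : nat := #|` fset_set (gamma `&` I)|.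

Definition UIB (S : set (set R)) : Prop :=
  S `<=` impulse_times /\
  exists2 phi : R -> R, cont_nondecreasing phi &
    forall gamma, S gamma -> forall t0 t : R, 0 <= t0 -> t0 < t ->
      (nimp gamma `]t0, t]%classic)%:R <= phi (t - t0).

End ImpulseTimes.

(* [completed_lebesgue_measure] lives on the sigma-algebra of Lebesgue
   measurable sets, [lebesgue_measure] on that of Borel sets. *)
Notation lebR R := (@completed_lebesgue_measure R).

Section Lebesgue.
Variables (R : realType) (n : nat).

Definition Lmeasurable (D : set R) (h : R -> 'rV[R]_n) : Prop :=
  forall i : 'I_n,
    measurable_fun (D : set (caratheodory_type (wlength (@idfun R))^*%mu))
      (fun t => h t 0 i : measurableTypeR R).

Definition abs_continuous (a b : R) (x : R -> 'rV[R]_n) : Prop :=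
  forall e : R, 0 < e -> exists2 d : R, 0 < d &
    forall (N : nat) (p q : 'I_N -> R),
      (forall i, [/\ a <= p i, p i <= q i & q i <= b]) ->
      trivIset setT (fun i => `]p i, q i[%classic) ->
      \sum_(i < N) (q i - p i) < d ->
      \sum_(i < N) enorm (x (q i) - x (p i)) < e.

End Lebesgue.

Section ImpulsiveSystems.
Variables (R : realType) (n m : nat).

(* I `[a, b[` with a possibly infinite right end-point. *)
Definition rco (a : R) (b : \bar R) : set R := [set t | a <= t /\ (t%:E < b)%E].

Definition caratheodory_rhs (f : R -> 'rV[R]_n -> 'rV[R]_m -> 'rV[R]_n) :=
  [/\ (forall xi mu, Lmeasurable `[0, +oo[%classic (fun t => f t xi mu)),
      (forall t : R, 0 <= t ->
         continuous (fun z : 'rV[R]_n * 'rV[R]_m => f t z.1 z.2))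
    & (forall a b : R, 0 <= a -> a <= b ->
       forall K : set ('rV[R]_n * 'rV[R]_m), compact K ->
       exists2 bnd : R -> R,
         (lebR R).-integrable `[a, b]%classic (EFin \o bnd) &
         forall t z, t \in `[a, b] -> K z -> enorm (f t z.1 z.2) <= bnd t)].

Record impulsive_system := ImpulsiveSystem {
  imp : set R;
  flow : R -> 'rV[R]_n -> 'rV[R]_m -> 'rV[R]_n;
  jump : R -> 'rV[R]_n -> 'rV[R]_m -> 'rV[R]_n;
  impP : impulse_times imp;
  flow0 : forall t : R, 0 <= t -> flow t 0 0 = 0;
  jump0 : forall t : R, 0 <= t -> jump t 0 0 = 0;
  flowP : caratheodory_rhs flow }.

Implicit Types (S : impulsive_system) (u : R -> 'rV[R]_m).

Definition input u : Prop :=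
  Lmeasurable `[0, +oo[%classic u /\
  forall b : R, 0 <= b -> exists M : R,
    {ae lebR R, forall t, t \in `[0, b] -> enorm (u t) <= M}.

(* x is a function on R of which only the restriction to [t0, Tx[ matters. *)
Definition solution S (t0 : R) (x0 : 'rV[R]_n) u
    (Tx : \bar R) (x : R -> 'rV[R]_n) : Prop :=
  [/\ (t0%:E < Tx)%E,
      x t0 = x0,
      (forall (t1 : R) (t2 : \bar R), (t1%:E < t2)%E ->
         rco t1 t2 `<=` rco t0 Tx ->
         (forall t, imp S t -> ~ (t1 < t /\ (t%:E < t2)%E)) ->
         (forall a b : R, a <= b -> `[a, b]%classic `<=` rco t1 t2 ->
            abs_continuous a b x) /\
         {ae lebR R, forall t, rco t1 t2 t ->
            is_derive t (1 : R) x (flow S t (x t) (u t))})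
    & (forall t, imp S t -> t0 < t -> (t%:E < Tx)%E ->
         exists2 xl : 'rV[R]_n, x s @[s --> t^'-] --> xl &
           x t = xl + jump S t xl (u t))].

Definition maximal_solution S t0 x0 u Tx x : Prop :=
  solution S t0 x0 u Tx x /\
  ~ (exists Ty y, [/\ solution S t0 x0 u Ty y, (Tx < Ty)%E
       & forall t, rco t0 Tx t -> y t = x t]).

(* The essential supremum over I is that of |u| extended by 0 outside I. *)
Definition norm_inf (gamma I : set R) u : \bar R :=
  maxe (ess_sup (lebR R) ((fun t => (enorm (u t))%:E) \_ I))
       (ereal_sup ([set 0%E] `|` [set (enorm (u t))%:E | t in gamma `&` I])).

Definition norm_rho (rho1 rho2 : R -> R) (gamma I : set R) u : \bar R :=
  (\int[lebR R]_(s in I) (rho1 (enorm (u s)))%:E +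
   \esum_(s in gamma `&` I) (rho2 (enorm (u s)))%:E)%E.

Section Stability.
Variables (L : Type) (Sigma : L -> impulsive_system).

(* [norm_inf] is finite for admissible inputs and bounded I. *)
Definition weakly_ISS : Prop :=
  exists (beta : R -> R -> R) (rho : R -> R),
  [/\ classKL beta, classKinf rho &
    forall l (t0 : R) x0 u Tx x t, 0 <= t0 -> input u ->
      maximal_solution (Sigma l) t0 x0 u Tx x -> rco t0 Tx t ->
      enorm (x t) <= beta (enorm x0) (t - t0)
        + rho (fine (norm_inf (imp (Sigma l)) `]t0, t]%classic u))].

Definition strongly_iISS : Prop :=
  exists (beta : R -> R -> R) (alpha rho1 rho2 : R -> R),
  [/\ classKL beta, classKinf alpha, classKinf rho1, classKinf rho2 &
    forall l (t0 : R) x0 u Tx x t, 0 <= t0 -> input u ->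
      maximal_solution (Sigma l) t0 x0 u Tx x -> rco t0 Tx t ->
      ((alpha (enorm (x t)))%:E <=
        (beta (enorm x0)
           (t - t0 + (nimp (imp (Sigma l)) `]t0, t]%classic)%:R))%:E
        + norm_rho rho1 rho2 (imp (Sigma l)) `]t0, t]%classic u)%E].

Definition weakly_iISS : Prop :=
  exists (beta : R -> R -> R) (alpha rho1 rho2 : R -> R),
  [/\ classKL beta, classKinf alpha, classKinf rho1, classKinf rho2 &
    forall l (t0 : R) x0 u Tx x t, 0 <= t0 -> input u ->
      maximal_solution (Sigma l) t0 x0 u Tx x -> rco t0 Tx t ->
      ((alpha (enorm (x t)))%:E <=
        (beta (enorm x0) (t - t0))%:E
        + norm_rho rho1 rho2 (imp (Sigma l)) `]t0, t]%classic u)%E].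

End Stability.

(* The two incremental bounds, with (h, vphit, eta, vphi, N, O, P) being
   (f, tilde varphi_f, eta_f, varphi_f, N_f, O_f, P_f), or the same for g. *)
Definition incr_bounds (h : R -> 'rV[R]_n -> 'rV[R]_m -> 'rV[R]_n)
    (vphit eta vphi N O P : R -> R) : Prop :=
  (forall (t : R) xi mu1 mu2, 0 <= t ->
     enorm (h t xi mu1 - h t xi mu2) <=
       vphit (enorm (mu1 - mu2)) *
         (N (enorm xi) + O (Num.min (enorm mu1) (enorm mu2)))) /\
  (forall (t : R) xi1 xi2 mu, 0 <= t ->
     enorm (h t xi1 mu - h t xi2 mu) <=
       eta (enorm (xi1 - xi2)) *
         (P (Num.min (enorm xi1) (enorm xi2)) + vphi (enorm mu))).

End ImpulsiveSystems.

(* Main.v *)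
Require Import Defs.
From mathcomp Require Import all_boot all_order all_algebra finmap.
From mathcomp Require Import all_classical all_reals all_analysis measurable_realfun ess_sup_inf.
From mathcomp Require Import ring lra.

Set Implicit Arguments.
Unset Strict Implicit.
Unset Printing Implicit Defensive.

Import Order.TTheory GRing.Theory Num.Theory.
Import numFieldNormedType.Exports.

Local Open Scope classical_set_scope.
Local Open Scope ring_scope.

(** Truncate the input, setting it to [0] where [|u| > r], with [rho r <= M / 8].
    From a state of norm at most [M] the truncated system has a global solution
    [y], and weak ISS gives [|y t| <= beta M (t - t0) + M / 8].  By Gronwall's
    inequality between impulses and the incremental bounds at the impulses, of
    which UIB allows boundedly many, [|x t - y t| <= M / 8] on a window of length
    [T M] as long as the excess of the input above [r] (in integral and at the
    impulses) is below some [kappa M].  So [|x|] halves over each such window,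
    and stays below [B M = beta M 0 + M] as long as the excess is small.

    At the scales [M = 2 ^ k], [k : int], weights making [rho1] and [rho2]
    large turn an input energy [E] below a threshold [theta_k] into small
    excess at all scales [j >= k]; then [x] descends to scale [k] and remains
    below [B (2 ^ k)].  Take [alpha] with [alpha (B (2 ^ k)) <= theta_(k - 1)].
    The states with [alpha |x t| > E] then have [alpha |x t|] bounded in terms
    of [|x0|], small for small [|x0|] and tending to [0] uniformly in time, and
    a KL function majorizes any such relation.  Counting impulses in the
    time argument changes nothing, since by UIB a large value of
    [t - t0 + n] forces a large [t - t0]. *)

(** * Comparison functions with prescribed bounds *)

(** Weak ISS sees the input through its supremum, while the conclusion may charge only its energy,
    which does not bound the supremum; hence the comparison with a truncated input. The comparison
    trajectory has to be constructed, because weak ISS speaks of maximal solutions without providing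
    any. For the truncated system the incremental bounds make the flow bounded and Lipschitz on
    bounded sets, so Picard iteration applies, and weak ISS is the a priori bound that excludes
    finite escape. The linear bound on [eta_f] feeds Gronwall's inequality. At impulses continuity
    of [eta_g] is enough: their number in a window is bounded, so tolerances can be chosen backwards
    from the last one. The tolerance [kappa] may degenerate at both ends of the scale, with
    different cures. At large scales the excess lives where the input exceeds a radius tending to
    infinity, so the weights raise [rho1] and [rho2] only at large arguments. At small scales
    weights would spoil [rho 0 = 0], so the energy thresholds there are running minima of
    [kappa]. *)

Section Majorants.
Variable R : realType.
Implicit Types (r s t v e d : R).

Lemma within_ge0P (f : R -> R) :
  {within `[0, +oo[%classic, continuous f} <->
  forall r, 0 <= r -> forall e, 0 < e ->
    exists2 d, 0 < d & forall s, 0 <= s -> `|s - r| < d -> `|f s - f r| < e.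
Proof.
split=> [/subspace_continuousP cf r r0 e e0|H].
- have := cf r; rewrite /= in_itv/= r0 => /(_ isT)/cvgrPdist_lt/(_ e e0).
  rewrite near_withinE => /nbhs_ballP[d/= d0 Hd]; exists d => // s s0 sr.
  rewrite distrC; apply: Hd; last by rewrite /= in_itv/= s0.
  by rewrite /ball/= distrC.
- apply/subspace_continuousP => r; rewrite /= in_itv/= andbT => r0.
  apply/cvgrPdist_lt => e e0; have [d d0 Hd] := H r r0 e e0.
  rewrite near_withinE; apply/nbhs_ballP; exists d => //= s.
  rewrite /ball/= in_itv/= andbT => rs s0; rewrite distrC; apply: Hd => //.
  by rewrite distrC.
Qed.

Definition ramp r : R := Num.min 1 (Num.max 0 (2 * r - 1)).

Lemma ramp_ge0 r : 0 <= ramp r.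
Proof. by rewrite /ramp le_min ler01 le_max lexx. Qed.

Lemma ramp_le1 r : ramp r <= 1.
Proof. by rewrite /ramp ge_min lexx. Qed.

Lemma ramp1 r : 1 <= r -> ramp r = 1.
Proof.
move=> r1; apply/le_anti; rewrite ramp_le1/= /ramp le_min lexx le_max.
by apply/orP; right; lra.
Qed.

Lemma ramp0 r : r <= 2^-1 -> ramp r = 0.
Proof.
move=> r1; apply/le_anti; rewrite ramp_ge0 andbT /ramp ge_min ge_max lexx.
by apply/orP; right; rewrite andTb; lra.
Qed.

Lemma ramp_lip r s : r <= s -> ramp r <= ramp s <= ramp r + 2 * (s - r).
Proof.
rewrite /ramp /Num.min /Num.max => rs.
by do !case: ifPn; rewrite -?leNgt; lra.
Qed.

(** The least majorant that decreases in [t] is a supremum over later times. A relation [W] rather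
    than a function lets all trajectories of a family be inserted at once; the last three hypotheses
    supply finiteness, continuity at [r = 0] and decay. *)
Lemma KL_majorant (W : R -> R -> R -> Prop) :
  (forall r t v, W r t v -> 0 <= r /\ 0 <= t) ->
  (forall r, exists B, forall r' t v, W r' t v -> r' <= r -> v <= B) ->
  (forall e, 0 < e ->
     exists2 d, 0 < d & forall r t v, W r t v -> r <= d -> v <= e) ->
  (forall r e, 0 < e ->
     exists T, forall r' t v, W r' t v -> r' <= r -> T <= t -> v <= e) ->
  exists2 beta, classKL beta & forall r t v, W r t v -> v <= beta r t.
Proof.
move=> Wpos Wbnd Wstab Watt.
(* The ramp is [0] for [r <= r' / 2] and [1] for [r >= r'], and makes the
   supremum continuous in [r]. *)
pose S r t := [set y | y = 0 \/ exists r' t' v,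
  [/\ W r' t' v, t <= t', 0 < r', 0 <= v & y = v * ramp (r / r')]].
pose G r t := sup (S r t).
have S0 r t : S r t 0 by left.
have SB r : 0 <= r -> exists2 B, 0 <= B & forall s t, 0 <= s -> s <= r ->
    forall y, S s t y -> y <= B.
  (* A nonzero ramp forces [r' < 2 * s], so only points of [W] below [2 * r] contribute. *)
  move=> r0; have [B HB] := Wbnd (2 * r); exists (Num.max B 0).
    by rewrite le_max lexx orbT.
  move=> s t s0 sr y [->|[r' [t' [v [wv tt r'0 v0 ->]]]]].
    by rewrite le_max lexx orbT.
  have [h|h] := leP (s / r') 2^-1; first by rewrite ramp0// mulr0 le_max lexx orbT.
  rewrite le_max; apply/orP; left.
  apply: (le_trans (ler_piMr v0 (ramp_le1 _))); apply: HB wv _.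
  by move: h; rewrite ltr_pdivlMr// => h; lra.
have Ssup r t : 0 <= r -> has_sup (S r t).
  move=> r0; split; first by exists 0.
  by have [B _ HB] := SB r r0; exists B => y; apply: HB.
have Gub r t y : 0 <= r -> S r t y -> y <= G r t.
  by move=> r0 Sy; apply: ub_le_sup => //; exact: (Ssup r t r0).2.
have Gle r t B : (forall y, S r t y -> y <= B) -> G r t <= B.
  by move=> H; apply: ge_sup; [exists 0|exact: H].
have G0 r t : 0 <= r -> 0 <= G r t by move=> r0; exact: Gub.
have Gmono r s t : 0 <= r -> r <= s -> G r t <= G s t.
  move=> r0 rs; apply: Gle => y [->|[r' [t' [v [wv tt r'0 v0 ->]]]]].
    by apply: G0; lra.
  have /andP[h _] : ramp (r / r') <= ramp (s / r') <= ramp (r / r') + 2 * (s / r' - r / r').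
    by apply: ramp_lip; rewrite ler_pM2r// invr_gt0.
  apply: le_trans (_ : v * ramp (s / r') <= _); first by rewrite ler_wpM2l.
  by apply: Gub; [lra|right; exists r', t', v].
have Gdec r s t : 0 <= r -> s <= t -> G r t <= G r s.
  move=> r0 st; apply: Gle => y [->|[r' [t' [v [wv tt r'0 v0 ->]]]]]; first exact: G0.
  by apply: Gub => //; right; exists r', t', v; split => //; lra.
have Gsmall r t e B : 0 <= r -> 0 <= e -> 2 * r <= B ->
    (forall r' t' v, W r' t' v -> r' <= B -> t <= t' -> v <= e) -> G r t <= e.
  move=> r0 e0 rB H; apply: Gle => y [->//|[r' [t' [v [wv tt r'0 v0 ->]]]]].
  have [h|h] := leP (r / r') 2^-1; first by rewrite ramp0// mulr0.
  apply: (le_trans (ler_piMr v0 (ramp_le1 _))); apply: H wv _ _ => //.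
  by move: h; rewrite ltr_pdivlMr// => h; lra.
have G00 t : G 0 t = 0.
  apply/le_anti; rewrite G0// andbT; apply: Gle => y [->//|[r' [t' [v [_ _ _ _ ->]]]]].
  by rewrite mul0r ramp0 ?mulr0// invr_ge0.
have Gcont t r : 0 <= r -> forall e, 0 < e ->
    exists2 d, 0 < d & forall s, 0 <= s -> `|s - r| < d -> `|G s t - G r t| < e.
  rewrite le_eqVlt => /predU1P[<- e e0|r0 e e0].
    (* At [r = 0] the slope bound used below for [r > 0] degenerates; continuity there is the
       stability hypothesis. *)
    have [d d0 Hd] := Wstab (e / 2) ltac:(lra); exists (d / 2); first lra.
    move=> s s0; rewrite subr0 G00 subr0 !ger0_norm ?G0// => sd.
    apply: (@le_lt_trans _ _ (e / 2)); last lra.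
    by apply: (Gsmall _ _ _ d) => //; try lra; move=> *; apply: Hd; eassumption.
  (* On [[r / 2, 2 * r]] only [r' < 4 * r] contribute. If [r' <= a], both ramps equal 1; otherwise
     [r' > r / 2], and since [ramp] is 2-Lipschitz the slope is at most [2 * max B 0 / (r / 2)],
     which is [C]. *)
  have [B HB] := Wbnd (4 * r).
  pose C := (Num.max B 0) * 4 / r.
  have C0 : 0 <= C.
    by rewrite /C; apply: divr_ge0; [apply: mulr_ge0; rewrite ?le_max ?lexx ?orbT//|lra].
  have key a b : r / 2 <= a -> a <= b -> b <= 2 * r -> G b t <= G a t + C * (b - a).
    move=> ra ab b2; have a0 : 0 <= a by lra.
    apply: Gle => y [->|[r' [t' [v [wv tt r'0 v0 ->]]]]].
      by rewrite addr_ge0 ?G0// mulr_ge0//; lra.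
    have Sa : v * ramp (a / r') <= G a t by apply: Gub => //; right; exists r', t', v.
    have abr : a / r' <= b / r' by rewrite ler_pM2r// invr_gt0.
    have [h|h] := leP r' a.
      rewrite (@ramp1 (b / r')).
        by move: Sa; rewrite ramp1 ?ler_pdivlMr ?mul1r// => Sa; rewrite ler_wpDr// mulr_ge0//; lra.
      by rewrite ler_pdivlMr// mul1r; lra.
    have [h2|h2] := leP (b / r') 2^-1.
      by rewrite ramp0// mulr0 addr_ge0 ?G0// mulr_ge0//; lra.
    have vB : v <= Num.max B 0.
      rewrite le_max; apply/orP; left; apply: HB wv _.
      by move: h2; rewrite ltr_pdivlMr//; lra.
    have /andP[_ h3] := ramp_lip abr.
    have h4 : v * ramp (b / r') <= v * ramp (a / r') + v * (2 * (b / r' - a / r')).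
      by rewrite -mulrDr ler_wpM2l.
    apply: (le_trans h4); apply: lerD => //; rewrite /C -mulrBl -!mulrA.
    apply: ler_pM => //; first by rewrite !mulr_ge0// ?invr_ge0; lra.
    have -> : 2 * ((b - a) / r') = (b - a) * (2 / r') by ring.
    have -> : 4 * (r^-1 * (b - a)) = (b - a) * (4 / r) by ring.
    apply: ler_wpM2l; first lra.
    by rewrite ler_pdivrMr// mulrAC ler_pdivlMr//; lra.
  exists (Num.min (r / 2) (e / (2 * (C + 1)))).
    by rewrite lt_min !divr_gt0//; lra.
  move=> s s0; rewrite lt_min => /andP[]; rewrite ltr_norml => /andP[sr1 sr2] sr3.
  have he : C * `|s - r| < e.
    have : (C + 1) * `|s - r| < e.
      move: sr3; rewrite ltr_pdivlMr; last lra.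
      have := normr_ge0 (s - r); nra.
    have := normr_ge0 (s - r); nra.
  have [srle|rs] := leP s r.
    rewrite distrC ger0_norm ?subr_ge0 ?Gmono//.
    have := key s r ltac:(lra) srle ltac:(lra).
    by move: he; rewrite ler0_norm; lra.
  rewrite ger0_norm ?subr_ge0 ?Gmono//; try lra.
  have := key r s ltac:(lra) (ltW rs) ltac:(lra).
  by move: he; rewrite ger0_norm; lra.
(* The extra term makes each time slice strictly increasing and unbounded, and still tends to 0 in
   [t]. *)
exists (fun r t => G r t + r / (1 + t)); last first.
  move=> r t v wv; have [r0 t0] := Wpos _ _ _ wv.
  have d0 : 0 <= r / (1 + t) by apply: divr_ge0; lra.
  have [v0|v0] := leP v 0; first by rewrite (le_trans v0)// addr_ge0// G0.
  suff : v <= G r t by lra.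
  have {d0} := r0; rewrite le_eqVlt => /predU1P[rE|{}r0].
    suff : v <= v / 2 by lra.
    have [d d0 Hd] := Wstab (v / 2) ltac:(lra); apply: Hd wv _; lra.
  apply: Gub; first lra.
  by right; exists r, t, v; split => //; rewrite ?ltW// divff ?gt_eqF// ramp1// mulr1.
split=> [t t0|r r0].
  have t1 : 0 < 1 + t by lra.
  split=> [|M].
    split; [apply/within_ge0P => r r0 e e0| |by rewrite G00 mul0r addr0].
      have [d d0 Hd] := Gcont t r r0 (e / 2) ltac:(lra).
      exists (Num.min d (e / 2)); first by rewrite lt_min d0; lra.
      move=> s s0; rewrite lt_min => /andP[s1 s2].
      have -> : G s t + s / (1 + t) - (G r t + r / (1 + t)) =
        (G s t - G r t) + (s - r) / (1 + t) by rewrite mulrBl; ring.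
      apply: (le_lt_trans (ler_normD _ _)).
      have := Hd s s0 s1; suff : `|(s - r) / (1 + t)| <= `|s - r| by lra.
      have i1 : (1 + t)^-1 <= 1 by rewrite invf_le1//; lra.
      have i0 : 0 <= (1 + t)^-1 by rewrite invr_ge0 ltW.
      by rewrite normrM (ger0_norm i0) ler_piMr.
    move=> r s r0 rs; apply: ler_ltD; first by apply: Gmono; lra.
    by rewrite ltr_pM2r// invr_gt0.
  have h0 : 0 <= (`|M| + 1) * (1 + t).
    by rewrite mulr_ge0//; have := normr_ge0 M; lra.
  exists ((`|M| + 1) * (1 + t)) => //.
  rewrite mulfK ?gt_eqF//.
  by have := G0 _ t h0; have := ler_norm M; lra.
split=> [s t s0 st|].
  apply: lerD; first exact: Gdec.
  rewrite ler_wpM2l// lef_pV2 ?lerD2l// posrE; lra.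
apply/cvgrPdist_le => e e0.
have [T HT] := Watt (2 * r) (e / 2) ltac:(lra).
near=> t.
have t1 : T <= t by near: t; apply: nbhs_pinfty_ge; rewrite num_real.
have t2 : (2 * r) / e <= t by near: t; apply: nbhs_pinfty_ge; rewrite num_real.
have t3 : 0 <= t by near: t; apply: nbhs_pinfty_ge; rewrite num_real.
have H1 : 0 <= r / (1 + t) by apply: divr_ge0; lra.
rewrite sub0r normrN ger0_norm; last by rewrite addr_ge0// G0.
have : G r t <= e / 2.
  apply: (Gsmall _ _ _ (2 * r)) => //; first lra.
  by move=> r' t' v wv r'r tt'; apply: HT wv _ _; lra.
suff : r / (1 + t) <= e / 2 by lra.
rewrite ler_pdivrMr; last lra.
by move: t2; rewrite ler_pdivrMr//; lra.
Unshelve. all: by end_near. Qed.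

(** A time slice of a KL majorant: with all data placed at [t = 0], attraction holds vacuously from
    time 1 on. *)
Lemma Kinf_majorant (W : R -> R -> Prop) :
  (forall r v, W r v -> 0 <= r) ->
  (forall r, exists B, forall r' v, W r' v -> r' <= r -> v <= B) ->
  (forall e, 0 < e -> exists2 d, 0 < d & forall r v, W r v -> r <= d -> v <= e) ->
  exists2 rho, classKinf rho & forall r v, W r v -> v <= rho r.
Proof.
move=> Wpos Wbnd Wstab.
have [|r|e e0|r e e0|beta bKL Hb] := @KL_majorant (fun r t v => t = 0 /\ W r v).
- by move=> r t v [-> /Wpos].
- by have [B HB] := Wbnd r; exists B => r' t v [_]; exact: HB.
- by have [d d0 Hd] := Wstab e e0; exists d => // r t v [_]; exact: Hd.
- by exists 1 => r' t v [-> _] _; lra.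
exists (beta^~ 0); first exact: bKL.1.
by move=> r v Wv; exact: Hb.
Qed.

(** Dual to the majorant: an infimum regularized by a penalty. The third hypothesis keeps it
    positive away from 0, the fourth makes it unbounded. *)
Lemma Kinf_minorant (W : R -> R -> Prop) :
  (forall r v, W r v -> 0 <= v) ->
  (exists p, W p.1 p.2) ->
  (forall r, 0 < r -> exists2 c, 0 < c & forall s v, W s v -> r <= s -> c <= v) ->
  (forall N, exists r, forall s v, W s v -> r <= s -> N <= v) ->
  exists2 alpha, classKinf alpha & forall r v, W r v -> 0 <= r -> alpha r <= v.
Proof.
move=> Wpos [p0 Wp0] Wc Winf.
(* The slope-[1] penalty makes the infimum [1]-Lipschitz in [s]. *)
pose S s := [set y | exists r v, W r v /\ y = v + Num.max 0 (s - r)].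
pose G s := inf (S s).
have Sne s : S s !=set0 by exists (p0.2 + Num.max 0 (s - p0.1)), p0.1, p0.2.
have Slb s : lbound (S s) 0.
  by move=> y [r [v [wv ->]]]; rewrite addr_ge0 ?(Wpos _ _ wv)// le_max lexx.
have Sinf s : has_inf (S s) by split; [exact: Sne|exists 0; exact: Slb].
have Gle s y : S s y -> G s <= y by move=> Sy; apply: ge_inf => //; exact: (Sinf s).2.
have Gge s c : (forall y, S s y -> c <= y) -> c <= G s.
  by move=> H; apply: lb_le_inf.
have G0 s : 0 <= G s by apply: Gge => y /Slb.
have Gmono s t : s <= t -> G s <= G t <= G s + (t - s).
  move=> st; apply/andP; split.
    apply: Gge => y [r [v [wv ->]]]; apply: le_trans (Gle _ _ _) _.
      by exists r, v; split; [exact: wv|reflexivity].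
    by rewrite lerD2l /Num.max; do !case: ifPn; rewrite -?leNgt; lra.
  rewrite -lerBlDr; apply: Gge => y [r [v [wv ->]]]; rewrite lerBlDr.
  apply: le_trans (Gle _ _ _) _.
    by exists r, v; split; [exact: wv|reflexivity].
  by rewrite -addrA lerD2l /Num.max; do !case: ifPn; rewrite -?leNgt; lra.
have Gpos s : 0 < s -> 0 < G s.
  move=> s0; have [c c0 Hc] := Wc (s / 2) ltac:(lra).
  apply: (@lt_le_trans _ _ (Num.min c (s / 2))); first by rewrite lt_min c0; lra.
  apply: Gge => y [r [v [wv ->]]]; rewrite ge_min.
  have [h|h] := leP (s / 2) r.
    apply/orP; left; apply: ler_wpDr; first by rewrite le_max lexx.
    exact: Hc wv h.
  apply/orP; right; apply: ler_wpDl; first exact: Wpos wv.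
  by rewrite le_max; apply/orP; right; lra.
(* [G] is only nondecreasing and may be positive at 0. The factor is at most 1, vanishes at 0 and is
   strictly increasing, which repairs both. *)
exists (fun s => s / (1 + s) * G s); last first.
  move=> r v wv r0; have : G r <= v.
    by apply: Gle; exists r, v; rewrite subrr maxxx addr0.
  apply: le_trans; rewrite ler_piMl//.
  by rewrite ler_pdivrMr; lra.
have qmono s t : 0 <= s -> s < t -> s / (1 + s) < t / (1 + t).
  move=> s0 st; rewrite ltr_pdivrMr; last lra.
  rewrite mulrAC ltr_pdivlMr; last lra.
  by nra.
have q0 s : 0 <= s -> 0 <= s / (1 + s) by move=> s0; apply: divr_ge0; lra.
have q1 s : 0 <= s -> s / (1 + s) <= 1 by move=> s0; rewrite ler_pdivrMr; lra.
have qlip s t : 0 <= s -> s <= t -> t / (1 + t) <= s / (1 + s) + (t - s).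
  move=> s0 st.
  have -> : s / (1 + s) + (t - s) = (s + (t - s) * (1 + s)) / (1 + s) by field; lra.
  rewrite ler_pdivrMr; last lra.
  rewrite mulrAC ler_pdivlMr; last lra.
  have := mulr_ge0 (mulr_ge0 s0 s0) (ltac:(lra) : 0 <= t - s).
  have := mulr_ge0 s0 (ltac:(lra) : 0 <= t - s).
  have := mulr_ge0 (mulr_ge0 s0 (ltac:(lra) : 0 <= t)) (ltac:(lra) : 0 <= t - s).
  have := mulr_ge0 (ltac:(lra) : 0 <= t) (ltac:(lra) : 0 <= t - s).
  nra.
have mono s t : 0 <= s -> s < t -> s / (1 + s) * G s < t / (1 + t) * G t.
  move=> s0 st; have := qmono s t s0 st; have := q0 s s0.
  have /andP[h1 _] := Gmono s t (ltW st).
  have := Gpos t ltac:(lra); have := G0 s => h2 h3 h4 h5.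
  apply: (@le_lt_trans _ _ (s / (1 + s) * G t)); first by rewrite ler_wpM2l.
  by rewrite ltr_pM2r.
split; last first.
  move=> M; have [r Hr] := Winf (2 * `|M| + 2).
  (* Either [r'] is beyond [r] and [Winf] bounds [v] from below, or the penalty alone exceeds
     [2 * |M| + 3]. Since [s >= 1], the factor [s / (1 + s)] costs at most one half. *)
  pose s := `|r| + 2 * `|M| + 3.
  have s1 : 1 <= s by rewrite /s; have := normr_ge0 r; have := normr_ge0 M; lra.
  exists s; first lra.
  have : 2^-1 <= s / (1 + s) by rewrite ler_pdivlMr; lra.
  have : 2 * `|M| + 2 <= G s.
    apply: Gge => y [r' [v [wv ->]]].
    have [h|h] := leP r r'.
      have : 0 <= Num.max 0 (s - r') by rewrite le_max lexx.
      by have := Hr _ _ wv h; lra.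
    have : s - r' <= Num.max 0 (s - r') by rewrite le_max lexx orbT.
    by have := Wpos _ _ wv; have := ler_norm r; rewrite /s; lra.
  have := ler_norm M; have := normr_ge0 M => h1 h2 h3 h4.
  apply: (@lt_le_trans _ _ (2^-1 * (2 * `|M| + 2))); first lra.
  by apply: ler_pM => //; lra.
split; [|exact: mono|by rewrite mul0r mul0r].
apply/within_ge0P => r r0 e e0.
(* Lipschitz constant of the product on [[0, r + 1]]: both factors are 1-Lipschitz, the first is
   bounded by 1 and the second by [G (r + 1)]. *)
pose C := G (r + 1) + 1.
have C1 : 1 <= C by rewrite /C; have := G0 (r + 1); lra.
have lip s t : 0 <= s -> s <= t -> t <= r + 1 ->
    t / (1 + t) * G t <= s / (1 + s) * G s + C * (t - s).
  move=> s0 st tr.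
  have /andP[h1 h2] := Gmono s t st.
  have := qlip s t s0 st; have := q0 s s0; have := q1 s s0; have := G0 s.
  have /andP[h4 _] := Gmono t (r + 1) tr.
  have h5 := G0 t.
  move=> h6 h7 h8 h9.
  have : t / (1 + t) * G t <= (s / (1 + s) + (t - s)) * G t by rewrite ler_wpM2r.
  have : s / (1 + s) * G t <= s / (1 + s) * (G s + (t - s)) by rewrite ler_wpM2l.
  have : (t - s) * G t <= (t - s) * G (r + 1) by rewrite ler_wpM2l//; lra.
  have : s / (1 + s) * (t - s) <= t - s by rewrite ler_piMl//; lra.
  rewrite /C; nra.
exists (Num.min 1 (e / (2 * C))); first by rewrite lt_min ltr01 divr_gt0//; lra.
move=> s s0; rewrite lt_min => /andP[s1 s2].
have h : C * `|s - r| < e.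
  by move: s2; rewrite ltr_pdivlMr; last lra; have := normr_ge0 (s - r); nra.
move: s1 h; have [sr|rs] := leP s r.
  rewrite (distrC s r) (@ger0_norm _ (r - s)) ?subr_ge0// => s1 h; rewrite distrC.
  have := lip s r s0 sr ltac:(lra).
  rewrite ger0_norm; first lra.
  by rewrite subr_ge0; move: sr; rewrite le_eqVlt => /predU1P[->//|sr]; exact/ltW/mono.
rewrite (@ger0_norm _ (s - r)); last lra.
move=> s1 h; have := lip r s r0 (ltW rs) ltac:(lra).
rewrite ger0_norm; first lra.
by rewrite subr_ge0; exact/ltW/mono.
Qed.

End Majorants.

(** * Differential inequalities almost everywhere *)

Section EuclideanNorm.
Variables (R : realType) (n : nat).
Implicit Types (x y z : 'rV[R]_n) (c : R).

Lemma enorm_ge0 x : 0 <= enorm x.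
Proof. exact: sqrtr_ge0. Qed.

Lemma enorm_sqr x : enorm x ^+ 2 = \sum_(i < n) x 0 i ^+ 2.
Proof. by rewrite sqr_sqrtr// sumr_ge0// => i _; rewrite sqr_ge0. Qed.

Lemma enorm0 : enorm (0 : 'rV[R]_n) = 0.
Proof.
by rewrite /enorm big1 ?sqrtr0// => i _; rewrite mxE expr0n.
Qed.

Lemma ler_coord_enorm x i : `|x 0 i| <= enorm x.
Proof.
rewrite -sqrtr_sqr ler_wsqrtr// (bigD1 i)//= lerDl.
by rewrite sumr_ge0// => j _; rewrite sqr_ge0.
Qed.

Lemma enorm_eq0 x : enorm x = 0 -> x = 0.
Proof.
move=> x0; apply/rowP => i; rewrite mxE; apply/eqP; rewrite -normr_le0.
by rewrite -x0 ler_coord_enorm.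
Qed.

Lemma enormZ c x : enorm (c *: x) = `|c| * enorm x.
Proof.
rewrite /enorm -sqrtr_sqr -sqrtrM ?sqr_ge0//; congr Num.sqrt.
by rewrite mulr_sumr; apply: eq_bigr => i _; rewrite mxE exprMn.
Qed.

Lemma enormN x : enorm (- x) = enorm x.
Proof. by rewrite -scaleN1r enormZ normrN1 mul1r. Qed.

Lemma enormBC x y : enorm (x - y) = enorm (y - x).
Proof. by rewrite -opprB enormN. Qed.

(** Cauchy-Schwarz, from expanding the sum of the squares of [b * x 0 i - a * y 0 i]; the null
    vectors are split off so that one may divide by [a * b]. *)
Lemma dot_le_enorm x y : \sum_(i < n) x 0 i * y 0 i <= enorm x * enorm y.
Proof.
set a := enorm x; set b := enorm y.
have [/enorm_eq0 ->|a0] := eqVneq a 0.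
  by rewrite big1 ?mulr_ge0 ?enorm_ge0// => i _; rewrite mxE mul0r.
have [/enorm_eq0 ->|b0] := eqVneq b 0.
  by rewrite big1 ?mulr_ge0 ?enorm_ge0// => i _; rewrite mxE mulr0.
have {}a0 : 0 < a by rewrite lt0r a0 enorm_ge0.
have {}b0 : 0 < b by rewrite lt0r b0 enorm_ge0.
have : 0 <= \sum_(i < n) (b * x 0 i - a * y 0 i) ^+ 2.
  by rewrite sumr_ge0// => i _; rewrite sqr_ge0.
have -> : \sum_(i < n) (b * x 0 i - a * y 0 i) ^+ 2 =
    b ^+ 2 * (\sum_(i < n) x 0 i ^+ 2) - 2 * a * b * (\sum_(i < n) x 0 i * y 0 i)
    + a ^+ 2 * (\sum_(i < n) y 0 i ^+ 2).
  rewrite !mulr_sumr -sumrB -big_split/=; apply: eq_bigr => i _; ring.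
rewrite -!enorm_sqr -/a -/b => h.
have ab : 0 < a * b by rewrite mulr_gt0.
by rewrite -(ler_pM2l ab); nra.
Qed.

Lemma ler_enormD x y : enorm (x + y) <= enorm x + enorm y.
Proof.
rewrite -(@ler_pXn2r _ 2)// ?nnegrE ?addr_ge0 ?enorm_ge0//.
rewrite enorm_sqr.
have -> : \sum_(i < n) (x + y) 0 i ^+ 2 =
    (\sum_(i < n) x 0 i ^+ 2) + 2 * (\sum_(i < n) x 0 i * y 0 i) + \sum_(i < n) y 0 i ^+ 2.
  rewrite mulr_sumr -!big_split/=; apply: eq_bigr => i _; rewrite mxE; ring.
rewrite -!enorm_sqr; have := dot_le_enorm x y; nra.
Qed.

Lemma ler_enormB x y : enorm (x - y) <= enorm x + enorm y.
Proof. by rewrite (le_trans (ler_enormD _ _))// enormN. Qed.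

Lemma ler_enorm_dist z x y : enorm (x - y) <= enorm (x - z) + enorm (z - y).
Proof. by rewrite (le_trans _ (ler_enormD _ _))// addrA subrK. Qed.

Lemma ler_enorm_sub x y : enorm x <= enorm y + enorm (x - y).
Proof. by rewrite (le_trans _ (ler_enormD _ _))// addrC subrK. Qed.

Lemma ler_dist_enorm x y : `|enorm x - enorm y| <= enorm (x - y).
Proof.
rewrite ler_norml; have := ler_enorm_sub x y; have := ler_enorm_sub y x.
by rewrite (enormBC y x) => ? ?; apply/andP; split; lra.
Qed.

Lemma enorm_sum x : enorm x <= \sum_(i < n) `|x 0 i|.
Proof.
rewrite -(@ler_pXn2r _ 2)// ?nnegrE ?enorm_ge0 ?sumr_ge0//.
rewrite enorm_sqr.
have H (s : seq 'I_n) : \sum_(i <- s) x 0 i ^+ 2 <= (\sum_(i <- s) `|x 0 i|) ^+ 2.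
  elim: s => [|i s ih]; first by rewrite !big_nil expr0n.
  rewrite !big_cons sqrrD -[x 0 i ^+ 2]real_normK ?num_real//.
  have := mulr_ge0 (normr_ge0 (x 0 i)) (sumr_ge0 s (fun j _ => normr_ge0 (x 0 j)) : 0 <= \sum_(j <- s) `|x 0 j|).
  lra.
exact: H.
Qed.

Lemma enorm_le_mxnorm x : enorm x <= n%:R * `|x|.
Proof.
apply: (le_trans (enorm_sum x)).
apply: (@le_trans _ _ (\sum_(i < n) `|x|)); last by rewrite sumr_const card_ord mulr_natl.
apply: ler_sum => i _; rewrite [leRHS]mx_normrE.
by apply: le_trans (le_bigmax _ _ (ord0, i)).
Qed.

Lemma mxnorm_le_enorm x : `|x| <= enorm x.
Proof.
rewrite [leLHS]mx_normrE; apply/bigmax_leP; split; first exact: enorm_ge0.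
by move=> [i j] _ /=; rewrite (ord1 i) ler_coord_enorm.
Qed.

(** Convergence of row vectors refers to the sup norm; the two norms bound each other up to the
    factor [n]. *)
Lemma cvg_enormP (T : Type) (F : set_system T) (FF : Filter F) (f : T -> 'rV[R]_n) x :
  f @ F --> x <-> forall e, 0 < e -> \forall t \near F, enorm (f t - x) < e.
Proof.
split=> [/cvgrPdist_lt H e e0|H].
  (* [n.+1] keeps the divisor nonzero in dimension 0. *)
  have := H (e / n.+1%:R) (divr_gt0 e0 (ltr0Sn _ _)); apply: filterS => t.
  rewrite distrC ltr_pdivlMr// => h; apply: le_lt_trans (enorm_le_mxnorm _) _.
  apply: le_lt_trans h; rewrite mulrC ler_wpM2l// ler_nat; exact: leqnSn.
apply/cvgrPdist_lt => e e0; have := H e e0; apply: filterS => t.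
by rewrite distrC => h; apply: le_lt_trans (mxnorm_le_enorm _) _.
Qed.

Lemma is_derive_enorm (X : R -> 'rV[R]_n) (t : R) (w : 'rV[R]_n) :
  is_derive t (1 : R) X w ->
  forall e, 0 < e -> exists2 d, 0 < d &
    forall s, `|s - t| < d -> enorm (X s - X t - (s - t) *: w) <= e * `|s - t|.
Proof.
move=> [dX <-] e e0.
have /cvg_enormP/(_ e e0)/nbhs_ballP[d/= d0 Hd] := dX.
exists d => // s std.
have [->|st] := eqVneq s t; first by rewrite !subrr scale0r subr0 enorm0 normr0 mulr0.
have st0 : s - t != 0 by rewrite subr_eq0.
have := Hd (s - t); rewrite /ball/= sub0r normrN => /(_ std st0).
rewrite /GRing.scale/= mulr1 subrK => h.
have -> : X s - X t - (s - t) *: 'D_1 X t =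
    (s - t) *: ((s - t)^-1 *: (X s - X t) - 'D_1 X t).
  by rewrite scalerBr scalerA divff// scale1r.
by rewrite enormZ mulrC ler_wpM2r//; exact/ltW/h.
Qed.

Lemma is_derive_coord (X : R -> 'rV[R]_n) (t : R) (w : 'rV[R]_n) :
  (forall i, is_derive t (1 : R) (fun s => X s 0 i) (w 0 i)) ->
  is_derive t (1 : R) X w.
Proof.
move=> H; have dX : derivable X t 1.
  by apply/derivable_mxP => i j; rewrite (ord1 i); have [] := H j.
split => //; rewrite derive_mx//; apply/rowP => j; rewrite mxE.
by have [_ ->] := H j.
Qed.

End EuclideanNorm.

Lemma Lmeasurable_enorm (R : realType) n (D : set R) (h : R -> 'rV[R]_n) :
  Lmeasurable D h ->
  measurable_fun (D : set (caratheodory_type (wlength (@idfun R))^*%mu))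
    (fun t => enorm (h t) : measurableTypeR R).
Proof.
move=> mh; rewrite /enorm.
apply: (@measurableT_comp _ _ _ _ _ _ (Num.sqrt : measurableTypeR R -> measurableTypeR R)).
  exact: (@continuous_measurable_fun R (@Num.sqrt R) (@sqrt_continuous R)).
apply: measurable_sum => i; apply: measurable_funX; exact: mh.
Qed.

(** Monotonicity already gives Borel measurability, so this also covers the gain with a jump at the
    truncation radius. *)
Lemma Lmeasurable_mono_comp (R : realType) (D : set R) (f g : R -> R) :
  (forall r s, 0 <= r -> r <= s -> f r <= f s) -> (forall t, 0 <= g t) ->
  measurable_fun (D : set (caratheodory_type (wlength (@idfun R))^*%mu))
    (g : _ -> measurableTypeR R) ->
  measurable_fun (D : set (caratheodory_type (wlength (@idfun R))^*%mu))
    ((fun t => f (g t)) : _ -> measurableTypeR R).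
Proof.
move=> fmono g0 mg.
have -> : (fun t => f (g t)) = (fun r => f (Num.max 0 r)) \o g.
  by apply/funext => t /=; rewrite max_r.
apply: measurableT_comp => //; apply: nondecreasing_measurable => // r s rs.
apply: fmono; first by rewrite le_max lexx.
by rewrite /Num.max; do !case: ifPn; rewrite -?leNgt; lra.
Qed.

Section NullSets.
Variable R : realType.

Lemma aeS (P Q : R -> Prop) : (forall t, P t -> Q t) ->
  {ae lebR R, forall t, P t} -> {ae lebR R, forall t, Q t}.
Proof. by move=> PQ; apply: (@filterS _ _ (ae_filter_ringOfSetsType _)). Qed.

Lemma aeI (P Q : R -> Prop) :
  {ae lebR R, forall t, P t} -> {ae lebR R, forall t, Q t} ->
  {ae lebR R, forall t, P t /\ Q t}.
Proof. exact: (@filterI _ _ (ae_filter_ringOfSetsType _)). Qed.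

Lemma ae_true (P : R -> Prop) : (forall t, P t) -> {ae lebR R, forall t, P t}.
Proof.
by move=> HP; apply: (@filterE _ _ (ae_filter_ringOfSetsType _)).
Qed.

Lemma ae_lebesgue_completed (P : R -> Prop) :
  {ae @lebesgue_measure R, forall t, P t} -> {ae lebR R, forall t, P t}.
Proof.
move=> [A [mA A0 PA]]; exists A; split => //.
exact: sub_caratheodory.
Qed.

Lemma ae_neq (c : R) : {ae lebR R, forall t, t != c}.
Proof.
apply: ae_lebesgue_completed; exists [set c]; split => //.
  exact: lebesgue_measure_set1.
by move=> t /= /negP; rewrite negbK => /eqP ->.
Qed.

Lemma ae_open_cover (P : R -> Prop) (e : R) : {ae lebR R, forall t, P t} ->
  0 < e -> exists U : set R, [/\ open U, forall t, ~ P t -> U t &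
    (lebesgue_measure U <= e%:E)%E].
Proof.
move=> [A [_ A0 PA]] e0.
have [U [oU AU mU]] := @outer_measure_open_le R A e e0.
exists U; split => //; first by move=> t nP; exact/AU/PA.
by move: mU; rewrite (_ : ((wlength idfun)^* A)%mu = 0%E) ?add0e.
Qed.

End NullSets.

(** * Monotonicity from derivative bounds outside a null set *)

Section RealInduction.
Variable R : realType.
Implicit Types (U : set R) (l : seq (R * R)) (F : R -> R).

(* The intervals of [l], listed from right to left, lie in [U] and in [a, c]. *)
Fixpoint interval_chain U (a c : R) l : Prop :=
  if l is pq :: l' then
    [/\ pq.1 <= pq.2, pq.2 <= c, `[pq.1, pq.2] `<=` U & interval_chain U a pq.1 l']
  else a <= c.

Lemma interval_chain_le U a c c' l :
  c <= c' -> interval_chain U a c l -> interval_chain U a c' l.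
Proof. by case: l => [|[p q] l] cc /=; [lra|move=> [? ? ? ?]; split => //; lra]. Qed.

Lemma interval_chain_ge U a c l : interval_chain U a c l -> a <= c.
Proof. by elim: l c => [|[p q] l ih] c //= [pq qc _ /ih]; lra. Qed.

Lemma interval_chain_length U a c l : open U -> interval_chain U a c l ->
  ((\sum_(x <- l) (x.2 - x.1))%:E <= lebesgue_measure (U `&` `]a, c]))%E.
Proof.
move=> oU; have mU : measurable U by exact: open_measurable.
elim: l c => [|[p q] l ih] c /=; first by rewrite big_nil => _; exact: measure_ge0.
move=> [pq qc pqU /[dup] /interval_chain_ge ap /ih H].
rewrite big_cons/= EFinD.
apply: (@le_trans _ _ (lebesgue_measure (`]p, q] `|` (U `&` `]a, p])))).
  rewrite measureU//=; last 2 first.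
  - exact: measurableI.
  - apply/seteqP; split => // t [] /=; rewrite !in_itv/= => /andP[h1 _] [_ /andP[_ h2]].
    by move: (lt_le_trans h1 h2); rewrite ltxx.
  apply: leeD H.
  rewrite lebesgue_measure_itv/=; case: ifPn => //.
  by rewrite lte_fin -leNgt => qp; rewrite lee_fin; lra.
apply: le_measure; rewrite ?inE; [|exact: measurableI|].
  by apply: measurableU => //; exact: measurableI.
move=> t [|[Ut]] /=; rewrite !in_itv/= => /andP[h1 h2].
  split; first by apply: pqU; rewrite /= in_itv/= h2 ltW.
  by rewrite /= ?in_itv/=; apply/andP; split; lra.
by split => //; rewrite /= ?in_itv/= h1; lra.
Qed.

Lemma interval_chain_nth U a c l x0 : interval_chain U a c l ->
  forall i, (i < size l)%N ->
    [/\ a <= (nth x0 l i).1, (nth x0 l i).1 <= (nth x0 l i).2,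
        (nth x0 l i).2 <= c &
        forall j, (i < j < size l)%N -> (nth x0 l j).2 <= (nth x0 l i).1].
Proof.
elim: l c => [|[p q] l ih] c //= [pq qc _ /[dup] /interval_chain_ge ap /ih H] [_|i].
  split => //= -[//|j]; rewrite /= ltnS => jl.
  by have [] := H _ jl.
rewrite ltnS => il; have [h1 h2 h3 h4] := H _ il; split => //=; first lra.
by case=> [//|j]; rewrite /= !ltnS; exact: h4.
Qed.

(* Real induction: the points to the left of which [F] has gained at most [e]
   times the length, up to intervals inside a small open set [U] containing the
   exceptional points; absolute continuity controls the gain inside [U]. *)
Lemma ae_nonincreasing F (a b : R) : a <= b ->
  (forall e, 0 < e -> exists2 d, 0 < d & forall N (p q : 'I_N -> R),
     (forall i, [/\ a <= p i, p i <= q i & q i <= b]) ->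
     trivIset setT (fun i => `]p i, q i[%classic) ->
     \sum_(i < N) (q i - p i) < d -> \sum_(i < N) (F (q i) - F (p i)) < e) ->
  {ae lebR R, forall t, a < t -> t < b -> forall e, 0 < e ->
     exists2 d, 0 < d & forall s, a <= s -> s <= b -> `|s - t| < d ->
       (t <= s -> F s - F t <= e * (s - t)) /\
       (s <= t -> F t - F s <= e * (t - s))} ->
  F b <= F a.
Proof.
move=> ab AC good.
(* The part [b - a] pays for slope [e] outside [U], the 1 for a total gain below [e] inside [U]. *)
suff H e : 0 < e -> F b - F a <= e * (b - a + 1).
  rewrite -subr_le0; apply/ler_addgt0Pr => e e0; rewrite add0r.
  have := H (e / (b - a + 1)) ltac:(apply: divr_gt0; lra).
  by rewrite mulfVK//; lra.
move=> e0; have [d d0 Hd] := AC e e0.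
(* The slope hypothesis concerns interior points only, so both end points join the exceptional
   set. *)
have {}good := aeI good (aeI (ae_neq a) (ae_neq b)).
have [U [oU PU mU]] := ae_open_cover good (ltac:(lra) : 0 < d / 2).
have {good PU} alt t : a <= t -> t <= b -> U t \/ exists2 d, 0 < d &
    forall s, a <= s -> s <= b -> `|s - t| < d ->
      (t <= s -> F s - F t <= e * (s - t)) /\
      (s <= t -> F t - F s <= e * (t - s)).
  move=> at0 tb; have [Ut|nUt] := pselect (U t); [by left|right].
  have /contrapT [h [/eqP h1 /eqP h2]] := contra_not (PU t) nUt.
  by apply: h => //; rewrite lt_neqAle ?at0 ?tb andbT; apply/eqP => //; exact: nesym.
pose claim c := [/\ a <= c, c <= b & exists2 l, interval_chain U a c l &
  F c - F a <= e * (c - a) + \sum_(x <- l) (F x.2 - F x.1)].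
have step c t : claim c -> c <= t -> t <= b ->
    (`[c, t] `<=` U \/ F t - F c <= e * (t - c)) -> claim t.
  move=> [ac cb [l cl Fl]] ct tb H; split => //; first lra.
  case: H => [cU|FF].
    exists ((c, t) :: l); first by split.
    by rewrite big_cons/=; have := mulr_ge0 (ltW e0) (ltac:(lra) : 0 <= t - c); lra.
  by exists l; [exact: interval_chain_le cl|lra].
have ca : claim a.
  by split => //; exists [::] => //=; rewrite big_nil; lra.
have Sub : has_sup claim by split; [exists a|exists b => c []].
pose c := sup claim.
have cub x : claim x -> x <= c by move=> cx; apply: ub_le_sup => //; exact: Sub.2.
have ac : a <= c by exact: cub.
have cb : c <= b by apply: ge_sup => [|x []//]; exists a.
(* One radius serves both halves of the induction: the claim passes from the left of [c] to [c], and
   from [c] to its right. *)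
have [r r0 Hr] : exists2 r, 0 < r & forall x y, claim x -> x <= y -> y <= b ->
    (x = c \/ y = c) -> `|y - x| < r -> claim y.
  case: (alt c ac cb) => [Uc|[r r0 Hr]].
    have /nbhs_ballP[r /= r0 Hr] := open_nbhs_nbhs (conj oU Uc).
    exists r => // x y cx xy yb xyc yxr; apply: step cx xy yb _; left.
    move=> z /=; rewrite in_itv/= => /andP[xz zy]; apply: Hr; rewrite /ball/=.
    move: yxr; rewrite ger0_norm; last lra.
    move=> yxr; rewrite ltr_norml; apply/andP.
    by case: xyc => xyc; split; lra.
  exists r => // x y cx xy yb xyc yxr; apply: step (cx) (xy) (yb) _; right.
  have [ax _ _] := cx.
  have ay : a <= y by exact: le_trans ax xy.
  have xb : x <= b by exact: le_trans xy yb.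
  case: xyc => E.
    have [] := Hr y ay yb; rewrite -E// => + _; exact.
  have [] := Hr x ax xb; first by rewrite -E distrC.
  by move=> _; rewrite -E; exact.
have cc : claim c.
  have [x cx xc] := sup_adherent r0 Sub.
  apply: (Hr x) => //; [exact: cub|by right|].
  by rewrite ger0_norm; [rewrite -/c in xc; lra|rewrite subr_ge0; exact: cub].
have cbE : c = b.
  apply/le_anti; rewrite cb/= leNgt; apply/negP => cltb.
  pose y := Num.min b (c + r / 2).
  have yc : c < y by rewrite lt_min cltb; lra.
  have y2 : y <= c + r / 2 by rewrite ge_min lexx orbT.
  have : claim y.
    apply: (Hr c) => //; [exact: ltW|by rewrite ge_min lexx|by left|].
    by rewrite ger0_norm; lra.
  by move/cub; lra.
have [_ _ [l cl Fl]] := cc; rewrite cbE in cl Fl.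
pose p (i : 'I_(size l)) := (nth (0, 0) l i).1.
pose q (i : 'I_(size l)) := (nth (0, 0) l i).2.
have big_nth_l (G : R * R -> R) : \sum_(x <- l) G x = \sum_(i < size l) G (p i, q i).
  by rewrite (big_nth (0, 0)) big_mkord; apply: eq_bigr => i _; rewrite /p /q -surjective_pairing.
have := Hd _ p q; rewrite -(big_nth_l (fun x => F x.2 - F x.1)) -(big_nth_l (fun x => x.2 - x.1)).
move=> HH; suff : \sum_(x <- l) (F x.2 - F x.1) < e by lra.
apply: HH.
- by move=> i; have [] := interval_chain_nth (0, 0) cl (ltn_ord i).
- apply/trivIsetP => i j _ _; wlog : i j / (i < j)%N.
    move=> W ij; have := ij; rewrite neq_ltn => /orP[h|h]; first exact: W.
    by rewrite setIC; apply: W => //; rewrite eq_sym.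
  move=> ij _; apply/seteqP; split => // t [] /=; rewrite !in_itv/= => /andP[h1 _] /andP[_ h2].
  have [_ _ _ /(_ j)] := interval_chain_nth (0, 0) cl (ltn_ord i).
  by rewrite ij ltn_ord => /(_ isT); rewrite -/(p i) -/(q j); lra.
- rewrite -lte_fin; apply: (@le_lt_trans _ _ (d / 2)%:E); last by rewrite lte_fin; lra.
  apply: le_trans (interval_chain_length oU cl) _.
  apply: le_trans mU; apply: le_measure; rewrite ?inE//.
  - by apply: measurableI => //; exact: open_measurable.
  - exact: open_measurable.
Qed.

Lemma is_derive_approx F (t w : R) :
  is_derive t (1 : R) F w ->
  forall e, 0 < e -> exists2 d, 0 < d &
    forall s, `|s - t| < d -> `|F s - F t - (s - t) * w| <= e * `|s - t|.
Proof.
move=> [dF <-] e e0.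
have /cvgrPdist_lt/(_ e e0)/nbhs_ballP[d/= d0 Hd] := dF.
exists d => // s std.
have [->|st] := eqVneq s t; first by rewrite !subrr mul0r subr0 normr0 mulr0.
have st0 : s - t != 0 by rewrite subr_eq0.
have := Hd (s - t); rewrite /ball/= sub0r normrN => /(_ std st0).
rewrite /GRing.scale/= mulr1 subrK => h.
have -> : F s - F t - (s - t) * 'D_1 F t =
    (s - t) * ((s - t)^-1 * (F s - F t) - 'D_1 F t).
  by rewrite mulrBr mulrA divff// mul1r.
by rewrite normrM mulrC ler_wpM2r// distrC; exact/ltW/h.
Qed.

End RealInduction.

Lemma ler_dist_min (R : realType) (x y c : R) :
  `|Num.min x c - Num.min y c| <= `|x - y|.
Proof.
have h1 := ler_norm (x - y); have h2 := ler_norm (y - x).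
rewrite (distrC y) in h2; rewrite ler_norml.
by rewrite /Num.min; do !case: ifPn; rewrite -?leNgt => *; apply/andP; split; lra.
Qed.

Section Gronwall.
Variables (R : realType) (n : nat).
Implicit Types (X : R -> 'rV[R]_n) (G : R -> R).

(* The bound on the derivative is only required while [|X|] is below [theta]:
   the proof applies [ae_nonincreasing] to [|X|] truncated at [theta]. *)
Lemma gronwall X G (a b C theta : R) :
  a <= b -> 0 <= C -> 0 < theta -> abs_continuous a b X ->
  (forall s t, a <= s -> s <= t -> t <= b -> G s <= G t) ->
  {ae lebR R, forall t, a < t -> t < b -> exists w g,
     [/\ is_derive t (1 : R) X w, is_derive t (1 : R) G g, 0 <= g &
         enorm (X t) <= theta -> enorm w <= g + C * enorm (X t)]} ->
  (enorm (X a) + (G b - G a)) * expR (C * (b - a)) < theta ->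
  enorm (X b) <= (enorm (X a) + (G b - G a)) * expR (C * (b - a)).
Proof.
move=> ab C0 th0 AC Gmono dX small.
pose E t := expR (- C * (t - a)).
pose D t := Num.min (enorm (X t)) theta.
(* [E] is the integrating factor: where the truncation is inactive, the growth rate of [E * D] is at
   most [E * g <= g], the rate of [G]. *)
pose F t := E t * D t - G t.
have E0 t : 0 < E t by exact: expR_gt0.
have Emono s t : s <= t -> E t <= E s.
  by move=> st; rewrite ler_expR; have := mulr_ge0 C0 (ltac:(lra) : 0 <= t - s); lra.
have Ea : E a = 1 by rewrite /E subrr mulr0 expR0.
have E1 t : a <= t -> E t <= 1 by move=> at0; rewrite -Ea Emono.
have D0 t : 0 <= D t by rewrite le_min enorm_ge0 ltW.
have Dth t : D t <= theta by rewrite ge_min lexx orbT.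
have DX t : D t <= enorm (X t) by rewrite ge_min lexx.
have Dlip s t : `|D s - D t| <= enorm (X s - X t).
  exact: le_trans (ler_dist_min _ _ _) (ler_dist_enorm _ _).
(* Since [E] decreases and [G] increases, upward increments of [F] are controlled by [X] alone, so
   absolute continuity of [X] suffices. *)
have Finc p q : a <= p -> p <= q -> q <= b -> F q - F p <= enorm (X q - X p).
  move=> ap pq qb; have := Gmono p q ap pq qb => G1.
  have := ler_norm (D q - D p); have := Dlip q p => h1 h2.
  have h3 : E q * (D q - D p) <= `|D q - D p|.
    apply: (@le_trans _ _ (E q * `|D q - D p|)); first by rewrite ler_wpM2l// ltW.
    by rewrite ler_piMl// E1//; lra.
  have h4 : (E q - E p) * D p <= 0.
    by rewrite mulr_le0_ge0// subr_le0 Emono.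
  rewrite /F; lra.
have FF : F b <= F a.
  apply: ae_nonincreasing => //.
    move=> e e0; have [d d0 Hd] := AC e e0; exists d => // N p q pq tr len.
    apply: le_lt_trans (Hd N p q pq tr len).
    by apply: ler_sum => i _; have [? ? ?] := pq i; apply: Finc.
  move: dX; apply: aeS => t + at0 tb => /(_ at0 tb)[w [g [dXt dGt g0 wg]]] e e0.
  (* Above [theta] the truncated norm is locally constant, and [F] decreases because [E] and [- G]
     do. *)
  have [Xth|Xth] := ltP theta (enorm (X t)).
    have [d1 d10 H1] := is_derive_enorm dXt ltr01.
    pose K := enorm w + 1.
    have K0 : 0 < K by rewrite /K; have := enorm_ge0 w; lra.
    exists (Num.min d1 ((enorm (X t) - theta) / K)).
      by rewrite lt_min d10 divr_gt0//; lra.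
    move=> s sa sb; rewrite lt_min => /andP[s1 s2].
    have Xs : theta < enorm (X s).
      have := H1 s s1; rewrite mul1r => h1.
      have h2 : enorm (X t - X s) <= K * `|s - t|.
        have -> : X t - X s = - ((X s - X t - (s - t) *: w) + (s - t) *: w).
          by rewrite subrK opprB.
        rewrite enormN; apply: le_trans (ler_enormD _ _) _.
        by rewrite enormZ /K; lra.
      have := ler_enorm_sub (X t) (X s).
      by move: s2; rewrite ltr_pdivlMr// ; lra.
    have Ds : D s = theta by rewrite /D min_r// ltW.
    have Dt : D t = theta by rewrite /D min_r// ltW.
    rewrite /F Ds Dt; split => st.
      have h1 := Gmono t s (ltW at0) st sb.
      have h2 : (E s - E t) * theta <= 0 by rewrite mulr_le0_ge0 ?subr_le0 ?Emono// ltW.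
      by have := mulr_ge0 (ltW e0) (ltac:(lra) : 0 <= s - t); lra.
    have h1 := Gmono s t sa st (ltW tb).
    have h2 : (E t - E s) * theta <= 0 by rewrite mulr_le0_ge0 ?subr_le0 ?Emono// ltW.
    by have := mulr_ge0 (ltW e0) (ltac:(lra) : 0 <= t - s); lra.
  have {wg}wg := wg Xth.
  have DtE : D t = enorm (X t) by rewrite /D min_l.
  (* [K] counts the errors of size [e']: [enorm w] from replacing [E s] by [E t], [theta] from the
     remainder of [E], and one each from the remainders of [X] and [G]. *)
  pose K := enorm w + theta + 2.
  have K0 : 0 < K by rewrite /K; have := enorm_ge0 w; lra.
  pose e' := e / K.
  have e'0 : 0 < e' by exact: divr_gt0.
  have e'K : e' * K = e by rewrite /e' mulfVK// gt_eqF.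
  have [d1 d10 H1] := is_derive_enorm dXt e'0.
  have [d2 d20 H2] := is_derive_approx dGt e'0.
  have dE : is_derive t (1 : R) E (- C * E t).
    rewrite /E; apply: is_derive_eq.
    by rewrite /GRing.scale/=; ring.
  have [d3 d30 H3] := is_derive_approx dE e'0.
  have cE : {for t, continuous E}.
    by apply: differentiable_continuous; apply/derivable1_diffP; case: dE.
  have /cvgrPdist_lt/(_ _ e'0)/nbhs_ballP[d4 /= d40 H4] := cE.
  exists (Num.min (Num.min d1 d2) (Num.min d3 d4)).
    by rewrite !lt_min d10 d20 d30 d40.
  move=> s sa sb; rewrite !lt_min => /andP[/andP[s1 s2] /andP[s3 s4]].
  have {}H1 := H1 s s1; have {}H2 := H2 s s2; have {}H3 := H3 s s3.
  have {H4} : `|E t - E s| < e' by apply: H4; rewrite /ball/= distrC.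
  rewrite ltr_norml => /andP[h41 h42].
  pose r := `|s - t|.
  have r0 : 0 <= r by exact: normr_ge0.
  have Ddiff : `|D s - D t| <= (enorm w + e') * r.
    apply: le_trans (Dlip _ _) _.
    have -> : X s - X t = (X s - X t - (s - t) *: w) + (s - t) *: w by rewrite subrK.
    apply: le_trans (ler_enormD _ _) _; rewrite enormZ mulrDl addrC.
    by apply: lerD => //; rewrite mulrC.
  have key : E s * ((enorm w + e') * r) - C * E t * D t * r + D t * (e' * r)
      - g * r + e' * r <= e * r.
    have -> : E s * ((enorm w + e') * r) - C * E t * D t * r + D t * (e' * r)
      - g * r + e' * r = (E s * (enorm w + e') - C * E t * D t + D t * e' - g + e') * r by ring.
    apply: ler_wpM2r => //.
    have i1 : E s * enorm w <= (E t + e') * enorm w.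
      by apply: ler_wpM2r; [exact: enorm_ge0|lra].
    have i2 : E s * e' <= e' by rewrite ler_piMl ?E1// ltW.
    have i3 : E t * enorm w <= E t * (g + C * D t) by rewrite ler_wpM2l ?DtE// ltW.
    have i4 : E t * g <= g by rewrite ler_piMl// E1// ltW.
    have i5 : D t * e' <= theta * e' by rewrite ler_wpM2r// ltW.
    rewrite -e'K /K; lra.
  have := ler_norm (D s - D t); have := ler_norm (D t - D s); rewrite (distrC (D t)).
  move=> j2 j1.
  have Es0 := E0 s.
  have k1 : E s * (D s - D t) <= E s * ((enorm w + e') * r) by apply: ler_wpM2l; [exact: ltW|exact: le_trans j1 Ddiff].
  have k2 : E s * (D t - D s) <= E s * ((enorm w + e') * r) by apply: ler_wpM2l; [exact: ltW|exact: le_trans j2 Ddiff].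
  move: H2 H3; rewrite !ler_norml => /andP[g1 g2] /andP[f1 f2].
  have Dt0 := D0 t.
  split => st.
    have rE : r = s - t by rewrite /r ger0_norm//; lra.
    have : D t * (E s - E t) <= D t * ((s - t) * (- C * E t) + e' * r).
      by rewrite ler_wpM2l//; rewrite /r; lra.
    move: key k1 g1 g2; rewrite /F -/r rE; lra.
  have rE : r = t - s by rewrite /r ler0_norm//; lra.
  have : D t * (E t - E s) <= D t * (- ((s - t) * (- C * E t)) + e' * r).
    by rewrite ler_wpM2l//; rewrite /r; lra.
  move: key k2 g1 g2; rewrite /F -/r rE; lra.
have Db : D b <= (enorm (X a) + (G b - G a)) * expR (C * (b - a)).
  rewrite -[C * _]opprK -mulNr expRN ler_pdivlMr; last exact: expR_gt0.
  by move: FF; rewrite /F Ea; have := DX a; rewrite -/(E b); lra.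
(* The bound lies strictly below [theta], so the truncation is inactive at [b]. *)
suff <- : D b = enorm (X b) by [].
by move: Db small; rewrite /D /Num.min; case: ifPn => // _ h1 h2; lra.
Qed.

(** Gronwall's inequality with [C = 0], applied to [X - X a]; any [theta] above the claimed bound
    serves, here the bound plus 1. *)
Lemma mvt_enorm X (a b K : R) :
  a <= b -> 0 <= K -> abs_continuous a b X ->
  {ae lebR R, forall t, a < t -> t < b -> exists2 w,
     is_derive t (1 : R) X w & enorm w <= K} ->
  enorm (X b - X a) <= K * (b - a).
Proof.
move=> ab K0 AC dX.
have Kab : 0 <= K * (b - a) by rewrite mulr_ge0//; lra.
have := @gronwall (fun t => X t - X a) (fun t => K * t) a b 0 (K * (b - a) + 1) ab (lexx 0).
rewrite mul0r expR0 !mulr1 subrr enorm0 add0r -mulrBr; apply => //.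
- lra.
- move=> e e0; have [d d0 Hd] := AC e e0; exists d => // N p q pq tr len.
  under eq_bigr do rewrite opprB addrA subrK.
  exact: Hd.
- by move=> s t _ st _; rewrite ler_wpM2l.
- move: dX; apply: aeS => t + at0 tb => /(_ at0 tb)[w dw wK].
  exists w, K; split => //.
  + have := @is_deriveB _ _ _ X (fun=> X a) t 1 w 0 dw (is_derive_cst _ _ _).
    by rewrite subr0.
  + by apply: is_derive_eq; rewrite /GRing.scale/=; ring.
  + by rewrite mul0r addr0.
- lra.
Qed.

End Gronwall.

(** * Antiderivatives of bounded Lebesgue measurable functions *)

Section Antiderivative.
Variable R : realType.
Notation mu := (@lebesgue_measure R).
Notation cara := (caratheodory_type (wlength (@idfun R))^*%mu).

Lemma completed_measurable_decomp (A : set R) : measurable (A : set cara) ->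
  exists B N Z : set R, [/\ A = B `|` N, measurable B, N `<=` Z,
    measurable Z & mu Z = 0%E].
Proof.
move=> mA; have : ((completed_algebra_gen mu).-sigma.-measurable) A.
  by rewrite completed_caratheodory_measurable.
rewrite g_sigma_completed_algebra_genE => -[B mB [N [Z [mZ Z0 NZ]] <-]].
by exists B, N, Z.
Qed.

(** Each superlevel set at a rational level is Borel up to a null set. Setting [h] to 0 on the union
    of these countably many null sets makes all of them Borel at once. *)
Lemma borel_version (h : R -> R) :
  measurable_fun (setT : set cara) (h : cara -> measurableTypeR R) ->
  exists2 h1 : R -> R, measurable_fun setT h1 &
    exists Z : set R, [/\ measurable Z, mu Z = 0%E &
      forall t, (Z t -> h1 t = 0) /\ (~ Z t -> h1 t = h t)].
Proof.
move=> mh.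
(* An enumeration of the rationals; the default 0 at codes of no rational merely repeats a level. *)
pose r_ (k : nat) : R := if (choice.unpickle k : option rat) is Some q then ratr q else 0.
have mA k : measurable ([set t | r_ k < h t] : set cara).
  have := mh measurableT (`]r_ k, +oo[%classic) (measurable_itv _).
  rewrite setTI; congr measurable; apply/seteqP; split => t /=;
    by rewrite in_itv/= andbT.
have /choice[B /choice[N /choice[Z HZ]]] : forall k, exists B N Z : set R,
    [/\ [set t | r_ k < h t] = B `|` N, measurable B, N `<=` Z,
    measurable Z & mu Z = 0%E].
  by move=> k; exact: completed_measurable_decomp.
pose Z' := \bigcup_k Z k.
have mZ' : measurable Z' by apply: bigcupT_measurable => k; have [] := HZ k.
have Z'0 : mu Z' = 0%E.
  apply/negligibleP => //; apply: negligible_bigcup => k.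
  by have [_ _ _ mZ Z0] := HZ k; apply/negligibleP.
pose h1 t := if `[< Z' t >] then 0 else h t.
have h1Z t : Z' t -> h1 t = 0 by move=> Zt; rewrite /h1 asboolT.
have h1N t : ~ Z' t -> h1 t = h t by move=> Zt; rewrite /h1 asboolF.
exists h1; last by exists Z'; split => // t; split; [exact: h1Z|exact: h1N].
have mh1 k : measurable [set t | r_ k < h1 t].
  have -> : [set t | r_ k < h1 t] =
      (B k `\` Z') `|` (Z' `&` [set t | r_ k < 0]).
    have [hE _ NZ _ _] := HZ k.
    apply/seteqP; split => t /=.
      have [Zt|nZt] := pselect (Z' t); first by rewrite h1Z// => ?; right.
      rewrite h1N// => ht; left; split => //.
      have : [set t | r_ k < h t] t by [].
      rewrite hE => -[//|/NZ Zk]; exfalso; apply: nZt; by exists k.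
    case=> [[Bt nZt]|[Zt r0]]; last by rewrite h1Z.
    rewrite h1N//; have : (B k `|` N k) t by left.
    by rewrite -hE.
  apply: measurableU; first by apply: measurableD => //; have [] := HZ k.
  apply: measurableI => //; case: (pselect (r_ k < 0)) => H.
    by rewrite (_ : [set _ | _] = setT)//; apply/seteqP; split.
  by rewrite (_ : [set _ | _] = set0)//; apply/seteqP; split.
apply: (measurability _ (RGenOInfty.measurableE R)).
move=> _ [_ [r ->] <-]; rewrite setTI.
have -> : h1 @^-1` `]r, +oo[ = \bigcup_(k in [set k | r <= r_ k]) [set t | r_ k < h1 t].
  apply/seteqP; split => t /=.
    rewrite in_itv/= andbT => rh.
    have [q /andP[rq qh]] := rat_in_itvoo rh.
    by exists (choice.pickle q) => /=; rewrite /r_ choice.pickleK// ltW.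
  by case=> k /= rk kh; rewrite in_itv/= andbT; exact: le_lt_trans kh.
by apply: bigcup_measurable => k _; exact: mh1.
Qed.

(** [H] is the integral over [[0, x]] of a Borel version of [h], differentiated by Lebesgue's
    theorem. Boundedness by [K] gives local integrability and the Lipschitz bound. *)
Lemma antiderivative (h : R -> R) (K : R) : 0 <= K ->
  measurable_fun (`[0, +oo[%classic : set cara) (h : cara -> measurableTypeR R) ->
  (forall t, 0 <= t -> `|h t| <= K) ->
  exists H : R -> R,
    [/\ forall a b, 0 <= a -> a <= b -> `|H b - H a| <= K * (b - a),
        {ae lebR R, forall t : R, 0 < t -> is_derive t (1 : R) H (h t)} &
        (forall t, 0 <= t -> 0 <= h t) -> forall a b, 0 <= a -> a <= b ->
          (\int[lebR R]_(s in `]a, b]) (h s)%:E)%E = (H b - H a)%:E].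
Proof.
move=> K0 mh hK.
pose h0 := h \_ `[0, +oo[.
have mpos : measurable (`[0, +oo[%classic : set cara).
  by apply: sub_caratheodory; exact: measurable_itv.
have mh0 : measurable_fun (setT : set cara) (h0 : cara -> measurableTypeR R).
  by apply/(measurable_restrictT _ _).1.
have h0E t : 0 <= t -> h0 t = h t.
  by move=> t0; rewrite /h0 patchE mem_set//= in_itv/= t0.
have h0K t : `|h0 t| <= K.
  rewrite /h0 patchE; case: ifPn => [|_]; last by rewrite normr0.
  by rewrite inE/= in_itv/= andbT; exact: hK.
have [h1 mh1 [Z [mZ Z0 HZ]]] := borel_version mh0.
have h1K t : `|h1 t| <= K.
  have [Zt|nZt] := pselect (Z t); first by rewrite (HZ t).1// normr0.
  by rewrite (HZ t).2.
have int1 (A : set R) : measurable A -> (mu A < +oo)%E -> mu.-integrable A (EFin \o h1).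
  move=> mA Afin; apply: measurable_bounded_integrable => //.
    exact: measurable_funTS.
  exists K; split; first exact: num_real.
  by move=> M KM t _ /=; rewrite (le_trans (h1K t))// ltW.
have itvfin (i : interval R) (a b : R) : (forall x, x \in i -> x \in `[a, b]) ->
    (mu [set` i] < +oo)%E.
  move=> ii; apply: (@le_lt_trans _ _ (mu `[a, b])).
    by apply: le_measure; rewrite ?inE.
  by rewrite lebesgue_measure_itv/=; case: ifPn => _; rewrite ?ltry.
pose H x := (\int[mu]_(t in [set` Interval (BLeft (0 : R)) (BRight x)]) (h1 t))%R.
have intI (b1 b2 : bool) a b : mu.-integrable [set` Interval (BSide b1 a) (BSide b2 b)] (EFin \o h1).
  apply: int1 => //; apply: (itvfin _ a b) => x.
  rewrite !in_itv/=; case: b1; case: b2 => /= /andP[u v]; rewrite ?(ltW u) ?(ltW v) ?u ?v//.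
have HB a b : 0 <= a -> a <= b ->
    H b - H a = (\int[mu]_(s in `]a, b]) h1 s)%R.
  move=> a0 ab.
  have E : [set` Interval (BLeft (0:R)) (BRight b)] =
      [set` Interval (BLeft (0:R)) (BRight a)] `|` `]a, b]%classic.
    by rewrite -itv_bndbnd_setU// bnd_simp.
  rewrite /H E Rintegral_setU//; last 2 first.
  - by rewrite -E; exact: intI.
  - apply/disj_setPRL => t /=; rewrite !in_itv/= => /andP[h2 _] /andP[_ h3].
    by move: (lt_le_trans h2 h3); rewrite ltxx.
  by rewrite addrC addKr.
exists H; split.
- move=> a b a0 ab; rewrite HB//.
  apply: le_trans (le_normr_Rintegral _ _) _ => //.
  apply: (@le_trans _ _ (\int[mu]_(s in `]a, b]) K)%R).
    apply: le_Rintegral => //.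
    + have := integrable_norm (intI false false a b).
      by congr integrable; apply/funext => t.
    + apply: measurable_bounded_integrable => //; first by apply: (itvfin _ a b) => x; rewrite !in_itv/= => /andP[u ->]; rewrite ltW.
      exists K; split; first exact: num_real.
      by move=> M KM t _ /=; rewrite ger0_norm// ltW.
  rewrite Rintegral_cst//; apply: ler_wpM2l => //.
  have -> : b - a = fine (lebesgue_measure (`]a, b]%classic : set R)).
    rewrite lebesgue_measure_itv/=; case: ifPn => //=; rewrite lte_fin -leNgt; lra.
  exact: lexx.
- have locf : locally_integrable [set: R] h1.
    split => //; first exact: openT.
    move=> C _ cC; have mC : measurable C by exact: compact_measurable.
    have /integrableP[_] := int1 C mC (compact_finite_measure cC).
    by under eq_integral do rewrite /= .
  have := FTC1 (fun y => intI true false 0 y) locf => /ae_lebesgue_completed hd.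
  have hZ : {ae lebR R, forall t, ~ Z t}.
    apply: ae_lebesgue_completed; exists Z; split => // t /=.
    by rewrite notK.
  move: hd hZ => /aeI /[apply]; apply: aeS => t [hd nZt] t0.
  have [|dH HE] := hd; first by rewrite (@lte_fin R).
  split => //; rewrite -derive1E HE (HZ t).2// h0E//; exact: ltW.
- move=> hpos a b a0 ab.
  have mab : measurable (`]a, b]%classic : set cara).
    by apply: sub_caratheodory; exact: measurable_itv.
  rewrite HB//.
  have h1pos t : 0 <= h1 t.
    have [Zt|nZt] := pselect (Z t); first by rewrite (HZ t).1.
    rewrite (HZ t).2// /h0 patchE; case: ifPn => //.
    by rewrite inE/= in_itv/= andbT; exact: hpos.
  have mh1c : measurable_fun (setT : set cara) (h1 : cara -> measurableTypeR R).
    move=> _ Y mY; rewrite setTI; apply: sub_caratheodory.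
    by rewrite -[X in _ X]setTI; exact: mh1.
  rewrite /Rintegral fineK; last first.
    by apply: integrable_fin_num => //; exact: intI.
  transitivity (\int[lebR R]_(s in `]a, b]) (h1 s)%:E)%E.
    apply: ae_eq_integral.
    + by apply: sub_caratheodory; exact: measurable_itv.
    + apply/measurable_EFinP; apply: measurable_funS mh => //.
      by move=> t /=; rewrite !in_itv/= andbT => /andP[u _]; lra.
    + by apply/measurable_EFinP; exact: measurable_funTS.
    + have : {ae lebR R, forall t, ~ Z t}.
        by apply: ae_lebesgue_completed; exists Z; split => // t /=; rewrite notK.
      apply: aeS => t nZt /=; rewrite in_itv/= => /andP[u _].
      by rewrite (HZ t).2// h0E//; lra.
  (* The identity pushes the completed measure forward to the Borel sets, which identifies the
     integrals over the two sigma-algebras. *)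
  have mid : measurable_fun (setT : set cara) (idfun : cara -> measurableTypeR R).
    by move=> _ Y mY; rewrite setTI; exact: sub_caratheodory.
  have := @ge0_integral_pushforward _ _ cara (measurableTypeR R) R idfun mid (lebR R)
    `]a, b]%classic (EFin \o h1).
  move=> <-//; last 2 first.
  + by apply/measurable_EFinP; exact: measurable_funTS.
  + by move=> t _; rewrite lee_fin.
Qed.

End Antiderivative.

(** * Existence and continuation of solutions *)

Section CaratheodoryComposition.
Variable R : realType.
Notation cara := (caratheodory_type (wlength (@idfun R))^*%mu).

(** Labels the cells of the grid of mesh [1 / (k + 1)]; integer labels make the cells countable. *)
Definition grid_index n (k : nat) (x : 'rV[R]_n) : 'rV[int]_n :=
  \row_i Num.floor (k.+1%:R * x 0 i).

Definition grid_point n (k : nat) (v : 'rV[int]_n) : 'rV[R]_n :=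
  \row_i ((v 0 i)%:~R / k.+1%:R).

Lemma grid_cvg n (x : 'rV[R]_n) :
  grid_point k (grid_index k x) @[k --> \oo] --> x.
Proof.
apply/cvgrPdist_lt => e e0; near=> k.
have ke : k.+1%:R^-1 < e by near: k; exact: near_infty_natSinv_lt (PosNum e0).
apply: le_lt_trans ke; rewrite [leLHS]mx_normrE; apply/bigmax_leP.
split => [|[i j] _ /=]; first by rewrite invr_ge0.
rewrite (ord1 i) !mxE.
have k0 : 0 < k.+1%:R :> R by rewrite ltr0n.
have -> : x 0 j - (Num.floor (k.+1%:R * x 0 j))%:~R / k.+1%:R =
   (k.+1%:R * x 0 j - (Num.floor (k.+1%:R * x 0 j))%:~R) / k.+1%:R.
  by field; rewrite gt_eqF// ltr0n.
rewrite normrM (@ger0_norm _ (k.+1%:R^-1)) ?invr_ge0//.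
rewrite ler_piMl ?invr_ge0//.
have /andP[h1 h2] := real_floor_itv (num_real (k.+1%:R * x 0 j)).
by rewrite intrD in h2; rewrite ger0_norm; lra.
Unshelve. all: by end_near. Qed.

Lemma measurable_grid_level n (D : set cara) (h : R -> 'rV[R]_n) k v :
  measurable D -> Lmeasurable D h ->
  measurable (D `&` [set t | grid_index k (h t) = v] : set cara).
Proof.
move=> mD mh.
have -> : D `&` [set t | grid_index k (h t) = v] = D `&` \bigcap_(i in [set: 'I_n])
    (D `&` (fun t => h t 0 i) @^-1` `[(v 0 i)%:~R / k.+1%:R, (v 0 i + 1)%:~R / k.+1%:R[).
  have k0 : 0 < k.+1%:R :> R by rewrite ltr0n.
  apply/seteqP; split => t /= [Dt H]; split => //.
    move=> i _; split => //=; rewrite in_itv/= ler_pdivrMr// ltr_pdivlMr//.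
    by rewrite -H mxE mulrC; exact: real_floor_itv (num_real _).
  apply/rowP => i; rewrite mxE; apply: floor_def.
  have [_ /=] := H i Logic.I.
  by rewrite in_itv/= ler_pdivrMr// ltr_pdivlMr// mulrC.
apply: measurableI => //.
apply: fin_bigcap_measurable => // i _.
by apply: mh => //; exact: measurable_itv.
Qed.

(** After rounding [y] and [u] to a grid, the composite is one of countably many functions
    [f t xi mu] with fixed [xi] and [mu] on each measurable cell. Continuity in the last two
    arguments gives convergence as the mesh tends to 0. *)
Lemma Lmeasurable_caratheodory_comp n m (D : set cara)
    (f : R -> 'rV[R]_n -> 'rV[R]_m -> 'rV[R]_n)
    (y : R -> 'rV[R]_n) (u : R -> 'rV[R]_m) :
  measurable D ->
  (forall xi mu, Lmeasurable D (fun t => f t xi mu)) ->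
  (forall t, D t -> continuous (fun z : 'rV[R]_n * 'rV[R]_m => f t z.1 z.2)) ->
  Lmeasurable D y -> Lmeasurable D u ->
  Lmeasurable D (fun t => f t (y t) (u t)).
Proof.
move=> mD mf cf my mu i.
pose fk k t := f t (grid_point k (grid_index k (y t))) (grid_point k (grid_index k (u t))) 0 i.
apply: (@measurable_fun_cvg _ _ _ D fk).
  move=> k _ Y mY.
  have -> : D `&` fk k @^-1` Y = \bigcup_(vw in [set: 'rV[int]_n * 'rV[int]_m])
     ((D `&` [set t | grid_index k (y t) = vw.1]) `&`
     (D `&` [set t | grid_index k (u t) = vw.2]) `&`
     (D `&` (fun t => f t (grid_point k vw.1) (grid_point k vw.2) 0 i) @^-1` Y)).
    apply/seteqP; split => t /=.
      move=> [Dt Yt]; exists (grid_index k (y t), grid_index k (u t)) => //.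
    by case=> -[v w] _ /= [[[Dt <-] [_ <-]] [_ Yt]].
  apply: countable_bigcupT_measurable => // -[v w] /=.
  apply: measurableI; last exact: mf.
  by apply: measurableI; exact: measurable_grid_level.
move=> t Dt.
have h : (fun z : 'rV[R]_n * 'rV[R]_m => f t z.1 z.2)
    (grid_point k (grid_index k (y t)), grid_point k (grid_index k (u t))) @[k --> \oo]
    --> f t (y t) (u t).
  have h1 : (grid_point k (grid_index k (y t)), grid_point k (grid_index k (u t)))
      @[k --> \oo] --> (y t, u t) by exact: (@cvg_pair _ _ _ \oo (nbhs (y t)) (nbhs (u t)) _ _ _ _ _ (@grid_cvg _ (y t)) (@grid_cvg _ (u t))).
  exact: (cvg_comp _ _ h1 (cf t Dt (y t, u t))).
exact: (@cvg_comp _ _ _ _ (fun M : 'rV[R]_n => M 0 i) _ _ _ h (@coord_continuous _ _ _ 0 i _)).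
Qed.

End CaratheodoryComposition.

Section LocalExistence.
Variable R : realType.

Lemma geometric_lt (M e : R) : 0 < e -> exists k, M * 2^-1 ^+ k < e.
Proof.
move=> e0; exists (Num.truncn (`|M| / e)).
set k := Num.truncn _.
have h : `|M| / e < k.+1%:R by apply: truncnS_gt.
have k2 : k.+1%:R <= 2 ^+ k :> R by rewrite -natrX ler_nat ltn_expl.
have p : 0 < (2 : R) ^+ k by rewrite exprn_gt0.
rewrite exprVn ltr_pdivrMr//.
move: h; rewrite ltr_pdivrMr// => h.
apply: (le_lt_trans (ler_norm M)); apply: (lt_le_trans h).
by rewrite mulrC ler_wpM2l// ltW.
Qed.

Lemma le_geometric (x y M : R) : (forall k, x <= y + M * 2^-1 ^+ k) -> x <= y.
Proof.
move=> H; apply/ler_addgt0Pr => e e0; have [k hk] := geometric_lt M e0.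
by apply: (le_trans (H k)); lra.
Qed.

(** The intervals of radius [2 * 2^-1 ^+ k] around [b k] are nested; the limit is the supremum of
    their left ends. *)
Lemma geometric_limit (b : nat -> R) :
  (forall k, `|b k.+1 - b k| <= 2^-1 ^+ k) ->
  exists l, forall k, `|b k - l| <= 2 * 2^-1 ^+ k.
Proof.
move=> H.
have dS k : b k - 2 * 2^-1 ^+ k <= b k.+1 - 2 * 2^-1 ^+ k.+1 /\
            b k.+1 + 2 * 2^-1 ^+ k.+1 <= b k + 2 * 2^-1 ^+ k.
  by rewrite exprS; move: (H k); rewrite ler_norml => /andP[h1 h2]; split; lra.
have dmono : {homo (fun k => b k - 2 * 2^-1 ^+ k) : i j / (i <= j)%N >-> i <= j}.
  by apply: homo_leq => [//|? ? ?|k]; [exact: le_trans|exact: (dS k).1].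
have cmono : {homo (fun k => b k + 2 * 2^-1 ^+ k) : i j / (i <= j)%N >-> j <= i}.
  apply: (@homo_leq _ _ (fun x y => y <= x)) => [//|? ? ? /[swap]|k].
    exact: le_trans.
  exact: (dS k).2.
have pos k : 0 <= (2^-1 : R) ^+ k by rewrite exprn_ge0// invr_ge0.
have dc j k : b j - 2 * 2^-1 ^+ j <= b k + 2 * 2^-1 ^+ k.
  have h1 := dmono j (maxn j k) (leq_maxl _ _).
  have h2 := cmono k (maxn j k) (leq_maxr _ _).
  by have := pos (maxn j k); rewrite /= in h1 h2; lra.
pose S := [set b k - 2 * 2^-1 ^+ k | k in [set: nat]].
have S0 : S !=set0 by exists (b 0%N - 2 * 2^-1 ^+ 0), 0%N.
exists (sup S) => k.
have h1 : b k - 2 * 2^-1 ^+ k <= sup S.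
  by apply: ub_le_sup; [exists (b 0%N + 2 * 2^-1 ^+ 0) => _ [j _ <-]|exists k].
have h2 : sup S <= b k + 2 * 2^-1 ^+ k.
  by apply: ge_sup => // _ [j _ <-].
by rewrite ler_norml; apply/andP; split; lra.
Qed.

Variable n : nat.

Lemma geometric_limit_vec (b : nat -> 'rV[R]_n) :
  (forall k, enorm (b k.+1 - b k) <= 2^-1 ^+ k) ->
  exists l, forall k, enorm (b k - l) <= n%:R * 2 * 2^-1 ^+ k.
Proof.
move=> H.
have /choice[l Hl] : forall i, exists l, forall k, `|b k 0 i - l| <= 2 * 2^-1 ^+ k.
  move=> i; apply: geometric_limit => k; apply: le_trans (H k).
  by apply: le_trans (ler_coord_enorm _ i); rewrite !mxE.
exists (\row_i l i) => k; apply: (le_trans (enorm_sum _)).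
apply: (@le_trans _ _ (\sum_(i < n) 2 * 2^-1 ^+ k)); last first.
  by rewrite sumr_const card_ord -[leLHS]mulr_natl mulrA.
by apply: ler_sum => i _; rewrite !mxE; exact: Hl.
Qed.

Lemma lipschitz_abs_continuous (X : R -> 'rV[R]_n) (a b K : R) :
  (forall s t, a <= s -> s <= t -> t <= b -> enorm (X t - X s) <= K * (t - s)) ->
  abs_continuous a b X.
Proof.
move=> lip e e0; exists (e / (`|K| + 1)).
  by rewrite divr_gt0//; have := normr_ge0 K; lra.
move=> N p q pq _; rewrite ltr_pdivlMr; last by have := normr_ge0 K; lra.
apply: le_lt_trans; rewrite mulr_suml; apply: ler_sum => i _.
have [ap pqi qb] := pq i; apply: (le_trans (lip _ _ ap pqi qb)).
by rewrite mulrC ler_wpM2l//; have := ler_norm K; lra.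
Qed.

Lemma antiderivative_vec (h : R -> 'rV[R]_n) (K : R) : 0 <= K ->
  Lmeasurable `[0, +oo[%classic h -> (forall t, 0 <= t -> enorm (h t) <= K) ->
  exists2 H : R -> 'rV[R]_n,
    forall a b, 0 <= a -> a <= b -> enorm (H b - H a) <= K * (b - a) &
    {ae lebR R, forall t : R, 0 < t -> is_derive t (1 : R) H (h t)}.
Proof.
move=> K0 mh hK.
have /choice[H HH] : forall i, exists H : R -> R,
    (forall a b, 0 <= a -> a <= b -> `|H b - H a| <= K * (b - a)) /\
    {ae lebR R, forall t : R, 0 < t -> is_derive t (1 : R) H (h t 0 i)}.
  move=> i; have [|H [h1 h2 _]] := antiderivative K0 (mh i); last by exists H.
  by move=> t t0; rewrite (le_trans (ler_coord_enorm _ i))// hK.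
pose HV t : 'rV[R]_n := \row_i H i t.
have dHV : {ae lebR R, forall t : R, 0 < t -> is_derive t (1 : R) HV (h t)}.
  have : {ae lebR R, forall t : R, forall i, 0 < t -> is_derive t (1 : R) (H i) (h t 0 i)}.
    have all (s : seq 'I_n) : {ae lebR R, forall t : R, forall i, i \in s -> 0 < t -> is_derive t (1 : R) (H i) (h t 0 i)}.
      elim: s => [|j s ih]; first by apply: ae_true.
      have [_ HHj] := HH j; have := aeI HHj ih; apply: aeS => t [h1 h2] i.
      by rewrite inE => /predU1P[->//|]; exact: h2.
    by have := all (enum 'I_n); apply: aeS => t h3 i; apply: h3; rewrite mem_enum.
  apply: aeS => t ht t0; apply: is_derive_coord => i.
  rewrite (_ : (fun s => HV s 0 i) = H i); first exact: ht.
  by apply/funext => s; rewrite mxE.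
(* Coordinatewise bounds give only the constant [n * K]. The mean value inequality recovers [K]
   itself, which lets the Picard iterates stay in one class of functions. *)
exists HV => // a b a0 ab; apply: mvt_enorm => //.
  apply: (@lipschitz_abs_continuous _ _ _ (n%:R * K)) => s t as_ st tb.
  apply: (le_trans (enorm_sum _)).
  apply: (@le_trans _ _ (\sum_(i < n) K * (t - s))); last first.
    by rewrite sumr_const card_ord -[leLHS]mulr_natl mulrA.
  by apply: ler_sum => i _; rewrite !mxE; have [HHi _] := HH i; apply: HHi => //; lra.
move: dHV; apply: aeS => t ht at0 tb; exists (h t); first by apply: ht; lra.
by apply: hK; lra.
Qed.

Variable m : nat.

Lemma lipschitz_Lmeasurable (w : R -> 'rV[R]_n) (K : R) (D : set R) :
  0 <= K ->
  measurable (D : set (caratheodory_type (wlength (@idfun R))^*%mu)) ->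
  (forall s t, enorm (w s - w t) <= K * `|s - t|) -> Lmeasurable D w.
Proof.
move=> K0 mD lip i.
have cw : continuous (fun t => w t 0 i : R).
  move=> t; apply/cvgrPdist_lt => e e0; apply/nbhs_ballP.
  exists (e / (K + 1)) => /=; first by rewrite divr_gt0//; lra.
  move=> s; rewrite /ball/= ltr_pdivlMr; last lra.
  move=> st; apply: le_lt_trans st.
  have := ler_coord_enorm (w t - w s) i; rewrite !mxE => h.
  apply: (le_trans h); apply: (le_trans (lip _ _)).
  by rewrite mulrC ler_wpM2l//; lra.
have mw := continuous_measurable_fun cw.
move=> _ Y mY; apply: measurableI => //; apply: sub_caratheodory.
by rewrite -[X in _ X]setTI; exact: mw.
Qed.

(** Picard iteration among the [K]-Lipschitz functions starting at [xi]. The limit is taken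
    pointwise along geometric bounds, which also give the fixed point property. *)
Lemma local_ode (f : R -> 'rV[R]_n -> 'rV[R]_m -> 'rV[R]_n)
    (u : R -> 'rV[R]_m) (Mu tau d0 : R) (xi : 'rV[R]_n) :
  (forall xi mu, Lmeasurable `[0, +oo[%classic (fun t => f t xi mu)) ->
  (forall t : R, 0 <= t ->
     continuous (fun z : 'rV[R]_n * 'rV[R]_m => f t z.1 z.2)) ->
  (forall c, exists2 K, 0 <= K & forall t x mu, 0 <= t -> enorm x <= c ->
     enorm mu <= c -> enorm (f t x mu) <= K) ->
  (forall c, exists2 C, 0 <= C & forall t x y mu, 0 <= t -> enorm x <= c ->
     enorm y <= c -> enorm mu <= c ->
     enorm (f t x mu - f t y mu) <= C * enorm (x - y)) ->
  Lmeasurable `[0, +oo[%classic u -> (forall t, 0 <= t -> enorm (u t) <= Mu) ->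
  0 <= tau -> 0 < d0 ->
  exists d K y, [/\ 0 < d, d <= d0, y tau = xi,
    forall s t, tau <= s -> s <= t -> t <= tau + d -> enorm (y t - y s) <= K * (t - s) &
    {ae lebR R, forall t : R, tau < t -> t < tau + d ->
       is_derive t (1 : R) y (f t (y t) (u t))}].
Proof.
move=> mf cf fbnd flip mu uM tau0 d00.
pose c := Num.max (enorm xi + 1) Mu.
have [K K0 HK] := fbnd c; have [C C0 HC] := flip c.
have uc t : 0 <= t -> enorm (u t) <= c.
  by move=> t0; rewrite le_max (uM t)// orbT.
(* [K * d <= 1] keeps admissible functions in the ball of radius [enorm xi + 1]; [C * d <= 1 / 2]
   makes the Picard map halve distances. *)
pose d := Num.min d0 (Num.min (K + 1)^-1 (2 * (C + 1))^-1).
have d_gt0 : 0 < d by rewrite !lt_min d00 !invr_gt0 mulr_gt0//; lra.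
have dd0 : d <= d0 by rewrite ge_min lexx.
have dK : K * d <= 1.
  have h : d <= (K + 1)^-1 by rewrite !ge_min lexx orbT.
  have K1 : 0 < K + 1 by lra.
  have := ler_wpM2l (ltW K1) h; rewrite divff ?gt_eqF// mulrDl mul1r.
  by have := ltW d_gt0; lra.
have dC : C * d <= 2^-1.
  have h : d <= (2 * (C + 1))^-1 by rewrite !ge_min lexx !orbT.
  have C1 : 0 < 2 * (C + 1) by lra.
  have := ler_wpM2l (ltW C1) h; rewrite divff ?gt_eqF//.
  by have := ltW d_gt0; lra.
clearbody d.
pose I t := tau <= t /\ t <= tau + d.
pose adm (w : R -> 'rV[R]_n) := w tau = xi /\
  forall s t, tau <= s -> s <= t -> t <= tau + d -> enorm (w t - w s) <= K * (t - s).
have adm_ball w t : adm w -> I t -> enorm (w t) <= c.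
  move=> [wtau lip] [t1 t2]; rewrite le_max; apply/orP; left.
  have := lip tau t (lexx _) t1 t2; have := ler_enorm_sub (w t) (w tau).
  rewrite wtau; have : K * (t - tau) <= K * d by rewrite ler_wpM2l//; lra.
  lra.
(* Freezing a function outside the window makes it Lipschitz on the whole line, hence the right-hand
   side measurable and bounded on the half-line. *)
pose clamp t := Num.max tau (Num.min t (tau + d)).
have clampI t : I (clamp t).
  split; first by rewrite le_max lexx.
  by rewrite ge_max ge_min lexx orbT andbT; lra.
have clampE t : I t -> clamp t = t.
  by move=> [t1 t2]; rewrite /clamp min_l// max_r.
have clamp_lip s t : s <= t -> clamp s <= clamp t <= clamp s + (t - s).
  by rewrite /clamp /Num.max /Num.min => st; do !case: ifPn; rewrite -?leNgt; lra.
have step w : adm w -> exists y, adm y /\ {ae lebR R, forall t : R, tau < t ->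
    t < tau + d -> is_derive t (1 : R) y (f t (w t) (u t))}.
  move=> aw; have [wtau lip] := aw.
  have mpos : measurable (`[0, +oo[%classic : set (caratheodory_type (wlength (@idfun R))^*%mu)).
    by apply: sub_caratheodory; exact: measurable_itv.
  have mw : Lmeasurable `[0, +oo[%classic (w \o clamp).
    apply: (@lipschitz_Lmeasurable _ K) => // s t /=.
    wlog st : s t / s <= t.
      move=> W; have [st|ts] := leP s t; first exact: W.
      by rewrite enormBC distrC; apply: W; exact: ltW.
    rewrite enormBC distrC ger0_norm ?subr_ge0//.
    have /andP[h1 h2] := clamp_lip s t st.
    have [s1 s2] := clampI s; have [t1 t2] := clampI t.
    apply: (le_trans (lip _ _ s1 h1 t2)).
    by rewrite ler_wpM2l//; lra.
  have mh : Lmeasurable `[0, +oo[%classic (fun t => f t (w (clamp t)) (u t)).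
    apply: (@Lmeasurable_caratheodory_comp R n m _ f (w \o clamp) u) => //.
    by move=> t /=; rewrite in_itv/= andbT; exact: cf.
  have [|H H1 H2] := antiderivative_vec K0 mh.
    by move=> t t0; apply: HK => //; [exact: adm_ball|exact: uc].
  exists (fun t => xi + (H t - H tau)); split.
    split; first by rewrite subrr addr0.
    move=> s t s1 st t1; rewrite opprD addrACA subrr add0r opprB addrA subrK.
    by apply: H1; lra.
  move: H2; apply: aeS => t ht t1 t2.
  have {}ht := ht ltac:(lra).
  have := @is_deriveD _ _ _ (fun=> xi - H tau) H t 1 0 _ (is_derive_cst _ _ _) ht.
  rewrite add0r clampE; last by split; exact: ltW.
  by congr is_derive; apply/funext => s /=; rewrite addrAC addrA.
have contr w1 w2 y1 y2 e : adm w1 -> adm w2 -> adm y1 -> adm y2 -> 0 <= e ->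
    {ae lebR R, forall t : R, tau < t -> t < tau + d ->
       is_derive t (1 : R) y1 (f t (w1 t) (u t))} ->
    {ae lebR R, forall t : R, tau < t -> t < tau + d ->
       is_derive t (1 : R) y2 (f t (w2 t) (u t))} ->
    (forall t, I t -> enorm (w1 t - w2 t) <= e) ->
    forall t, I t -> enorm (y1 t - y2 t) <= e / 2.
  move=> a1 a2 b1 b2 e0 d1 d2 we t [t1 t2].
  have := @mvt_enorm _ _ (fun t => y1 t - y2 t) tau t (C * e) t1 (mulr_ge0 C0 e0).
  rewrite b1.1 b2.1 subrr subr0 => H; apply: le_trans (H _ _) _.
  - apply: (@lipschitz_abs_continuous _ _ _ (K + K)) => r s r1 rs s1.
    have -> : y1 s - y2 s - (y1 r - y2 r) = (y1 s - y1 r) - (y2 s - y2 r).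
      by apply/rowP => i; rewrite !mxE; ring.
    apply: (le_trans (ler_enormB _ _)); rewrite mulrDl.
    by apply: lerD; [apply: b1.2|apply: b2.2] => //; lra.
  - move: d1 d2 => /aeI /[apply]; apply: aeS => s [h1 h2] s1 s2.
    have s2' : s < tau + d by exact: lt_le_trans t2.
    exists (f s (w1 s) (u s) - f s (w2 s) (u s)).
      by apply: is_deriveB; [exact: h1|exact: h2].
    have Is : I s by split; exact: ltW.
    apply: (le_trans (HC _ _ _ _ _ _ _ _)); [exact: le_trans (ltW s1)|exact: adm_ball|exact: adm_ball|apply: uc; exact: le_trans (ltW s1)|].
    by rewrite ler_wpM2l// we.
  have : C * (t - tau) <= 2^-1.
    by apply: le_trans dC; rewrite ler_wpM2l//; lra.
  by move=> h; rewrite mulrAC mulrC ler_wpM2l.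
have [y0 ady0] : exists y, adm y.
  exists (fun=> xi); split => // s t _ st _.
  by rewrite subrr enorm0 mulr_ge0//; lra.
have /choice[Phi HPhi] : forall w, exists y, adm w -> adm y /\ {ae lebR R, forall t : R, tau < t ->
    t < tau + d -> is_derive t (1 : R) y (f t (w t) (u t))}.
  move=> w; have [aw|naw] := pselect (adm w); last by exists w.
  by have [y Hy] := step w aw; exists y.
pose ys k := iter k Phi y0.
have ady k : adm (ys k) by elim: k => //= k /HPhi[].
have adI w1 w2 t : adm w1 -> adm w2 -> I t -> enorm (w1 t - w2 t) <= 2.
  move=> [a1 b1] [a2 b2] [t1 t2].
  have := b1 tau t (lexx _) t1 t2; have := b2 tau t (lexx _) t1 t2.
  have := ler_enorm_dist xi (w1 t) (w2 t); rewrite a1 a2 (enormBC xi).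
  have : K * (t - tau) <= K * d by rewrite ler_wpM2l//; lra.
  lra.
(* Any two admissible functions differ by at most 2, so one contraction yields [1 = 2^-1 ^+ 0] for
   the second difference; hence the index shift. *)
have geo k t : I t -> enorm (ys k.+2 t - ys k.+1 t) <= 2^-1 ^+ k.
  elim: k t => [|k ih] t It.
    have -> : (2^-1 : R) ^+ 0 = 2 / 2 by rewrite expr0 divff// gt_eqF.
    apply: (contr (ys 1%N) (ys 0%N)) => //;
      [exact: (HPhi _ (ady 1%N)).2|exact: (HPhi _ (ady 0%N)).2|].
    by move=> s Is; apply: adI.
  rewrite exprSr; apply: (contr (ys k.+2) (ys k.+1)) => //;
    [exact: (HPhi _ (ady k.+2)).2|exact: (HPhi _ (ady k.+1)).2].
have /choice[y Hy] : forall t, exists l, I t ->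
    forall k, enorm (ys k.+1 t - l) <= n%:R * 2 * 2^-1 ^+ k.
  move=> t; have [It|nIt] := pselect (I t); last by exists 0.
  have [|l Hl] := @geometric_limit_vec (fun k => ys k.+1 t); last by exists l.
  by move=> k; exact: geo.
have Itau : I tau by split => //; rewrite lerDl ltW.
have pos k : 0 <= (2^-1 : R) ^+ k by rewrite exprn_ge0// invr_ge0.
have adY : adm y.
  split.
    apply/eqP; rewrite -subr_eq0; apply/eqP/enorm_eq0/le_anti; rewrite enorm_ge0 andbT.
    apply: (@le_geometric _ _ (n%:R * 2)) => k; rewrite add0r enormBC.
    by have := Hy tau Itau k; rewrite (ady k.+1).1.
  move=> s t s1 st t1.
  have Is : I s by split => //; exact: le_trans t1.
  have It : I t by split => //; exact: le_trans st.
  apply: (@le_geometric _ _ (n%:R * 2 + n%:R * 2)) => k.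
  have := (ady k.+1).2 s t s1 st t1; have := Hy s Is k; have := Hy t It k.
  have := ler_enorm_dist (ys k.+1 t) (y t) (y s).
  have := ler_enorm_dist (ys k.+1 s) (ys k.+1 t) (y s).
  rewrite (enormBC (y t) (ys k.+1 t)); lra.
(* As a pointwise limit [y] carries no information on its derivative. [Phi y] does, and coincides
   with [y] on the window, so [Phi y] is returned as the solution. *)
have [adZ dZ] := HPhi y adY.
have ZY t : I t -> Phi y t = y t.
  move=> It; apply/eqP; rewrite -subr_eq0; apply/eqP/enorm_eq0/le_anti.
  rewrite enorm_ge0 andbT.
  apply: (@le_geometric _ _ (n%:R * 2)) => k; rewrite add0r.
  have e0 : 0 <= n%:R * 2 * (2^-1 : R) ^+ k by rewrite !mulr_ge0.
  have h1 := @contr y (ys k.+1) (Phi y) (ys k.+2) _ adY (ady _) adZ (ady _) e0 dZ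
    (HPhi _ (ady k.+1)).2.
  have h2 : enorm (Phi y t - ys k.+2 t) <= n%:R * 2 * 2^-1 ^+ k / 2.
    by apply: h1 => // s Is; rewrite enormBC; exact: Hy.
  have := Hy t It k.+1; rewrite exprS.
  have := ler_enorm_dist (ys k.+2 t) (Phi y t) (y t); lra.
exists d, K, (Phi y); split => //; [exact: adZ.1|exact: adZ.2|].
move: dZ; apply: aeS => t ht t1 t2; rewrite ZY; first exact: ht.
by split; exact: ltW.
Qed.

End LocalExistence.

(** * Gluing, maximal extension and continuation of solutions *)

Section Solutions.
Variables (R : realType) (n m : nat).
Implicit Types (S : impulsive_system R n m) (u : R -> 'rV[R]_m)
  (x y : R -> 'rV[R]_n) (gamma : set R) (T : \bar R).

Lemma cvg_leftP x (t : R) (l : 'rV[R]_n) :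
  x s @[s --> t^'-] --> l <-> forall e, 0 < e ->
    exists2 d, 0 < d & forall s, t - d < s -> s < t -> enorm (x s - l) < e.
Proof.
split=> [/cvg_enormP H e e0|H].
  have /nbhs_ballP[d /= d0 Hd] := H e e0; exists d => // s s1 s2.
  by apply: Hd => //; rewrite /ball/= ltr_norml; apply/andP; split; lra.
apply/cvg_enormP => e e0; have [d d0 Hd] := H e e0.
apply/nbhs_ballP; exists d => //= s; rewrite /ball/= ltr_norml => /andP[s1 s2] st.
by apply: Hd => //; lra.
Qed.

Lemma cvg_left_ext x y (a t : R) (l : 'rV[R]_n) : a < t ->
  (forall s, a < s -> s < t -> x s = y s) ->
  x s @[s --> t^'-] --> l -> y s @[s --> t^'-] --> l.
Proof.
move=> at0 xy /cvg_leftP H; apply/cvg_leftP => e e0; have [d d0 Hd] := H e e0.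
exists (Num.min d (t - a)); first by rewrite lt_min d0; lra.
move=> s s1 s2; have h1 : Num.min d (t - a) <= d by rewrite ge_min lexx.
have h2 : Num.min d (t - a) <= t - a by rewrite ge_min lexx orbT.
by rewrite -xy//; [apply: Hd => //|]; lra.
Qed.

Lemma is_derive_ext x y (a b t : R) w : a < t -> t < b ->
  (forall s, a < s -> s < b -> x s = y s) ->
  is_derive t (1 : R) x w -> is_derive t (1 : R) y w.
Proof.
move=> at0 tb xy; apply: near_eq_is_derive; apply/nbhs_ballP.
exists (Num.min (t - a) (b - t)) => /=; first by rewrite lt_min; apply/andP; split; lra.
move=> s; rewrite /ball/= lt_min => /andP[]; rewrite !ltr_norml => /andP[? ?] /andP[? ?].
by apply: xy; lra.
Qed.

Lemma abs_continuous_ext x y (a b : R) :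
  (forall s, a <= s -> s <= b -> x s = y s) ->
  abs_continuous a b x -> abs_continuous a b y.
Proof.
move=> xy H e e0; have [d d0 Hd] := H e e0; exists d => // N p q pq tr len.
apply: le_lt_trans (Hd N p q pq tr len); apply: ler_sum => i _.
by have [? ? ?] := pq i; rewrite !xy//; lra.
Qed.

Lemma impulse_gap gamma : impulse_times gamma ->
  forall t, exists2 d, 0 < d & forall s, gamma s -> s != t -> d <= `|s - t|.
Proof.
move=> [N [tau [_ _ _ lp0]]] t.
have : ~ limit_point gamma t by rewrite lp0.
rewrite not_limit_pointE => -[X /nbhs_ballP[d /= d0 Hd] gX].
exists d => // s gs st; rewrite leNgt; apply/negP => std.
have : s = t by apply: gX; split => //; apply: Hd; rewrite /ball/= distrC.
by move/eqP; exact/negP.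
Qed.

Lemma rco_mine (a : R) T T' t :
  rco a (mine T T') t <-> rco a T t /\ (t%:E < T')%E.
Proof.
rewrite /rco/= lt_min; split; first by move=> [-> /andP[-> ->]].
by move=> [[-> ->] ->].
Qed.

Definition ext_le (p q : \bar R * (R -> 'rV[R]_n)) (t0 : R) : Prop :=
  (p.1 <= q.1)%E /\ forall t, rco t0 p.1 t -> q.2 t = p.2 t.

(** The upper bound of a chain for Zorn's lemma. The delicate point is the almost everywhere
    derivative, since the chain may be uncountable. *)
Lemma solution_union S t0 (x0 : 'rV[R]_n) u (A : set (\bar R * (R -> 'rV[R]_n))) :
  A !=set0 -> (forall p, A p -> solution S t0 x0 u p.1 p.2) ->
  (forall p q, A p -> A q -> ext_le p q t0 \/ ext_le q p t0) ->
  exists T y, solution S t0 x0 u T y /\ forall p, A p -> ext_le p (T, y) t0.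
Proof.
move=> [p0 Ap0] solA totA.
pose T := ereal_sup [set p.1 | p in A].
have pT p : A p -> (p.1 <= T)%E by move=> Ap; apply: ereal_sup_ubound; exists p.
have memb t : (t%:E < T)%E -> exists2 p, A p & (t%:E < p.1)%E.
  by move=> /ereal_sup_gt[_ [p Ap <-] tp]; exists p.
have /choice[ch Hch] : forall t, exists p, (t%:E < T)%E -> A p /\ (t%:E < p.1)%E.
  move=> t; have [tT|tT] := pselect (t%:E < T)%E; last by exists p0.
  by have [p Ap tp] := memb t tT; exists p.
pose y t := (ch t).2 t.
have yE p t : A p -> rco t0 p.1 t -> y t = p.2 t.
  move=> Ap [tt0 tp]; have [Aq tq] := Hch t (lt_le_trans tp (pT p Ap)).
  by case: (totA _ _ Ap Aq) => -[_ H]; [rewrite /y H|rewrite /y -H].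
have gt0 : (t0%:E < T)%E.
  by have [h _ _ _] := solA _ Ap0; exact: lt_le_trans h (pT _ Ap0).
have yE' p : A p -> forall s, t0 < s -> (s%:E < p.1)%E -> p.2 s = y s.
  by move=> Ap s s1 s2; rewrite (yE p)//; split => //; exact: ltW.
exists T, y; split; last first.
  by move=> p Ap; split; [exact: pT|move=> t; exact: yE].
split => //.
- have [h <- _ _] := solA _ Ap0; apply: yE => //; by split.
- move=> t1 t2 t12 sub noimp.
  have t01 : t0 <= t1 by have [] := sub t1 (conj (lexx _) t12).
  have subp p : A p -> rco t1 (mine t2 p.1) `<=` rco t0 p.1.
    by move=> Ap t /rco_mine[[h1 h2] h3]; split => //; exact: le_trans h1.
  have nip (p : \bar R * (R -> 'rV[R]_n)) : forall t, imp S t -> ~ (t1 < t /\ (t%:E < mine t2 p.1)%E).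
    by move=> t gt [h1]; rewrite lt_min => /andP[h2 _]; apply: (noimp t).
  split.
    move=> a b ab abs; have Ib : rco t1 t2 b by apply: abs; rewrite /= in_itv/= ab lexx.
    have Ia : rco t1 t2 a by apply: abs; rewrite /= in_itv/= ab lexx.
    have [p Ap bp] := memb b (sub b Ib).2.
    have t1b : (t1%:E < mine t2 p.1)%E.
      by rewrite lt_min t12/= (le_lt_trans _ bp)// lee_fin; have [? _] := Ib.
    have [_ _ H _] := solA _ Ap.
    have [/(_ a b ab) AC _] := H t1 _ t1b (subp p Ap) (@nip p).
    apply: abs_continuous_ext (AC _).
      move=> s s1 s2; rewrite (yE p)//; split; first by have [? _] := Ia; lra.
      by rewrite (le_lt_trans _ bp)// lee_fin.
    move=> s /[dup] sab /abs sI; apply/rco_mine; split => //.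
    by move: sab; rewrite /= in_itv/= => /andP[_ sb]; rewrite (le_lt_trans _ bp)// lee_fin.
  pose r_ (k : nat) : R := if (choice.unpickle k : option rat) is Some q then ratr q else 0.
  (* Only the members chosen at rational times are used. Each [t] below the end time lies under such
     a rational, and near [t] the union agrees with the member chosen there; countably many null
     sets remain. *)
  have aek k : {ae lebR R, forall t, rco t1 (mine t2 (ch (r_ k)).1) t -> A (ch (r_ k)) ->
      is_derive t (1 : R) (ch (r_ k)).2 (flow S t ((ch (r_ k)).2 t) (u t))}.
    set p := ch _.
    have [Ap|nAp] := pselect (A p); last by apply: ae_true.
    have [t1b|nt1b] := pselect (t1%:E < mine t2 p.1)%E; last first.
      apply: ae_true => t [h1 h2]; exfalso; apply: nt1b.
      by apply: le_lt_trans h2; rewrite lee_fin.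
    have [_ _ H _] := solA _ Ap.
    have [_] := H t1 _ t1b (subp p Ap) (@nip p).
    by apply: aeS => t ht It _; apply: ht.
  have := aeI (ae_foralln aek) (ae_neq t1); apply: aeS => t [ht tt1] It.
  have t1t : t1 < t by rewrite lt_neqAle eq_sym tt1; have [] := It.
  have tT := (sub t It).2.
  have [p Ap tp] := memb t tT.
  have [k [tk kp]] : exists k, t < r_ k /\ ((r_ k)%:E < p.1)%E.
    have [b tb bp] : exists2 b : R, t < b & (b%:E <= p.1)%E.
      case: (p.1) tp => [r| |]; rewrite ?lte_fin.
      - by move=> tr; exists r.
      - by exists (t + 1); [lra|rewrite leey].
      - by rewrite ltNge leNye.
    have [q] := rat_in_itvoo tb; rewrite in_itv/= => /andP[tq qb].
    exists (choice.pickle q); rewrite /r_ choice.pickleK; split => //.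
    by apply: lt_le_trans bp; rewrite lte_fin.
  have [Aq qk] := Hch (r_ k) (lt_le_trans kp (pT _ Ap)).
  set q := ch _ in Aq qk.
  have tq : (t%:E < q.1)%E by apply: lt_trans qk; rewrite lte_fin.
  have := ht k; rewrite -/q => /(_ _ Aq).
  have Itq : rco t1 (mine t2 q.1) t by apply/rco_mine.
  move=> /(_ Itq); rewrite -(yE q)//; last by split => //; lra.
  apply: (@is_derive_ext _ _ t0 (r_ k)) => //; first lra.
  by move=> s s1 s2; apply: yE' => //; apply: lt_trans qk; rewrite lte_fin.
- move=> t gt t0t tT; have [p Ap tp] := memb t tT.
  have [_ _ _ /(_ t gt t0t tp)[xl cxl jx]] := solA _ Ap.
  exists xl; last by rewrite (yE p)//; split => //; exact: ltW.
  apply: cvg_left_ext cxl; first exact: t0t.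
  by move=> s s1 s2; apply: yE' => //; apply: lt_trans tp; rewrite lte_fin.
Qed.

(** Zorn's lemma for a preorder: values outside the interval of existence are arbitrary, so
    antisymmetry fails. *)
Lemma maximal_extension S t0 (x0 : 'rV[R]_n) u T y : solution S t0 x0 u T y ->
  exists T' y', maximal_solution S t0 x0 u T' y'.
Proof.
move=> sol.
pose P := {p : \bar R * (R -> 'rV[R]_n) | solution S t0 x0 u p.1 p.2}.
pose p0 : P := exist _ (T, y) sol.
pose Rel (p q : P) : bool := `[< ext_le (sval p) (sval q) t0 >].
have [||A totA|p Hp] := @ZL_preorder P p0 Rel.
- by move=> p; apply/asboolP; split.
- move=> r p q /asboolP[h1 h2] /asboolP[h3 h4]; apply/asboolP; split.
    exact: le_trans h3.
  move=> t It; rewrite h4 ?h2//; have [? h] := It; split => //.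
  exact: lt_le_trans h h1.
- have [[p Ap]|A0] := pselect (A !=set0); last first.
    by exists p0 => s As; exfalso; apply: A0; exists s.
  have [||q q' [s As <-] [s' As' <-]|T' [y' [sol' Hy']]] :=
      @solution_union S t0 x0 u [set sval s | s in A].
  + by exists (sval p), p.
  + by move=> q [s _ <-]; exact: svalP s.
  + by case: (totA s s' As As') => /asboolP; [left|right].
  exists (exist _ (T', y') sol') => s As; apply/asboolP; apply: Hy'.
  by exists s.
exists (sval p).1, (sval p).2; split; first exact: svalP p.
move=> [T' [y' [sol' lt' ag]]].
have := Hp (exist _ (T', y') sol'); rewrite /Rel => HH.
have : `[< ext_le (sval p) (T', y') t0 >].
  by apply/asboolP; split => //=; exact: ltW.
move=> /HH /asboolP[/=]; rewrite leNgt lt'. by [].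
Qed.

End Solutions.

(** Sampling [y] at [tau - r * 2^-1 ^+ k] with [K * r <= 1] makes consecutive differences at most
    [2^-1 ^+ k]. *)
Lemma lipschitz_left_limit (R : realType) (n : nat) (t1 tau K : R)
    (y : R -> 'rV[R]_n) : t1 < tau -> 0 <= K ->
  (forall a b, t1 <= a -> a <= b -> b < tau -> enorm (y b - y a) <= K * (b - a)) ->
  exists l, forall s, t1 <= s -> s < tau -> enorm (y s - l) <= K * (tau - s).
Proof.
move=> t1tau K0 ylip.
pose r := Num.min (tau - t1) (K + 1)^-1.
have r0 : 0 < r by rewrite lt_min invr_gt0 subr_gt0 t1tau/= ltr_wpDl.
have r1 : r <= tau - t1 by rewrite ge_min lexx.
have rK : K * r <= 1.
  have h : r <= (K + 1)^-1 by rewrite ge_min lexx orbT.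
  have K1 : 0 < K + 1 by lra.
  have := ler_wpM2l (ltW K1) h; rewrite divff ?gt_eqF// mulrDl mul1r.
  by have := ltW r0; lra.
clearbody r.
have pos k : 0 < (2^-1 : R) ^+ k by rewrite exprn_gt0// invr_gt0.
have pow1 k : (2^-1 : R) ^+ k <= 1 by rewrite exprn_ile1// ?invr_ge0// invf_le1//; lra.
pose tk k := tau - r * 2^-1 ^+ k.
have rp k : r * 2^-1 ^+ k <= r by rewrite ler_piMr// ltW.
have rp0 k : 0 < r * 2^-1 ^+ k by rewrite mulr_gt0.
have tk1 k : t1 <= tk k by have := rp k; rewrite /tk; lra.
have tk2 k : tk k < tau by have := rp0 k; rewrite /tk; lra.
have [k|l Hl] := @geometric_limit_vec _ _ (fun k => y (tk k)).
  have h1 : tk k <= tk k.+1 by rewrite /tk exprS; have := rp0 k; lra.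
  apply: (le_trans (ylip _ _ (tk1 k) h1 (tk2 k.+1))).
  have -> : K * (tk k.+1 - tk k) = K * r * (2^-1 ^+ k / 2).
    by rewrite /tk exprS; field.
  apply: (@le_trans _ _ (1 * (2^-1 ^+ k / 2))); last by have := pos k; lra.
  by apply: ler_wpM2r => //; have := pos k; lra.
exists l => s s1 stau.
apply: (@le_geometric _ _ _ (K * r + n%:R * 2)) => k.
have h1 := Hl k; have h2 := ler_enorm_dist (y (tk k)) (y s) l.
have h3 : enorm (y s - y (tk k)) <= K * ((tau - s) + r * 2^-1 ^+ k).
  have := rp0 k; have [stk|tks] := leP s (tk k) => hr.
    rewrite enormBC; apply: (le_trans (ylip _ _ s1 stk (tk2 k))).
    by apply: ler_wpM2l => //; rewrite /tk; lra.
  apply: (le_trans (ylip _ _ (tk1 k) (ltW tks) stau)).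
  by apply: ler_wpM2l => //; rewrite /tk; lra.
by lra.
Qed.

Section Continuation.
Variables (R : realType) (n m : nat) (S : impulsive_system R n m).
Variables (u : R -> 'rV[R]_m) (Mu : R).
Hypothesis flow_bounded : forall c, exists2 K, 0 <= K &
  forall t x mu, 0 <= t -> enorm x <= c -> enorm mu <= c -> enorm (flow S t x mu) <= K.
Hypothesis flow_lipschitz : forall c, exists2 C, 0 <= C &
  forall t x y mu, 0 <= t -> enorm x <= c -> enorm y <= c -> enorm mu <= c ->
    enorm (flow S t x mu - flow S t y mu) <= C * enorm (x - y).
Hypothesis u_measurable : Lmeasurable `[0, +oo[%classic u.
Hypothesis u_bounded : forall t, 0 <= t -> enorm (u t) <= Mu.
Implicit Types (y : R -> 'rV[R]_n) (x xi : 'rV[R]_n) (T : \bar R).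

Lemma local_flow (tau d0 : R) xi : 0 <= tau -> 0 < d0 ->
  exists d K y, [/\ 0 < d, d <= d0, y tau = xi,
    forall s t, tau <= s -> s <= t -> t <= tau + d -> enorm (y t - y s) <= K * (t - s) &
    {ae lebR R, forall t : R, tau < t -> t < tau + d ->
       is_derive t (1 : R) y (flow S t (y t) (u t))}].
Proof.
have [mf cf _] := flowP S; move=> tau0 d00.
exact: (local_ode xi mf cf flow_bounded flow_lipschitz u_measurable u_bounded tau0 d00).
Qed.

Lemma local_solution (t0 : R) x0 : 0 <= t0 ->
  exists T y, solution S t0 x0 u T y.
Proof.
move=> t00; have [d0 d00 gap] := impulse_gap (impP S) t0.
have [d [K [y [d_gt0 dd0 yt0 lip dy]]]] := local_flow x0 t00 d00.
exists (t0 + d)%:E, y; split => //.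
- by rewrite lte_fin; lra.
- move=> t1 t2 t12 sub noimp; split.
    move=> a b ab abs; apply: (@lipschitz_abs_continuous _ _ _ _ _ K) => s t sa st tb.
    have [a1 _] : rco t0 (t0 + d)%:E a by apply/sub/abs; rewrite /= in_itv/= lexx.
    have [_] : rco t0 (t0 + d)%:E b by apply/sub/abs; rewrite /= in_itv/= ab lexx.
    rewrite lte_fin => b2.
    by apply: lip; lra.
  have := aeI dy (ae_neq t0); apply: aeS => t [ht tt0] /sub[t0t].
  by rewrite lte_fin; apply: ht; rewrite lt_neqAle eq_sym tt0.
- move=> t gt t0t; rewrite lte_fin => td; exfalso.
  have := gap t gt; rewrite gt_eqF// => /(_ isT).
  by rewrite ger0_norm; lra.
Qed.

Lemma solution_glue (t0 tau de K Kz : R) x0 y z (l : 'rV[R]_n) :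
  solution S t0 x0 u tau%:E y -> 0 < de -> 0 <= K -> 0 <= Kz ->
  (forall t, imp S t -> tau < t -> tau + de <= t) ->
  (forall s1, t0 <= s1 -> (forall t, imp S t -> ~ (s1 < t /\ t < tau)) ->
    (forall a b, s1 <= a -> a <= b -> b < tau -> enorm (y b - y a) <= K * (b - a)) /\
    (forall s, s1 <= s -> s < tau -> enorm (y s - l) <= K * (tau - s))) ->
  y s @[s --> tau^'-] --> l ->
  (forall s t, tau <= s -> s <= t -> t <= tau + de -> enorm (z t - z s) <= Kz * (t - s)) ->
  {ae lebR R, forall t : R, tau < t -> t < tau + de ->
     is_derive t (1 : R) z (flow S t (z t) (u t))} ->
  (~ imp S tau -> z tau = l) ->
  (imp S tau -> z tau = l + jump S tau l (u tau)) ->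
  solution S t0 x0 u (tau + de)%:E (fun t => if t < tau then y t else z t).
Proof.
move=> [t0T yt0 ygap yimp] de0 K0 Kz0 gap ylip yl zlip dz znimp zimp.
rewrite lte_fin in t0T.
set w := fun t => if t < tau then y t else z t.
have wy t : t < tau -> y t = w t by rewrite /w => ->.
have wz t : tau <= t -> z t = w t by rewrite /w leNgt => /negbTE ->.
split.
- by rewrite lte_fin (lt_trans t0T)// ltrDl.
- by rewrite -wy.
- clear zimp yimp gap yl yt0.
  move=> s1 s2 s12 sub noimp.
  have s1t0 : t0 <= s1 by have [] := sub s1 (conj (lexx _) s12).
  have subm : rco s1 (mine s2 tau%:E) `<=` rco t0 tau%:E.
    by move=> t /rco_mine[[h1 h2] h3]; split => //; exact: le_trans h1.
  have nim t : imp S t -> ~ (s1 < t /\ (t%:E < mine s2 tau%:E)%E).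
    by move=> gt [h1]; rewrite lt_min => /andP[h2 _]; apply: (noimp t).
  split.
    clear dz; move=> a b ab abs.
    have [a1 a2] : rco s1 s2 a by apply: abs; rewrite /= in_itv/= lexx.
    have [b1 b2] : rco s1 s2 b by apply: abs; rewrite /= in_itv/= lexx ab.
    have bde : b < tau + de by have [_] := sub b (conj b1 b2); rewrite lte_fin.
    have [btau|taub] := ltP b tau.
      have s1m : (s1%:E < mine s2 tau%:E)%E.
        by rewrite lt_min s12 lte_fin (le_lt_trans b1).
      have [AC _] := ygap s1 _ s1m subm nim.
      apply: abs_continuous_ext (AC a b ab _).
        by move=> s _ sb; apply: wy; exact: le_lt_trans sb btau.
      move=> s /[dup] sab /abs sI; apply/rco_mine; split => //.
      by move: sab; rewrite /= in_itv/= => /andP[_ sb]; rewrite lte_fin (le_lt_trans sb).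
    have [taua|atau] := leP tau a.
      apply: (@abs_continuous_ext _ _ z) => [s sa _|].
        by apply: wz; exact: le_trans sa.
      apply: (@lipschitz_abs_continuous _ _ _ _ _ Kz) => s t sa st tb.
      apply: zlip => //; first exact: le_trans sa.
      by apply: le_trans tb _; exact: ltW.
    (* The interval straddles [tau] and has no impulse inside, so [z] starts at the left limit [l]
       and the two Lipschitz estimates join there. *)
    have nimp_tau : ~ imp S tau.
      move=> gtau; apply: (noimp tau gtau); split; first exact: le_lt_trans atau.
      by apply: le_lt_trans b2; rewrite lee_fin.
    have noimp' t : imp S t -> ~ (s1 < t /\ t < tau).
      move=> gt [h1 h2]; apply: (noimp t gt); split => //.
      by apply: le_lt_trans b2; rewrite lee_fin ltW// (lt_le_trans h2).
    have [yL yl] := ylip s1 s1t0 noimp'.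
    have zl := znimp nimp_tau.
    clear ygap sub noimp noimp' subm nim abs ylip znimp a2 b2 s12.
    apply: (@lipschitz_abs_continuous _ _ _ _ _ (K + Kz)) => s t sa st tb.
    rewrite mulrDl.
    have ts0 : 0 <= t - s by rewrite subr_ge0.
    have e1 := mulr_ge0 K0 ts0; have e2 := mulr_ge0 Kz0 ts0.
    have [ttau|taut] := ltP t tau.
      rewrite -!wy//; last exact: le_lt_trans ttau.
      by apply: ler_wpDr e2 _; apply: yL => //; exact: le_trans sa.
    have tde : t <= tau + de by exact: le_trans tb (ltW bde).
    rewrite -(wz t)//.
    have [taus|stau] := leP tau s.
      by rewrite -wz//; apply: ler_wpDl e1 _; exact: zlip.
    rewrite -wy//.
    have h1 := zlip tau t (lexx _) taut tde.
    have h2 := yl s (le_trans a1 sa) stau.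
    have h3 := ler_enorm_dist l (z t) (y s).
    rewrite zl in h1; rewrite (enormBC l) in h3.
    have h4 : K * (tau - s) <= K * (t - s) by rewrite ler_wpM2l// lerD2r.
    have h5 : Kz * (t - tau) <= Kz * (t - s) by rewrite ler_wpM2l// lerD2l lerN2 ltW.
    by clear -flow_bounded flow_lipschitz u_measurable u_bounded h1 h2 h3 h4 h5; lra.
  have dy : {ae lebR R, forall t, rco s1 (mine s2 tau%:E) t ->
      is_derive t (1 : R) y (flow S t (y t) (u t))}.
    have [s1m|ns1m] := pselect (s1%:E < mine s2 tau%:E)%E; last first.
      apply: ae_true => t [h1 h2]; exfalso; apply: ns1m.
      by apply: le_lt_trans h2; rewrite lee_fin.
    by have [] := ygap s1 _ s1m subm nim.
  have := aeI (aeI dy dz) (aeI (ae_neq tau) (ae_neq s1)).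
  apply: aeS => t [[hy hz] [tt tt1]] It; have [s1t ts2] := It.
  have [_] := sub t It; rewrite lte_fin => tde.
  have {}s1t : s1 < t by rewrite lt_neqAle eq_sym tt1.
  have [ttau|taut] := ltP t tau.
    rewrite -wy//; apply: (@is_derive_ext _ _ y _ s1 tau) => //.
      by move=> s _; exact: wy.
    by apply: hy; apply/rco_mine; split => //; rewrite lte_fin.
  have {}taut : tau < t by rewrite lt_neqAle eq_sym tt.
  rewrite -wz ?ltW//; apply: (@is_derive_ext _ _ z _ tau (tau + de)) => //.
  - by move=> s h _; apply: wz; exact: ltW.
  - exact: hz.
- move=> t gt t0t; rewrite lte_fin => tde.
  have [ttau|] := ltP t tau.
    have tt : (t%:E < tau%:E)%E by rewrite lte_fin.
    have [xl cxl jx] := yimp t gt t0t tt.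
    exists xl; last by rewrite -wy.
    apply: cvg_left_ext cxl; first exact: t0t.
    by move=> s _ st; apply: wy; exact: lt_trans ttau.
  rewrite le_eqVlt => /predU1P[tE|taut].
    exists l; last by rewrite -tE -wz// zimp// tE.
    rewrite -tE; apply: cvg_left_ext yl; first exact: t0T.
    by move=> s _ st; exact: wy.
  by have := gap t gt taut; rewrite leNgt tde.
Qed.

(** At a finite end time [tau] a bounded solution is Lipschitz after the last earlier impulse, hence
    has a left limit. Restarting from it, after the jump if [tau] is an impulse, contradicts
    maximality. *)
Lemma continuation (t0 : R) x0 T y (B : R) : 0 <= t0 ->
  maximal_solution S t0 x0 u T y ->
  (forall t, rco t0 T t -> enorm (y t) <= B) -> T = +oo%E.
Proof.
move=> t00 [sol maxi] yB; have [t0T yt0 ygap yimp] := sol.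
case: T => [tau| |] in sol maxi yB t0T ygap yimp *; [exfalso|by []|by []].
rewrite lte_fin in t0T; apply: maxi.
have tau0 : 0 <= tau by exact: le_trans (ltW t0T).
pose c := Num.max B Mu.
have yc t : t0 <= t -> t < tau -> enorm (y t) <= c.
  by move=> h1 h2; rewrite le_max yB//; split => //; rewrite lte_fin.
have uc t : 0 <= t -> enorm (u t) <= c.
  by move=> h; rewrite le_max u_bounded// orbT.
have [K K0 HK] := flow_bounded c.
have ylip t1 : t0 <= t1 -> (forall t, imp S t -> ~ (t1 < t /\ t < tau)) ->
    forall a b, t1 <= a -> a <= b -> b < tau -> enorm (y b - y a) <= K * (b - a).
  move=> t1t0 noimp a b t1a ab btau.
  have t0a := le_trans t1t0 t1a.
  have t1tau : (t1%:E < tau%:E)%E by rewrite lte_fin (le_lt_trans t1a)// (le_lt_trans ab).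
  have sub : rco t1 tau%:E `<=` rco t0 tau%:E.
    by move=> t [h1 h2]; split => //; exact: le_trans h1.
  have [AC dy] := ygap t1 tau%:E t1tau sub noimp.
  apply: mvt_enorm => //.
    apply: AC => // t; rewrite /= in_itv/= => /andP[h1 h2]; split.
      exact: le_trans h1.
    by rewrite lte_fin (le_lt_trans h2).
  move: dy; apply: aeS => t ht ta tb; exists (flow S t (y t) (u t)).
    apply: ht; split; first exact: le_trans (ltW ta).
    by rewrite lte_fin (lt_trans tb).
  have t0t : t0 <= t by exact: le_trans (ltW ta).
  have t00t : 0 <= t by exact: le_trans t0t.
  by apply: HK => //; [apply: yc => //; exact: lt_trans tb btau|exact: uc].
have [d d0 gap] := impulse_gap (impP S) tau.
pose t1 := Num.max t0 (tau - d).
have t1t0 : t0 <= t1 by rewrite le_max lexx.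
have t1d : tau - d <= t1 by rewrite le_max lexx orbT.
have t1tau : t1 < tau by rewrite gt_max t0T ltrBlDr ltrDl.
have noimp1 t : imp S t -> ~ (t1 < t /\ t < tau).
  move=> gt [h1 h2]; have := gap t gt; rewrite lt_eqF// => /(_ isT).
  by rewrite ltr0_norm ?subr_lt0//; clear -flow_bounded flow_lipschitz u_measurable u_bounded h1 h2 t1d; lra.
clearbody t1.
have [l Hl] := lipschitz_left_limit t1tau K0 (ylip t1 t1t0 noimp1).
(* The limit was found from [t1] on; an impulse-free stretch that begins earlier is reached by
   passing through [t1]. *)
have yl t2 s : t0 <= t2 -> (forall t, imp S t -> ~ (t2 < t /\ t < tau)) ->
    t2 <= s -> s < tau -> enorm (y s - l) <= K * (tau - s).
  move=> t2t0 noimp2 t2s stau.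
  have [st1|t1s] := leP s t1; last exact: Hl (ltW t1s) stau.
  have h1 := ylip t2 t2t0 noimp2 s t1 t2s st1 t1tau.
  have h2 := Hl t1 (lexx _) t1tau.
  have h3 := ler_enorm_dist (y t1) (y s) l; rewrite (enormBC (y s) (y t1)) in h3.
  by clear -flow_bounded flow_lipschitz u_measurable u_bounded h1 h2 h3; lra.
pose xi := if `[< imp S tau >] then l + jump S tau l (u tau) else l.
have [de [K' [z [de0 ded ztau zlip dz]]]] := local_flow xi tau0 d0.
have K'0 : 0 <= K'.
  have tde : tau <= tau + de by rewrite lerDl ltW.
  have := zlip tau (tau + de) (lexx _) tde (lexx _).
  rewrite addrAC subrr add0r => h; rewrite -(pmulr_lge0 _ de0).
  exact: le_trans (enorm_ge0 _) h.
exists (tau + de)%:E, (fun t => if t < tau then y t else z t); split.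
- apply: (@solution_glue t0 tau de K K' _ _ _ l) => //.
  + move=> t gt taut; have := gap t gt; rewrite gt_eqF// => /(_ isT).
    by rewrite gtr0_norm ?subr_gt0// lerBrDr addrC => h; rewrite (le_trans _ h)// lerD2l.
  + move=> s1 s1t0 noimp; split; first exact: ylip.
    by move=> s; exact: yl.
  + apply/cvg_leftP => e e0.
    exists (Num.min (tau - t1) (e / (K + 1))).
      by rewrite lt_min subr_gt0 t1tau/= divr_gt0// ltr_wpDl.
    move=> s h1 h2.
    have g1 : Num.min (tau - t1) (e / (K + 1)) <= tau - t1 by rewrite ge_min lexx.
    have g2 : Num.min (tau - t1) (e / (K + 1)) <= e / (K + 1) by rewrite ge_min lexx orbT.
    have t1s : t1 <= s by clear -flow_bounded flow_lipschitz u_measurable u_bounded g1 h1; lra.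
    apply: (le_lt_trans (Hl s t1s h2)).
    have : tau - s < e / (K + 1) by clear -flow_bounded flow_lipschitz u_measurable u_bounded g2 h1; lra.
    rewrite ltr_pdivlMr; last by rewrite ltr_wpDl.
    by clear -flow_bounded flow_lipschitz u_measurable u_bounded h2; lra.
  + by move=> nimp; rewrite ztau /xi asboolF.
  + by move=> gtau; rewrite ztau /xi asboolT.
- by rewrite lte_fin ltrDl.
- by move=> t [_]; rewrite lte_fin => ->.
Qed.

(** The a priori bound ranges over maximal solutions with any end time, the form in which weak ISS
    provides it. *)
Lemma global_solution (t0 : R) x0 (B : R) : 0 <= t0 ->
  (forall T y t, maximal_solution S t0 x0 u T y -> rco t0 T t -> enorm (y t) <= B) ->
  exists y, maximal_solution S t0 x0 u +oo%E y.
Proof.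
move=> t00 HB; have [T [y sol]] := local_solution x0 t00.
have [T' [y' msol]] := maximal_extension sol.
have T'E := continuation t00 msol (fun t => HB T' y' t msol).
by exists y'; rewrite -T'E.
Qed.

End Continuation.

(** * Truncated inputs and comparison of solutions *)

Section ClassKFacts.
Variables (R : realType) (alpha : R -> R).
Hypothesis alphaK : classK alpha.

Lemma classK_mono r s : 0 <= r -> r <= s -> alpha r <= alpha s.
Proof.
have [_ mono _] := alphaK.
by move=> r0; rewrite le_eqVlt => /predU1P[->//|rs]; exact/ltW/mono.
Qed.

Lemma classK_ge0 r : 0 <= r -> 0 <= alpha r.
Proof.
move=> r0; have [_ _ a0] := alphaK.
by rewrite -[leLHS]a0; exact: classK_mono.
Qed.

Lemma classK_small e : 0 < e -> exists2 d, 0 < d &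
  forall r, 0 <= r -> r < d -> alpha r < e.
Proof.
move=> e0; have [/within_ge0P c _ a0] := alphaK.
have [d d0 Hd] := c 0 (lexx _) e e0; exists d => // r r0 rd.
have := Hd r r0; rewrite a0 !subr0 (ger0_norm r0) => /(_ rd).
by rewrite (ger0_norm (classK_ge0 r0)).
Qed.

End ClassKFacts.

Section Impulses.
Variable R : realType.
Implicit Types (gamma : set R) (a b s t : R).

Lemma finite_impulses gamma a b : impulse_times gamma ->
  finite_set (gamma `&` `]a, b]%classic).
Proof.
move=> [N [tau [_ _ _ lp0]]]; apply: contrapT => inf.
have [|l ll] := infinite_bounded_limit_point_nonempty inf.
  exists (`|a| + `|b|); split; first exact: num_real.
  move=> M hM s [_] /=; rewrite in_itv/= => /andP[h1 h2].
  apply: le_trans (ltW hM); rewrite ler_norml.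
  have := ler_norm b; have := ler_norm (- a); rewrite normrN.
  by have := normr_ge0 a; have := normr_ge0 b => *; apply/andP; split; lra.
suff : (set0 : set R) l by [].
by rewrite -lp0 => U /ll [y [yl [gy _] Uy]]; exists y.
Qed.

Lemma nimp_eq0 gamma a b : impulse_times gamma ->
  nimp gamma `]a, b]%classic = 0%N -> forall s, gamma s -> a < s -> b < s.
Proof.
move=> ig /cardfs0_eq H s gs as_; rewrite ltNge; apply/negP => sb.
have : s \in fset_set (gamma `&` `]a, b]%classic).
  rewrite in_fset_set; last exact: finite_impulses.
  by rewrite inE; split => //=; rewrite in_itv/= as_.
by rewrite H in_fset0.
Qed.

Lemma nimp_lt gamma a b s tau : impulse_times gamma ->
  gamma tau -> a < tau -> tau <= b -> s < tau ->
  (nimp gamma `]a, s]%classic < nimp gamma `]a, b]%classic)%N.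
Proof.
move=> ig gtau atau taub stau; apply: fproper_ltn_card.
have fs := finite_impulses a s ig; have fb := finite_impulses a b ig.
rewrite fproperE; apply/andP; split.
  apply/fsubsetP => x; rewrite !in_fset_set// !inE => -[gx] /=.
  by rewrite !in_itv/= => /andP[h1 h2]; split => //=; rewrite ?in_itv/= h1/=; lra.
apply/negP => /fsubsetP /(_ tau); rewrite !in_fset_set// !inE.
have h : (gamma `&` `]a, b]%classic) tau by split => //=; rewrite ?in_itv/= atau.
by move=> /(_ h)[_] /=; rewrite in_itv/= leNgt stau andbF.
Qed.

Lemma last_impulse gamma a b : impulse_times gamma ->
  (exists s, [/\ gamma s, a < s & s <= b]) ->
  exists tau, [/\ gamma tau, a < tau, tau <= b &
    forall s, gamma s -> tau < s -> b < s].
Proof.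
move=> ig [s0 [gs0 as0 s0b]].
pose A := [set s | [/\ gamma s, a < s & s <= b]].
have hA : has_sup A by split; [exists s0|exists b => s []].
have ub s : A s -> s <= sup A by move=> As; apply: ub_le_sup => //; exact: hA.2.
have [d d0 gap] := impulse_gap ig (sup A).
have [s [gs as_ sb] hs] := sup_adherent d0 hA.
have sE : s = sup A.
  apply/eqP; apply: contraT => ne; have := gap s gs ne.
  have h : s <= sup A by exact: ub.
  by rewrite ler0_norm ?subr_le0//; lra.
exists (sup A); rewrite -sE; split => // r gr sr; rewrite ltNge; apply/negP => rb.
have : r <= s by rewrite sE; apply: ub; split => //; exact: lt_trans sr.
by rewrite leNgt sr.
Qed.

End Impulses.

Section Truncation.
Variables (R : realType) (n m : nat).
Implicit Types (u : R -> 'rV[R]_m) (v : R -> R).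

Definition trunc_input (r : R) u (t : R) : 'rV[R]_m :=
  if enorm (u t) <= r then u t else 0.

(** The gain of the whole value, not of the overshoot above [r]: the truncated input is 0 there, so
    the incremental bound compares [u t] with 0. *)
Definition excess v (r : R) u (t : R) : R :=
  if enorm (u t) <= r then 0 else v (enorm (u t)).

Lemma enorm_trunc r u t : 0 <= r -> enorm (trunc_input r u t) <= r.
Proof. by move=> r0; rewrite /trunc_input; case: ifPn => // _; rewrite enorm0. Qed.

Lemma excess_ge0 v r u t : classK v -> 0 <= excess v r u t.
Proof.
move=> vK; rewrite /excess; case: ifPn => // _.
exact: classK_ge0 (enorm_ge0 _).
Qed.

Notation cara := (caratheodory_type (wlength (@idfun R))^*%mu).

Lemma Lmeasurable_trunc (D : set cara) r u : measurable D ->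
  Lmeasurable D u -> Lmeasurable D (trunc_input r u).
Proof.
move=> mD mu i.
have -> : (fun t => trunc_input r u t 0 i) =
   (fun t => if enorm (u t) <= r then u t 0 i else 0).
  by apply/funext => t; rewrite /trunc_input; case: ifPn => // _; rewrite mxE.
apply: (measurable_fun_if mD).
- by apply: measurable_fun_ler; [exact: Lmeasurable_enorm|exact: measurable_cst].
- exact: (measurable_funS mD (@subIsetl _ _ _) (mu i)).
- exact: measurable_cst.
Qed.

Lemma measurable_excess (D : set cara) v r u : classK v -> 0 <= r ->
  Lmeasurable D u ->
  measurable_fun D (excess v r u : cara -> measurableTypeR R).
Proof.
move=> vK r0 mu.
apply: (@Lmeasurable_mono_comp R D (fun s => if s <= r then 0 else v s) (fun t => enorm (u t))).
- move=> s t s0 st; case: ifPn => [_|].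
    by case: ifPn => // _; apply: classK_ge0 => //; exact: le_trans st.
  rewrite -ltNge => rs; have -> : (t <= r) = false by rewrite leNgt (lt_le_trans rs st).
  exact: classK_mono.
- by move=> t; exact: enorm_ge0.
- exact: Lmeasurable_enorm.
Qed.

Variables (h : R -> 'rV[R]_n -> 'rV[R]_m -> 'rV[R]_n) (vphit eta vphi N O P : R -> R).
Hypotheses (vphitK : classK vphit) (etaK : classK eta) (vphiK : classK vphi).
Hypotheses (NP : cont_nondecreasing N) (OP : cont_nondecreasing O)
  (PP : cont_nondecreasing P).
Hypothesis hB : incr_bounds h vphit eta vphi N O P.

Lemma incr_bounds_input c t x mu : 0 <= t -> enorm x <= c ->
  enorm (h t x mu - h t x 0) <= vphit (enorm mu) * (N c + O 0).
Proof.
move=> t0 xc; have [H _] := hB; apply: le_trans (H t x mu 0 t0) _.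
rewrite subr0 enorm0 min_r ?enorm_ge0//.
apply: ler_wpM2l; first exact: classK_ge0 (enorm_ge0 _).
by rewrite lerD2r; have [_ mono _] := NP; apply: mono => //; exact: enorm_ge0.
Qed.

Lemma incr_bounds_state c t x y mu : 0 <= t -> enorm x <= c -> enorm mu <= c ->
  enorm (h t x mu - h t y mu) <= eta (enorm (x - y)) * (P c + vphi c).
Proof.
move=> t0 xc muc; have [_ H] := hB; apply: le_trans (H t x y mu t0) _.
apply: ler_wpM2l; first exact: classK_ge0 (enorm_ge0 _).
apply: lerD; last exact: classK_mono (enorm_ge0 _) muc.
have [_ mono _] := PP; apply: mono; first by rewrite le_min !enorm_ge0.
by rewrite ge_min xc.
Qed.

(** The input is changed at the state [x], then the state at the truncated input. Thus only [x] and
    [r] need the bound [c]; [y] enters through a minimum. *)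
Lemma incr_bounds_trunc c r u t x y : 0 <= t -> 0 <= r -> r <= c ->
  enorm x <= c ->
  enorm (h t x (u t) - h t y (trunc_input r u t)) <=
    excess vphit r u t * (N c + O 0) + eta (enorm (x - y)) * (P c + vphi c).
Proof.
move=> t0 r0 rc xc; apply: le_trans (ler_enorm_dist (h t x (trunc_input r u t)) _ _) _.
apply: lerD; last first.
  by apply: incr_bounds_state => //; apply: le_trans (enorm_trunc _ _ r0) rc.
rewrite /trunc_input /excess; case: ifPn => _.
  by rewrite subrr enorm0 mul0r.
exact: incr_bounds_input.
Qed.

Lemma incr_bounds_bounded c : (forall t, 0 <= t -> h t 0 0 = 0) ->
  exists2 K, 0 <= K & forall t x mu, 0 <= t -> enorm x <= c -> enorm mu <= c ->
    enorm (h t x mu) <= K.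
Proof.
move=> h00; have [c0|c0] := leP 0 c; last first.
  by exists 0 => // t x mu _ xc; have := le_lt_trans (le_trans (enorm_ge0 x) xc) c0; rewrite ltxx.
have [_ Nm N0] := NP; have [_ Om O0] := OP; have [_ Pm P0] := PP.
have K1 : 0 <= vphit c * (N c + O 0).
  by apply: mulr_ge0; [exact: classK_ge0|apply: addr_ge0; [exact: N0|exact: O0]].
have K2 : 0 <= eta c * (P c + vphi c).
  by apply: mulr_ge0; [exact: classK_ge0|apply: addr_ge0; [exact: P0|exact: classK_ge0]].
exists (vphit c * (N c + O 0) + eta c * (P c + vphi c)); first by rewrite addr_ge0.
move=> t x mu t0 xc muc.
have := ler_enorm_sub (h t x mu) (h t x 0); move=> H; apply: (le_trans H).
rewrite addrC; apply: lerD.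
  apply: (le_trans (incr_bounds_input _ t0 xc)).
  by apply: ler_wpM2r; [apply: addr_ge0; [exact: N0|exact: O0]|exact: classK_mono (enorm_ge0 _) muc].
have := @incr_bounds_state c t x 0 0 t0 xc; rewrite enorm0 h00// !subr0 => /(_ c0) H2.
apply: (le_trans H2); apply: ler_wpM2r.
  by apply: addr_ge0; [exact: P0|exact: classK_ge0].
exact: classK_mono (enorm_ge0 _) xc.
Qed.

End Truncation.

Section Perturbation.
Variables (R : realType) (n m : nat).
Implicit Types (S : impulsive_system R n m) (u : R -> 'rV[R]_m).

Lemma solution_flow S t0 (x0 : 'rV[R]_n) u T x (a b : R) :
  solution S t0 x0 u T x -> t0 <= a -> a <= b -> (b%:E < T)%E ->
  (forall s, imp S s -> a < s -> b < s) ->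
  abs_continuous a b x /\
  {ae lebR R, forall t : R, a < t -> t < b ->
    is_derive t (1 : R) x (flow S t (x t) (u t))}.
Proof.
move=> [_ _ gapx _] t0a ab bT noimp.
(* Solutions are described on half-open intervals, so [b] must become an inner point; the next
   impulse is at least [d] away. *)
have [d d0 gap] := impulse_gap (impP S) b.
have bt2 : (b%:E < mine T (b + d)%:E)%E by rewrite lt_min bT lte_fin ltrDl.
have at2 : (a%:E < mine T (b + d)%:E)%E by apply: le_lt_trans bt2; rewrite lee_fin.
have [||AC dx] := gapx a _ at2.
- by move=> t /rco_mine[[h1 h2] h3]; split => //; exact: le_trans h1.
- move=> s gs [as_]; rewrite lt_min lte_fin => /andP[_ sbd].
  have bs := noimp s gs as_.
  have := gap s gs; rewrite gt_eqF// => /(_ isT).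
  by rewrite gtr0_norm ?subr_gt0// lerBrDr leNgt addrC sbd.
split.
  apply: AC => // s; rewrite /= in_itv/= => /andP[h1 h2]; split => //.
  by apply: le_lt_trans bt2; rewrite lee_fin.
move: dx; apply: aeS => t ht h1 h2; apply: ht; split; first exact: ltW.
by apply: lt_trans bt2; rewrite lte_fin.
Qed.

(** The excess is only essentially bounded on [[0, b]]. Capping it at [v M'] changes it there on a
    null set only, and can only lower the integral, which leaves an inequality. *)
Lemma excess_antiderivative (v : R -> R) (r b : R) u : classK v -> 0 <= r ->
  input u -> 0 <= b ->
  exists H : R -> R,
    [/\ forall s t, 0 <= s -> s <= t -> H s <= H t,
        forall s t, 0 <= s -> s <= t ->
          ((H t - H s)%:E <= \int[lebR R]_(z in `]s, t]) (excess v r u z)%:E)%E &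
        {ae lebR R, forall t : R, 0 < t -> t < b ->
           is_derive t (1 : R) H (excess v r u t)}].
Proof.
move=> vK r0 [mu ubnd] b0; have [M HM] := ubnd b b0.
pose M' := Num.max M 0.
have M'0 : 0 <= M' by rewrite le_max lexx orbT.
have vM0 : 0 <= v M' by exact: classK_ge0.
pose h t := Num.min (excess v r u t) (v M').
have mex : measurable_fun (`[0, +oo[%classic : set (caratheodory_type (wlength (@idfun R))^*%mu))
   (excess v r u : _ -> measurableTypeR R) by exact: measurable_excess.
have mh : measurable_fun (`[0, +oo[%classic : set (caratheodory_type (wlength (@idfun R))^*%mu))
   (h : _ -> measurableTypeR R).
  exact: measurable_minr.
have h0 t : 0 <= h t by rewrite le_min excess_ge0.
have [|H [_ dH intH]] := antiderivative vM0 mh.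
  by move=> t _; rewrite ger0_norm// ge_min lexx orbT.
have {}intH := intH (fun t _ => h0 t).
exists H; split.
- move=> s t s0 st; have := intH s t s0 st => E.
  rewrite -subr_ge0 -lee_fin -E; apply: integral_ge0 => z _.
  by rewrite lee_fin.
- move=> s t s0 st; rewrite -(intH s t s0 st).
  have sub : `]s, t]%classic `<=` `[0, +oo[%classic.
    by move=> z /=; rewrite !in_itv/= andbT => /andP[h1 _]; apply: le_trans s0 (ltW h1).
  have mpos : measurable (`[0, +oo[%classic : set (caratheodory_type (wlength (@idfun R))^*%mu)).
    by apply: sub_caratheodory; exact: measurable_itv.
  apply: ge0_le_integral.
  + by apply: sub_caratheodory; exact: measurable_itv.
  + by move=> z _; rewrite lee_fin.
  + by apply/measurable_EFinP; exact: measurable_funS mpos sub mh.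
  + by apply/measurable_EFinP; exact: measurable_funS mpos sub mex.
  + by move=> z _; rewrite lee_fin ge_min lexx.
have := aeI dH HM; apply: aeS => t [dt ut'] t0 tb.
have ut : enorm (u t) <= M by apply: ut'; rewrite in_itv/= (ltW t0) (ltW tb).
suff <- : h t = excess v r u t by exact: dt.
rewrite /h min_l// /excess; case: ifPn => // _.
apply: classK_mono => //; first exact: enorm_ge0.
by rewrite le_max ut.
Qed.

Lemma left_limit_bound x (a t c : R) (l : 'rV[R]_n) : a < t ->
  (forall s, a < s -> s < t -> enorm (x s) <= c) ->
  x s @[s --> t^'-] --> l -> enorm l <= c.
Proof.
move=> at0 xc /cvg_leftP H; apply/ler_addgt0Pr => e e0.
have [d d0 Hd] := H e e0.
pose s := Num.max (t - d / 2) ((a + t) / 2).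
have s1 : t - d / 2 <= s by rewrite le_max lexx.
have s2 : (a + t) / 2 <= s by rewrite le_max lexx orbT.
have s3 : s < t by rewrite gt_max; apply/andP; split; lra.
have s4 : a < s by lra.
have s5 : t - d < s by lra.
have := Hd s s5 s3; have := xc s s4 s3; have := ler_enorm_sub l (x s).
by rewrite (enormBC l); lra.
Qed.

Lemma left_limit_sub x y (a t c : R) (l k : 'rV[R]_n) : a < t ->
  (forall s, a < s -> s < t -> enorm (x s - y s) <= c) ->
  x s @[s --> t^'-] --> l -> y s @[s --> t^'-] --> k -> enorm (l - k) <= c.
Proof.
move=> at0 xc xl yk.
apply: (@left_limit_bound (fun s => x s - y s) a t) => //.
exact: cvgB.
Qed.

End Perturbation.

Section Comparison.
Variables (R : realType) (n m : nat).
Variables (vf vg ef eg pf pg Nf Ng Of Og Pf Pg Lf : R -> R).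
Hypotheses (vfK : classK vf) (vgK : classK vg) (efK : classK ef) (egK : classK eg).
Hypotheses (pfK : classK pf) (pgK : classK pg).
Hypotheses (NfP : cont_nondecreasing Nf) (NgP : cont_nondecreasing Ng).
Hypotheses (OfP : cont_nondecreasing Of) (OgP : cont_nondecreasing Og).
Hypotheses (PfP : cont_nondecreasing Pf) (PgP : cont_nondecreasing Pg).
Hypothesis LfP : cont_nondecreasing Lf.
Hypothesis ef_lip : forall M s, 0 <= M -> 0 <= s -> s <= M -> ef s <= Lf M * s.

Definition flow_jump_bounds (S : impulsive_system R n m) : Prop :=
  incr_bounds (flow S) vf ef pf Nf Of Pf /\ incr_bounds (jump S) vg eg pg Ng Og Pg.

(** Gronwall's inequality with [theta = 1]. Only [y] is bounded beforehand; while [x] is within 1 of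
    [y] it stays in the ball of radius [c], where the incremental constants hold and
    [ef s <= Lf 1 * s]. *)
Lemma flow_comparison (S : impulsive_system R n m) (u : R -> 'rV[R]_m)
    (B r c kappa t0 a b : R) x0 y0 Tx Ty x y :
  flow_jump_bounds S -> input u -> 0 <= r -> r <= c -> B + 1 <= c -> 0 <= c ->
  0 <= kappa ->
  solution S t0 x0 u Tx x -> solution S t0 y0 (trunc_input r u) Ty y ->
  0 <= t0 -> t0 <= a -> a <= b -> (b%:E < Tx)%E -> (b%:E < Ty)%E ->
  (forall s, imp S s -> a < s -> b < s) ->
  (forall s, a <= s -> s <= b -> enorm (y s) <= B) ->
  (\int[lebR R]_(z in `]a, b]) (excess vf r u z)%:E <= kappa%:E)%E ->
  let C := Lf 1 * (Pf c + pf c) in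
  let A := enorm (x a - y a) + (Nf c + Of 0) * kappa in
  A * expR (C * (b - a)) < 1 ->
  enorm (x b - y b) <= A * expR (C * (b - a)).
Proof.
move=> [fB _] uI r0 rc Bc c0 k0 solx soly t00 t0a ab bTx bTy noimp yB intk C A A1.
have a0 : 0 <= a by exact: le_trans t0a.
have b0 : 0 <= b by exact: le_trans ab.
have [ACx dx] := solution_flow solx t0a ab bTx noimp.
have [ACy dy] := solution_flow soly t0a ab bTy noimp.
have [H [Hmono Hint dH]] := excess_antiderivative vfK r0 uI b0.
set NN := Nf c + Of 0 in A A1 *.
have NN0 : 0 <= NN.
  by have [_ _ h1] := NfP; have [_ _ h2] := OfP; rewrite addr_ge0 ?h1 ?h2.
have PP0 : 0 <= Pf c + pf c.
  have [_ _ h1] := PfP; apply: addr_ge0; [exact: h1|exact: classK_ge0].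
have C0 : 0 <= C by have [_ _ h1] := LfP; rewrite mulr_ge0 ?h1.
pose G t := NN * H t.
have GA : enorm (x a - y a) + (G b - G a) <= A.
  rewrite /A lerD2l /G -mulrBr ler_wpM2l// -lee_fin.
  exact: le_trans (Hint a b a0 ab) intk.
have E0 : 0 <= expR (C * (b - a)) by rewrite ltW// expR_gt0.
have GE := ler_wpM2r E0 GA.
apply: le_trans (GE).
apply: (@gronwall R n (fun t => x t - y t) G a b C 1) => //.
- move=> e e0; have e2 : 0 < e / 2 by rewrite divr_gt0.
  have [d1 d10 H1] := ACx _ e2; have [d2 d20 H2] := ACy _ e2.
  exists (Num.min d1 d2); first by rewrite lt_min d10.
  move=> N p q pq tr; rewrite lt_min => /andP[l1 l2].
  have h1 := H1 N p q pq tr l1; have h2 := H2 N p q pq tr l2.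
  rewrite (splitr e); apply: le_lt_trans (ltrD h1 h2).
  rewrite -big_split/=; apply: ler_sum => i _.
  have -> : x (q i) - y (q i) - (x (p i) - y (p i)) =
     (x (q i) - x (p i)) - (y (q i) - y (p i)).
    by apply/rowP => j; rewrite !mxE; ring.
  exact: ler_enormB.
- by move=> s t as_ st _; rewrite /G ler_wpM2l// Hmono//; exact: le_trans as_.
- have := aeI dx (aeI dy dH); apply: aeS => t [hx [hy hH]] at0 tb.
  have tpos : 0 < t by exact: le_lt_trans at0.
  have := hx at0 tb; have := hy at0 tb; have := hH tpos tb => h1 h2 h3.
  exists (flow S t (x t) (u t) - flow S t (y t) (trunc_input r u t)), (NN * excess vf r u t).
  split.
  + exact: is_deriveB.
  + exact: (is_deriveZ NN h1).
  + by rewrite mulr_ge0// excess_ge0.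
  + move=> D1.
    have yb : enorm (y t) <= B by apply: yB; exact: ltW.
    have xc : enorm (x t) <= c.
      apply: (le_trans (ler_enorm_sub (x t) (y t))).
      by apply: le_trans Bc; exact: lerD.
    apply: (le_trans (incr_bounds_trunc vfK efK pfK NfP PfP fB u _ (ltW tpos) r0 rc xc)).
    rewrite [excess _ _ _ _ * _]mulrC lerD2l /C mulrAC; apply: ler_wpM2r => //.
    by apply: ef_lip => //; exact: enorm_ge0.
- exact: le_lt_trans GE A1.
Qed.

(** Induction on the number of impulses, peeling off the last one: the tolerance required after it
    determines the one before it. [kappa] depends only on the common bounds, so it serves the whole
    family. *)
Lemma comparison (B r T : R) (k : nat) : 0 <= r -> 0 <= T ->
  forall a, 0 < a -> exists2 kappa, 0 < kappa &
  forall (S : impulsive_system R n m) (u : R -> 'rV[R]_m) t0 x0 y0 Tx Ty x y t,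
  flow_jump_bounds S -> input u -> 0 <= t0 ->
  solution S t0 x0 u Tx x -> solution S t0 y0 (trunc_input r u) Ty y ->
  t0 <= t -> (t%:E < Tx)%E -> (t%:E < Ty)%E -> t - t0 <= T ->
  (nimp (imp S) `]t0, t]%classic <= k)%N ->
  (forall s, t0 <= s -> s <= t -> enorm (y s) <= B) ->
  enorm (x0 - y0) <= kappa ->
  (\int[lebR R]_(z in `]t0, t]) (excess vf r u z)%:E <= kappa%:E)%E ->
  (forall s, imp S s -> t0 < s -> s <= t -> excess vg r u s <= kappa) ->
  enorm (x t - y t) <= a.
Proof.
move=> r0 T0.
pose c := Num.max (B + 1) r.
have Bc : B + 1 <= c by rewrite le_max lexx.
have rc : r <= c by rewrite le_max lexx orbT.
have c0 : 0 <= c by exact: le_trans rc.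
pose NN := Nf c + Of 0; pose NG := Ng c + Og 0; pose Q := Pg c + pg c.
pose C := Lf 1 * (Pf c + pf c).
have NN0 : 0 <= NN.
  by have [_ _ h1] := NfP; have [_ _ h2] := OfP; rewrite addr_ge0 ?h1 ?h2.
have NG0 : 0 <= NG.
  by have [_ _ h1] := NgP; have [_ _ h2] := OgP; rewrite addr_ge0 ?h1 ?h2.
have Q0 : 0 <= Q.
  have [_ _ h1] := PgP; apply: addr_ge0; [exact: h1|exact: classK_ge0].
have C0 : 0 <= C.
  have [_ _ h1] := LfP; have [_ _ h2] := PfP.
  by apply: mulr_ge0; [exact: h1|apply: addr_ge0; [exact: h2|exact: classK_ge0]].
pose E := expR (C * T).
have E0 : 0 < E by exact: expR_gt0.
(* The impulse-free stretch up to [t]. The initial error and the input term each take half of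
   [min a 2^-1], divided by the growth factor [E]; the [2^-1] secures the strict bound 1 asked by
   [flow_comparison]. *)
have flow_part (a kappa : R) : 0 < a -> 0 <= kappa ->
    NN * kappa <= Num.min a 2^-1 / (2 * E) ->
    forall (S : impulsive_system R n m) (u : R -> 'rV[R]_m) t0 x0 y0 Tx Ty x y s t,
    flow_jump_bounds S -> input u -> 0 <= t0 ->
    solution S t0 x0 u Tx x -> solution S t0 y0 (trunc_input r u) Ty y ->
    t0 <= s -> s <= t -> (t%:E < Tx)%E -> (t%:E < Ty)%E -> t - t0 <= T ->
    (forall s', imp S s' -> s < s' -> t < s') ->
    (forall s, t0 <= s -> s <= t -> enorm (y s) <= B) ->
    enorm (x s - y s) <= Num.min a 2^-1 / (2 * E) ->
    (\int[lebR R]_(z in `]t0, t]) (excess vf r u z)%:E <= kappa%:E)%E ->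
    enorm (x t - y t) <= a.
  move=> a0 k0 Nk S u t0 x0 y0 Tx Ty x y s t SB uI t00 solx soly t0s st tTx tTy tT noimp yB D intk.
  have intk' : (\int[lebR R]_(z in `]s, t]) (excess vf r u z)%:E <= kappa%:E)%E.
    apply: le_trans intk; apply: ge0_subset_integral.
    - by apply: sub_caratheodory; exact: measurable_itv.
    - by apply: sub_caratheodory; exact: measurable_itv.
    - apply/measurable_EFinP; apply: measurable_funS (measurable_excess vfK r0 uI.1).
        by apply: sub_caratheodory; exact: measurable_itv.
      by move=> z /=; rewrite !in_itv/= andbT => /andP[h1 _]; apply: le_trans t00 (ltW h1).
    - by move=> z _; rewrite lee_fin excess_ge0.
    - by move=> z /=; rewrite !in_itv/= => /andP[h1 ->]; rewrite andbT (le_lt_trans t0s).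
  have Ele : expR (C * (t - s)) <= E.
    rewrite ler_expR ler_wpM2l//; apply: le_trans tT.
    by rewrite lerD2l lerN2.
  have Amin : (enorm (x s - y s) + NN * kappa) * expR (C * (t - s)) <= Num.min a 2^-1.
    apply: (@le_trans _ _ ((enorm (x s - y s) + NN * kappa) * E)).
      by rewrite ler_wpM2l// addr_ge0 ?enorm_ge0// mulr_ge0.
    have -> : Num.min a 2^-1 = (Num.min a 2^-1 / (2 * E) + Num.min a 2^-1 / (2 * E)) * E.
      by field; rewrite gt_eqF.
    by apply: ler_wpM2r; [exact: ltW|exact: lerD].
  have := @flow_comparison S u B r c kappa t0 s t x0 y0 Tx Ty x y SB uI r0 rc Bc c0 k0
    solx soly t00 t0s st tTx tTy noimp.
  move=> H; apply: le_trans (H _ intk' _) _.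
  - by move=> z h1 h2; apply: yB => //; exact: le_trans h1.
  - apply: (le_lt_trans Amin); rewrite gt_min; apply/orP; right.
    by rewrite invf_lt1// ltr1n.
  - by apply: (le_trans Amin); rewrite ge_min lexx.
elim: k => [|k ih] a a0.
  pose nu := Num.min a 2^-1 / (2 * E).
  have nu0 : 0 < nu by rewrite divr_gt0// ?mulr_gt0// lt_min a0 invr_gt0 ltr0n.
  have N1 : 0 < NN + 1 by exact: ltr_wpDl.
  exists (nu / (NN + 1)); first by rewrite divr_gt0.
  have k0 : 0 <= nu / (NN + 1) by rewrite divr_ge0// ltW.
  have kn : nu / (NN + 1) <= nu by rewrite ler_pdivrMr// ler_peMr ?(ltW nu0)// lerDr.
  have Nk : NN * (nu / (NN + 1)) <= nu.
    rewrite mulrA ler_pdivrMr// mulrC ler_wpM2l ?(ltW nu0)//.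
    by rewrite lerDl.
  move=> S u t0 x0 y0 Tx Ty x y t SB uI t00 solx soly t0t tTx tTy tT.
  rewrite leqn0 => /eqP ni yB D intk _.
  have [_ xt0 _ _] := solx; have [_ yt0 _ _] := soly.
  apply: (@flow_part a _ a0 k0 Nk S u t0 x0 y0 Tx Ty x y t0 t) => //.
  - by apply: nimp_eq0 ni => //; exact: impP.
  - by rewrite xt0 yt0; exact: le_trans D kn.
pose nu := Num.min a 2^-1 / (2 * E).
have nu0 : 0 < nu by rewrite divr_gt0// ?mulr_gt0// lt_min a0 invr_gt0 ltr0n.
have N1 : 0 < NN + 1 by exact: ltr_wpDl.
have NG1 : 0 < NG + 1 by exact: ltr_wpDl.
have Q1 : 0 < Q + 1 by exact: ltr_wpDl.
have nuQ : 0 < nu / (4 * (Q + 1)) by apply: divr_gt0 => //; apply: mulr_gt0.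
have [d1 d10 Hd1] := classK_small egK nuQ.
(* Error allowed before the last impulse: at most 1 keeps the left limit of [x] in the ball of
   radius [c], at most [nu / 4] is its own share after the jump, and below [d1] makes the [eg] term
   at most [nu / 4]. The input term gets the remaining [nu / 2]. *)
pose de := Num.min (Num.min 1 (nu / 4)) (d1 / 2).
have de0 : 0 < de.
  by rewrite !lt_min ltr01/=; apply/andP; split; exact: divr_gt0.
have de1 : de <= 1 by rewrite !ge_min lexx.
have den : de <= nu / 4 by rewrite !ge_min lexx orbT.
have ded : de < d1.
  have : de <= d1 / 2 by rewrite ge_min lexx orbT.
  by move=> h; apply: (le_lt_trans h); rewrite ltr_pdivrMr// ltr_pMr// ltr1n.
have [k1 k10 Hk1] := ih de de0.
pose kappa := Num.min k1 (Num.min (nu / (NN + 1)) (nu / (2 * (NG + 1)))).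
have kp : 0 < kappa.
  rewrite !lt_min k10/=; apply/andP; split; first exact: divr_gt0.
  by apply: divr_gt0 => //; exact: mulr_gt0.
have kk1 : kappa <= k1 by rewrite ge_min lexx.
have kkn : kappa <= nu / (NN + 1) by rewrite !ge_min lexx orbT.
have kkg : kappa <= nu / (2 * (NG + 1)) by rewrite !ge_min lexx !orbT.
have Nk : NN * kappa <= nu.
  apply: (@le_trans _ _ (NN * (nu / (NN + 1)))); first by rewrite ler_wpM2l.
  by rewrite mulrA ler_pdivrMr// mulrC ler_wpM2l ?(ltW nu0)// lerDl.
have NGk : NG * kappa <= nu / 2.
  apply: (@le_trans _ _ (NG * (nu / (2 * (NG + 1))))); first by rewrite ler_wpM2l.
  rewrite mulrA ler_pdivrMr ?mulr_gt0//.
  have -> : nu / 2 * (2 * (NG + 1)) = nu * (NG + 1) by field.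
  by rewrite mulrC ler_wpM2l ?(ltW nu0)// lerDl.
have knu : kappa <= nu.
  by apply: (le_trans kkn); rewrite ler_pdivrMr// ler_peMr ?(ltW nu0)// lerDr.
clearbody kappa de.
exists kappa => // S u t0 x0 y0 Tx Ty x y t SB uI t00 solx soly t0t tTx tTy tT ni yB D intk jk.
have [_ xt0 _ ximp] := solx; have [_ yt0 _ yimp] := soly.
have [ex|nex] := pselect (exists s, [/\ imp S s, t0 < s & s <= t]); last first.
  apply: (@flow_part a _ a0 (ltW kp) Nk S u t0 x0 y0 Tx Ty x y t0 t) => //.
  - move=> s gs t0s; rewrite ltNge; apply/negP => st.
    by apply: nex; exists s.
  - by rewrite xt0 yt0; exact: le_trans D knu.
have [tau [gtau t0tau taut lasttau]] := last_impulse (impP S) ex.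
(* Up to any [s < tau] there is strictly one impulse fewer or less, so the induction hypothesis
   applies; the estimate then passes to the left limits. *)
have before s : t0 < s -> s < tau -> enorm (x s - y s) <= de.
  move=> t0s stau; have st : s <= t by exact: le_trans (ltW stau) taut.
  apply: (Hk1 S u t0 x0 y0 Tx Ty x y s) => //.
  - exact: ltW.
  - by apply: le_lt_trans tTx; rewrite lee_fin.
  - by apply: le_lt_trans tTy; rewrite lee_fin.
  - by apply: le_trans tT; rewrite lerD2r.
  - rewrite -ltnS; apply: leq_trans ni.
    exact: (nimp_lt (impP S) gtau t0tau taut stau).
  - by move=> z h1 h2; apply: yB => //; exact: le_trans st.
  - exact: le_trans kk1.
  - apply: (@le_trans _ _ kappa%:E); last by rewrite lee_fin.
    apply: le_trans intk; apply: ge0_subset_integral.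
    + by apply: sub_caratheodory; exact: measurable_itv.
    + by apply: sub_caratheodory; exact: measurable_itv.
    + apply/measurable_EFinP; apply: measurable_funS (measurable_excess vfK r0 uI.1).
        by apply: sub_caratheodory; exact: measurable_itv.
      by move=> z /=; rewrite !in_itv/= andbT => /andP[h1 _]; apply: le_trans t00 (ltW h1).
    + by move=> z _; rewrite lee_fin excess_ge0.
    + by move=> z /=; rewrite !in_itv/= => /andP[-> h1]; rewrite (le_trans h1).
  - move=> z gz h1 h2; apply: le_trans kk1; apply: jk => //; exact: le_trans st.
have tauTx : (tau%:E < Tx)%E by apply: le_lt_trans tTx; rewrite lee_fin.
have tauTy : (tau%:E < Ty)%E by apply: le_lt_trans tTy; rewrite lee_fin.
have [xl cxl jx] := ximp tau gtau t0tau tauTx.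
have [yl cyl jy] := yimp tau gtau t0tau tauTy.
have ylB : enorm yl <= B.
  apply: left_limit_bound t0tau _ cyl => s h1 h2.
  by apply: yB; [exact: ltW|exact: le_trans (ltW h2) taut].
have dl : enorm (xl - yl) <= de by exact: left_limit_sub t0tau before cxl cyl.
have tau0 : 0 <= tau by exact: le_trans (ltW t0tau).
have xlc : enorm xl <= c.
  apply: (le_trans (ler_enorm_sub xl yl)); apply: le_trans Bc; apply: lerD => //.
  exact: le_trans de1.
have jump_est : enorm (x tau - y tau) <= nu.
  have [_ gB] := SB.
  have h1 := incr_bounds_trunc vgK egK pgK NgP PgP gB u yl tau0 r0 rc xlc.
  have h2 : excess vg r u tau * NG <= nu / 2.
    apply: le_trans NGk; rewrite mulrC ler_wpM2l//; exact: jk.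
  have h3 : eg (enorm (xl - yl)) * Q <= nu / 4.
    have g1 : eg (enorm (xl - yl)) <= eg de by apply: classK_mono => //; exact: enorm_ge0.
    have g2 := Hd1 de (ltW de0) ded.
    apply: (@le_trans _ _ (nu / (4 * (Q + 1)) * Q)).
      by apply: ler_wpM2r => //; apply: (le_trans g1); exact: ltW.
    rewrite mulrAC ler_pdivrMr ?mulr_gt0//.
    have -> : nu / 4 * (4 * (Q + 1)) = nu * (Q + 1) by field.
    by rewrite ler_wpM2l ?(ltW nu0)// lerDl.
  rewrite jx jy opprD addrACA; apply: (le_trans (ler_enormD _ _)).
  have -> : nu = nu / 4 + (nu / 2 + nu / 4) by field.
  apply: lerD; first exact: le_trans den.
  by apply: (le_trans h1); apply: lerD.
apply: (@flow_part a _ a0 (ltW kp) Nk S u t0 x0 y0 Tx Ty x y tau t) => //.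
exact: ltW.
Qed.

End Comparison.

Section Auxiliary.
Variable R : realType.

(** Half the supremum of a sublevel set: halving puts the radius strictly inside it, and the factor
    2 in the last clause pays for this. *)
Lemma Kinf_radius (rho : R -> R) : classKinf rho ->
  forall M, 0 < M -> exists r, [/\ 0 < r, rho r <= M &
    forall s, 0 <= s -> rho (2 * s) <= M -> s <= r].
Proof.
move=> [rhoK rhoinf] M M0.
pose A := [set r | 0 <= r /\ rho r <= M].
have [d d0 Hd] := classK_small rhoK M0.
have Ad : A (d / 2) by split; [lra|apply/ltW/Hd; lra].
have [b b0 Mb] := rhoinf M.
have hA : has_sup A.
  split; first by exists (d / 2).
  exists b => r [r0 rM]; rewrite leNgt; apply/negP => br.
  by have := classK_mono rhoK b0 (ltW br); rewrite leNgt (le_lt_trans rM Mb).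
have ub r : A r -> r <= sup A by move=> Ar; apply: ub_le_sup => //; exact: hA.2.
have s0 : 0 < sup A by apply: (lt_le_trans _ (ub _ Ad)); lra.
exists (sup A / 2); split; first lra.
  have [r [r0 rM] hr] := sup_adherent (ltac:(lra) : 0 < sup A / 2) hA.
  by apply: le_trans rM; apply: classK_mono => //; lra.
move=> s sge0 sM; have := ub (2 * s); rewrite /A/= => H.
by have := H (conj (ltac:(lra) : 0 <= 2 * s) sM); lra.
Qed.

(** The two bounds on the extended norm make it finite, so [fine] returns its value and not the
    default 0. *)
Lemma norm_inf_le m (gamma I : set R) (u : R -> 'rV[R]_m) (r : R) : 0 <= r ->
  (forall t, enorm (u t) <= r) ->
  0 <= fine (norm_inf gamma I u) <= r.
Proof.
move=> r0 ur.
have h1 : (norm_inf gamma I u <= r%:E)%E.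
  rewrite /norm_inf ge_max; apply/andP; split.
    apply/ess_supP; apply: ae_true => t; rewrite patchE; case: ifPn => _.
      by rewrite lee_fin.
    by rewrite lee_fin.
  apply: ge_ereal_sup => y [->|[t _ <-]]; by rewrite lee_fin.
have h0 : (0 <= norm_inf gamma I u)%E.
  by rewrite /norm_inf le_max; apply/orP; right; apply: ereal_sup_ubound; left.
move: h0 h1; case: (norm_inf gamma I u) => [x| |]; rewrite ?lee_fin//=.
by move=> -> ->.
Qed.

Lemma nimp_itv0 (gamma : set R) (t : R) : nimp gamma `]t, t]%classic = 0%N.
Proof.
have E : gamma `&` `]t, t]%classic = set0.
  apply/seteqP; split => // s [_] /=; rewrite in_itv/= => /andP[h1 h2].
  by move: (lt_le_trans h1 h2); rewrite ltxx.
by rewrite /nimp E fset_set0 cardfs0.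
Qed.

Lemma solution_restrict n m (S : impulsive_system R n m) t0 (x0 : 'rV[R]_n)
    u T x (s : R) : solution S t0 x0 u T x -> t0 <= s -> (s%:E < T)%E ->
  solution S s (x s) u T x.
Proof.
move=> [t0T _ gapx jumpx] t0s sT; split => //.
- move=> t1 t2 t12 sub; apply: gapx => // t /sub[h1 h2].
  by split => //; exact: le_trans h1.
- by move=> t gt st tT; apply: jumpx => //; exact: le_lt_trans st.
Qed.

End Auxiliary.

Section Scales.
Variables (R : realType) (n m : nat) (L : Type) (Sigma : L -> impulsive_system R n m).
Variables (vf vg ef eg pf pg Nf Ng Of Og Pf Pg Lf : R -> R).
Hypotheses (vfK : classK vf) (vgK : classK vg) (efK : classK ef) (egK : classK eg).
Hypotheses (pfK : classK pf) (pgK : classK pg).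
Hypotheses (NfP : cont_nondecreasing Nf) (NgP : cont_nondecreasing Ng).
Hypotheses (OfP : cont_nondecreasing Of) (OgP : cont_nondecreasing Og).
Hypotheses (PfP : cont_nondecreasing Pf) (PgP : cont_nondecreasing Pg).
Hypothesis LfP : cont_nondecreasing Lf.
Hypothesis ef_lip : forall M s, 0 <= M -> 0 <= s -> s <= M -> ef s <= Lf M * s.
Hypothesis SigmaB : forall l, flow_jump_bounds vf vg ef eg pf pg Nf Ng Of Og Pf Pg (Sigma l).
Variables (phi : R -> R) (beta : R -> R -> R) (rho : R -> R).
Hypothesis phiP : cont_nondecreasing phi.
Hypothesis nimp_phi : forall l t0 t, 0 <= t0 -> t0 < t ->
  (nimp (imp (Sigma l)) `]t0, t]%classic)%:R <= phi (t - t0).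
Hypothesis betaKL : classKL beta.
Hypothesis rhoK : classKinf rho.
Hypothesis ISS : forall l (t0 : R) x0 u Tx x t, 0 <= t0 -> input u ->
  maximal_solution (Sigma l) t0 x0 u Tx x -> rco t0 Tx t ->
  enorm (x t) <= beta (enorm x0) (t - t0)
    + rho (fine (norm_inf (imp (Sigma l)) `]t0, t]%classic u)).

(** At impulses the bound is pointwise: a bound on the sum implies it, and a window contains only
    boundedly many impulses. *)
Definition small_excess l (u : R -> 'rV[R]_m) (r kappa t0 t : R) : Prop :=
  (\int[lebR R]_(z in `]t0, t]) (excess vf r u z)%:E <= kappa%:E)%E /\
  (forall s, imp (Sigma l) s -> t0 < s -> s <= t -> excess vg r u s <= kappa).

Lemma small_excess_sub l u r kappa t0 s s' t : 0 <= r -> input u -> 0 <= t0 ->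
  t0 <= s -> s' <= t ->
  small_excess l u r kappa t0 t -> small_excess l u r kappa s s'.
Proof.
move=> r0 uI t00 t0s s't [h1 h2]; split; last first.
  move=> z gz sz zs'; apply: h2 => //; first exact: le_lt_trans sz.
  exact: le_trans s't.
apply: le_trans h1; apply: ge0_subset_integral.
- by apply: sub_caratheodory; exact: measurable_itv.
- by apply: sub_caratheodory; exact: measurable_itv.
- apply/measurable_EFinP; apply: measurable_funS (measurable_excess vfK r0 uI.1).
    by apply: sub_caratheodory; exact: measurable_itv.
  by move=> z /=; rewrite !in_itv/= andbT => /andP[h1 _]; apply: le_trans t00 (ltW h1).
- by move=> z _; rewrite lee_fin excess_ge0.
- move=> z /=; rewrite !in_itv/= => /andP[h1 h3].
  by rewrite (le_lt_trans t0s h1) (le_trans h3).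
Qed.

Lemma nimp_window l (T t0 t : R) : 0 <= t0 -> t0 <= t -> t - t0 <= T ->
  (nimp (imp (Sigma l)) `]t0, t]%classic)%:R <= phi T.
Proof.
have [_ phim phi0] := phiP.
move=> t00; rewrite le_eqVlt => /predU1P[<-|t0t] tT.
  by rewrite nimp_itv0; apply: phi0; rewrite subrr in tT.
by apply: (le_trans (nimp_phi l t00 t0t)); apply: phim => //; rewrite subr_ge0 ltW.
Qed.

Lemma beta_bound (M s t : R) : 0 <= s -> s <= M -> 0 <= t -> beta s t <= beta M t.
Proof. by move=> s0 sM t0; have [bK _] := betaKL.1 t t0; exact: (classK_mono bK s0 sM). Qed.

Lemma beta_decr (M s t : R) : 0 <= M -> 0 <= s -> s <= t -> beta M t <= beta M s.
Proof. by move=> M0; have [h _] := betaKL.2 M M0; exact: h. Qed.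

(** Weak ISS keeps every maximal solution of the truncated system below [beta M 0 + rho r], so one
    of them exists for all times. *)
Lemma truncated_bounded_solution l (t0 r M : R) x0 u : 0 <= t0 -> 0 <= r -> input u ->
  enorm x0 <= M ->
  exists y, solution (Sigma l) t0 x0 (trunc_input r u) +oo%E y /\
    forall t, t0 <= t -> enorm (y t) <= beta M (t - t0) + rho r.
Proof.
move=> t00 r0 uI x0M.
have mpos : measurable (`[0, +oo[%classic : set (caratheodory_type (wlength (@idfun R))^*%mu)).
  by apply: sub_caratheodory; exact: measurable_itv.
have mt : Lmeasurable `[0, +oo[%classic (trunc_input r u).
  exact: Lmeasurable_trunc uI.1.
have tb t : enorm (trunc_input r u t) <= r by exact: enorm_trunc.
have tI : input (trunc_input r u).
  by split => // b _; exists r; apply: ae_true => t _; exact: tb.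
have M0 : 0 <= M by exact: le_trans (enorm_ge0 _) x0M.
have bound T y t : maximal_solution (Sigma l) t0 x0 (trunc_input r u) T y ->
    rco t0 T t -> enorm (y t) <= beta M (t - t0) + rho r.
  move=> msol It; have [t0t _] := It.
  apply: (le_trans (ISS t00 tI msol It)); apply: lerD.
    by apply: beta_bound => //; [exact: enorm_ge0|rewrite subr_ge0].
  have /andP[h1 h2] := norm_inf_le (imp (Sigma l)) `]t0, t]%classic r0 tb.
  exact: (classK_mono rhoK.1 h1 h2).
have [fB _] := SigmaB l.
have [||||y msol] := @global_solution R n m (Sigma l) (trunc_input r u) r _ _ mt _ t0 x0
    (beta M 0 + rho r) t00.
- by move=> c; exact: (incr_bounds_bounded vfK efK pfK NfP OfP PfP fB c (@flow0 _ _ _ (Sigma l))).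
- move=> c; have [c0|c0] := leP 0 c; last first.
    by exists 0 => // t x y mu _ xc; have := le_lt_trans (le_trans (enorm_ge0 x) xc) c0; rewrite ltxx.
  have c2 : 0 <= c + c by exact: addr_ge0.
  have [_ _ Lf0] := LfP; have [_ _ Pf0] := PfP.
  have Q0 : 0 <= Pf c + pf c by apply: addr_ge0; [exact: Pf0|exact: classK_ge0].
  exists (Lf (c + c) * (Pf c + pf c)); first by apply: mulr_ge0 => //; exact: Lf0.
  move=> t x y mu tge xc yc muc.
  apply: (le_trans (incr_bounds_state efK pfK PfP fB y tge xc muc)).
  rewrite mulrAC; apply: ler_wpM2r => //; apply: ef_lip => //; first exact: enorm_ge0.
  by apply: (le_trans (ler_enormB _ _)); exact: lerD.
- by move=> t _; exact: tb.
- move=> T y t msol It; apply: (le_trans (bound T y t msol It)).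
  rewrite lerD2r; apply: beta_decr => //.
  by rewrite subr_ge0; have [] := It.
exists y; split; first by have [] := msol.
by move=> t t0t; apply: bound msol _; split => //; exact: ltry.
Qed.

(** At the end of the window the share [beta M T <= M / 4], the gain [M / 8] and the comparison
    error [M / 8] add up to [M / 2]. *)
Lemma scale_step (M r : R) : 0 < M -> 0 < r -> rho r <= M / 8 ->
  exists T kappa, [/\ 0 < T, 0 < kappa &
  forall l (t0 t : R) x0 u Tx x, 0 <= t0 -> input u ->
    solution (Sigma l) t0 x0 u Tx x -> enorm x0 <= M ->
    t0 <= t -> (t%:E < Tx)%E -> t <= t0 + T -> small_excess l u r kappa t0 t ->
    enorm (x t) <= beta M 0 + M /\ (t = t0 + T -> enorm (x t) <= M / 2)].
Proof.
move=> M0 r0 rhor.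
have [_ /cvgrPdist_le bcvg] := betaKL.2 M (ltW M0).
have M4 : 0 < M / 4 by exact: divr_gt0.
have [T T0 bT] : exists2 T, 0 < T & beta M T <= M / 4.
  have : \forall t \near +oo, 0 < t /\ beta M t <= M / 4.
    near=> t; have t0 : 0 < t by near: t; apply: nbhs_pinfty_gt; rewrite num_real.
    split => //; have : `|0 - beta M t| <= M / 4 by near: t; exact: bcvg.
    by rewrite sub0r normrN; apply: le_trans; exact: ler_norm.
  by case/filter_ex => t [h1 h2]; exists t.
pose k := (Num.truncn (phi T)).+1.
have kphi : phi T < k%:R by exact: truncnS_gt.
have M8 : 0 < M / 8 by exact: divr_gt0.
have [kappa k0 Hk] := @comparison R n m vf vg ef eg pf pg Nf Ng Of Og Pf Pg Lf vfK vgK efK egK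
  pfK pgK NfP NgP OfP OgP PfP PgP LfP ef_lip (beta M 0 + M / 8) r T k (ltW r0) (ltW T0) _ M8.
exists T, kappa; split => // l t0 t x0 u Tx x t00 uI solx x0M t0t tTx tT [ek1 ek2].
have [y [soly yb]] := truncated_bounded_solution l t00 (ltW r0) uI x0M.
have tt0 : 0 <= t - t0 by rewrite subr_ge0.
have tT' : t - t0 <= T by rewrite lerBlDl.
have dxy : enorm (x t - y t) <= M / 8.
  apply: (Hk (Sigma l) u t0 x0 x0 Tx +oo%E x y t) => //.
  - exact: ltry.
  - by rewrite -(ler_nat R) ltW// (le_lt_trans _ kphi)//; exact: nimp_window.
  - move=> s t0s st; apply: (le_trans (yb s t0s)); apply: lerD => //.
    by apply: beta_decr => //; [exact: ltW|rewrite subr_ge0].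
  - by rewrite subrr enorm0 ltW.
have h1 := ler_enorm_sub (x t) (y t); have h2 := yb t t0t.
split.
  have h3 := beta_decr (ltW M0) (lexx 0) tt0.
  by lra.
move=> tE; have h3 : t - t0 = T by rewrite tE addrC addKr.
rewrite h3 in h2.
by lra.
Unshelve. all: by end_near. Qed.

End Scales.

(** * Descent through the dyadic scales *)

Section Dyadic.
Variable R : realType.

Definition dyadic (k : int) : R := 2 ^ k.

Lemma dyadic_gt0 k : 0 < dyadic k.
Proof. exact: exprz_gt0. Qed.

Lemma dyadicD1 k : dyadic (k + 1) = 2 * dyadic k.
Proof.
have two0 : (2 : R) != 0 by rewrite pnatr_eq0.
by rewrite /dyadic (expfzDr _ _ two0) expr1z mulrC.
Qed.

Lemma dyadic_mono j k : j <= k -> dyadic j <= dyadic k.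
Proof. by move=> jk; apply: ler_weXz2l jk; rewrite ler1n. Qed.

Lemma dyadic_small (e : R) : 0 < e -> exists k, dyadic k < e.
Proof.
move=> e0; have [i hi] := geometric_lt 1 e0; exists (- i%:Z).
by rewrite mul1r in hi; rewrite /dyadic -exprz_inv.
Qed.

Lemma dyadic_large (M : R) : exists i : nat, M <= dyadic i%:Z.
Proof.
exists (Num.truncn `|M|).+1; apply: (le_trans (ler_norm M)).
apply: (@le_trans _ _ (Num.truncn `|M|).+1%:R); first exact/ltW/truncnS_gt.
by rewrite /dyadic -exprnP -natrX ler_nat ltnW// ltn_expl.
Qed.

End Dyadic.

Section Chain.
Variables (R : realType) (n m : nat) (L : Type) (Sigma : L -> impulsive_system R n m).
Variables (vf vg : R -> R).
Hypothesis vfK : classK vf.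
Variables (rad T kap B : int -> R).
Hypotheses (rad_gt0 : forall k, 0 < rad k) (T_gt0 : forall k, 0 < T k).
Notation small k l u t0 t := (small_excess Sigma vf vg l u (rad k) (kap k) t0 t).
Hypothesis step : forall k l (t0 t : R) x0 u Tx x, 0 <= t0 -> input u ->
  solution (Sigma l) t0 x0 u Tx x -> enorm x0 <= dyadic R k ->
  t0 <= t -> (t%:E < Tx)%E -> t <= t0 + T k -> small k l u t0 t ->
  enorm (x t) <= B k /\ (t = t0 + T k -> enorm (x t) <= dyadic R (k - 1)).

(** A window started below [dyadic R k] ends below half of it, so the next window can start at the
    same scale; the induction counts windows. *)
Lemma invariance k l (t0 t : R) x0 u Tx x : 0 <= t0 -> input u ->
  solution (Sigma l) t0 x0 u Tx x -> enorm x0 <= dyadic R k ->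
  t0 <= t -> (t%:E < Tx)%E -> small k l u t0 t -> enorm (x t) <= B k.
Proof.
move=> t00 uI; have [N HN] : exists N, t - t0 <= N%:R * T k.
  exists (Num.truncn (`|t - t0| / T k)).+1; apply: (le_trans (ler_norm _)).
  by rewrite -ler_pdivrMr//; exact/ltW/truncnS_gt.
elim: N t0 x0 t00 HN => [|N ih] t0 x0 t00 HN sol x0k t0t tTx sm.
  have [h _] := step t00 uI sol x0k t0t tTx ltac:(by rewrite mul0r subr_le0 in HN; rewrite (le_trans HN)// lerDl ltW) sm.
  exact: h.
have [tT|tT] := leP t (t0 + T k); first by have [] := step t00 uI sol x0k t0t tTx tT sm.
have t0s : t0 <= t0 + T k by rewrite lerDl ltW.
have sTx : ((t0 + T k)%:E < Tx)%E by apply: lt_trans tTx; rewrite lte_fin.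
have sms : small k l u t0 (t0 + T k).
  by apply: small_excess_sub sm => //; exact: ltW.
have [_ /(_ erefl) xs] := step t00 uI sol x0k t0s sTx (lexx _) sms.
apply: (ih (t0 + T k) (x (t0 + T k))) => //.
- exact: le_trans t0s.
- by rewrite -natr1 mulrDl mul1r in HN; rewrite opprD addrA lerBlDr.
- exact: solution_restrict sol t0s sTx.
- by apply: (le_trans xs); apply: dyadic_mono; rewrite gerBl.
- exact: ltW.
- by apply: small_excess_sub sm => //; exact: ltW.
Qed.

(** One window is spent per scale. The target [i] depends on the energy, so the time is fixed
    beforehand for all [i <= N]; only scales above [i] need small excess. *)
Lemma descent (N : nat) (k : int) : exists2 TN, 0 <= TN &
  forall l (t0 t : R) x0 u Tx x, 0 <= t0 -> input u ->
    solution (Sigma l) t0 x0 u Tx x -> enorm x0 <= dyadic R (k + N%:Z) ->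
    t0 + TN <= t -> (t%:E < Tx)%E ->
    forall i : nat, (i <= N)%N ->
      (forall p : nat, (i < p <= N)%N -> small (k + p%:Z) l u t0 t) ->
      exists s, [/\ t0 <= s, s <= t & enorm (x s) <= dyadic R (k + i%:Z)].
Proof.
elim: N => [|N [TN TN0 ih]].
  exists 0 => // l t0 t x0 u Tx x _ _ [_ xt0 _ _] x0k; rewrite addr0 => t0t _ i.
  by rewrite leqn0 => /eqP -> _; exists t0; split => //; rewrite xt0.
exists (T (k + N.+1%:Z) + TN); first by rewrite addr_ge0// ltW.
move=> l t0 t x0 u Tx x t00 uI sol x0k; rewrite addrA => tTN tTx i.
rewrite leq_eqVlt => /predU1P[->|iN] sm.
  have [_ xt0 _ _] := sol; exists t0; split; rewrite ?xt0//.
  by apply: le_trans tTN; rewrite -addrA lerDl addr_ge0// ltW.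
set T1 := T _ in tTN.
have T10 : 0 < T1 by exact: T_gt0.
have t0s : t0 <= t0 + T1 by rewrite lerDl ltW.
have st : t0 + T1 <= t by apply: le_trans tTN; rewrite lerDl.
have sTx : ((t0 + T1)%:E < Tx)%E by apply: le_lt_trans tTx; rewrite lee_fin.
have sm1 : small (k + N.+1%:Z) l u t0 (t0 + T1).
  by apply: small_excess_sub (sm N.+1 _) => //; [exact: ltW|rewrite iN leqnn].
have [_ /(_ erefl) xs] := step t00 uI sol x0k t0s sTx (lexx _) sm1.
have xs' : enorm (x (t0 + T1)) <= dyadic R (k + N%:Z).
  by move: xs; rewrite -addrA (_ : N.+1%:Z - 1 = N%:Z)// -addn1 PoszD addrK.
have [||s [h1 h2 h3]] := ih l (t0 + T1) t (x (t0 + T1)) u Tx x _ uI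
    (solution_restrict sol t0s sTx) xs' tTN tTx i iN _.
- exact: le_trans t0s.
- move=> p /andP[ip pN]; apply: small_excess_sub (sm p _) => //; first exact: ltW.
  by rewrite ip leqW.
- by exists s; split => //; exact: le_trans h1.
Qed.

End Chain.

(** * Energy weights and thresholds *)

Section EnergyWeights.
Variable R : realType.
Variables (rad kap : int -> R).
Hypothesis kap_gt0 : forall k, 0 < kap k.
Hypothesis rad_large : forall s : R, 0 <= s -> exists J : nat,
  forall j : int, J%:Z <= j -> s <= rad j.
Hypothesis rad_pos : exists2 d : R, 0 < d & forall j : int, 0 < j -> d <= rad j.

(** At positive scales [weight j * kap j >= j], so any given energy becomes harmless at large
    scales. At the other scales weight 1 lets the weighted gains still vanish at 0. *)
Definition weight (j : int) : R :=
  if 0 < j then Num.max 1 (j%:~R / kap j) else 1.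

Lemma weight_ge1 j : 1 <= weight j.
Proof. by rewrite /weight; case: ifPn => // _; rewrite le_max lexx. Qed.

Lemma weight_kap j : 0 < j -> j%:~R <= weight j * kap j.
Proof.
by move=> j0; rewrite /weight j0 -ler_pdivrMr// le_max lexx orbT.
Qed.

(** Since the radii tend to infinity, only finitely many positive scales weigh on a bounded range of
    [s], and none on small [s]. *)
Lemma weighted_majorant (v : R -> R) : classK v ->
  exists2 rho, classKinf rho & forall j s, 0 <= s -> rad j < s -> weight j * v s <= rho s.
Proof.
move=> vK.
pose W s y := 0 <= s /\ exists2 j, rad j < s & y = weight j * v s.
have [|r|e e0|rho rhoK Hrho] := @Kinf_majorant R W.
- by move=> s y [].
- have [J HJ] := rad_large (normr_ge0 r).
  (* The 1 covers all scales [j <= 0], the sum the positive ones below [J]. *)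
  exists ((1 + \sum_(i < J) weight i%:Z) * v `|r|) => s y [s0 [j js ->]] sr.
  have sr' : s <= `|r| by exact: le_trans (ler_norm r).
  have v0 : 0 <= v s by exact: classK_ge0.
  apply: ler_pM => //; first exact: le_trans (weight_ge1 j).
    have S0 (P : pred 'I_J) : 0 <= \sum_(i < J | P i) weight i%:Z.
      by apply: sumr_ge0 => i _; exact: le_trans (weight_ge1 _).
    have [j0|j0] := leP j 0.
      by rewrite {1}/weight ltNge j0/= lerDl.
    have jJ : j < J%:Z.
      rewrite ltNge; apply/negP => /HJ; rewrite leNgt.
      by rewrite (lt_le_trans js).
    have [i iE] : exists i : nat, j = i%:Z by exists `|j|%N; rewrite gez0_abs// ltW.
    rewrite iE in jJ *; have iJ : (i < J)%N by [].
    rewrite (bigD1 (Ordinal iJ))//=.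
    by have := S0 (fun i0 => i0 != Ordinal iJ); lra.
  exact: classK_mono.
- have [d d0 Hd] := rad_pos; have [d' d'0 Hd'] := classK_small vK e0.
  exists (Num.min d (d' / 2)); first by rewrite lt_min d0 divr_gt0.
  move=> s y [s0 [j js ->]]; rewrite le_min => /andP[sd sd'].
  have j0 : ~~ (0 < j).
    by apply/negP => /Hd; rewrite leNgt (lt_le_trans js).
  rewrite /weight (negbTE j0) mul1r; apply/ltW/Hd' => //; lra.
exists rho => // j s s0 js; apply: Hrho; split => //; by exists j.
Qed.

Variables (n m : nat) (L : Type) (Sigma : L -> impulsive_system R n m).
Variables (vf vg rho1 rho2 : R -> R).
Hypothesis vfK : classK vf.
Hypotheses (rho1K : classKinf rho1) (rho2K : classKinf rho2).
Hypothesis rho1_ge : forall j s, 0 <= s -> rad j < s -> weight j * vf s <= rho1 s.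
Hypothesis rho2_ge : forall j s, 0 <= s -> rad j < s -> weight j * vg s <= rho2 s.
Hypothesis rad_gt0 : forall k, 0 < rad k.

Lemma excess_le_weight (v rho : R -> R) j (u : R -> 'rV[R]_m) t : classK rho ->
  (forall s, 0 <= s -> rad j < s -> weight j * v s <= rho s) ->
  excess v (rad j) u t <= (weight j)^-1 * rho (enorm (u t)).
Proof.
move=> rhoK H; have w0 : 0 < weight j by exact: lt_le_trans (weight_ge1 j).
rewrite /excess; case: ifPn => [_|].
  by apply: mulr_ge0; [rewrite invr_ge0 ltW|exact: classK_ge0 (enorm_ge0 _)].
rewrite -ltNge => h; rewrite mulrC ler_pdivlMr// mulrC; apply: H => //.
exact: enorm_ge0.
Qed.

Lemma energy_small_excess l (u : R -> 'rV[R]_m) (t0 t E kappa : R) j :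
  input u -> 0 <= t0 ->
  (norm_rho rho1 rho2 (imp (Sigma l)) `]t0, t]%classic u <= E%:E)%E ->
  E <= weight j * kappa ->
  small_excess Sigma vf vg l u (rad j) kappa t0 t.
Proof.
move=> uI t00 nE Ek.
have w0 : 0 < weight j by exact: lt_le_trans (weight_ge1 j).
have wi : 0 <= (weight j)^-1 by rewrite invr_ge0 ltW.
have i0 : (0 <= \int[lebR R]_(s in `]t0, t]) (rho1 (enorm (u s)))%:E)%E.
  by apply: integral_ge0 => s _; rewrite lee_fin classK_ge0 ?enorm_ge0//; exact: rho1K.1.
have s0 : (0 <= \esum_(s in imp (Sigma l) `&` `]t0, t]) (rho2 (enorm (u s)))%:E)%E.
  by apply: esum_ge0 => s _; rewrite lee_fin classK_ge0 ?enorm_ge0//; exact: rho2K.1.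
have iE : (\int[lebR R]_(s in `]t0, t]) (rho1 (enorm (u s)))%:E <= E%:E)%E.
  by apply: le_trans nE; rewrite /norm_rho leeDl.
have sE : (\esum_(s in imp (Sigma l) `&` `]t0, t]) (rho2 (enorm (u s)))%:E <= E%:E)%E.
  by apply: le_trans nE; rewrite /norm_rho leeDr.
have mI : measurable (`]t0, t]%classic : set (caratheodory_type (wlength (@idfun R))^*%mu)).
  by apply: sub_caratheodory; exact: measurable_itv.
have mpos : measurable (`[0, +oo[%classic : set (caratheodory_type (wlength (@idfun R))^*%mu)).
  by apply: sub_caratheodory; exact: measurable_itv.
have sub : `]t0, t]%classic `<=` `[0, +oo[%classic.
  by move=> z /=; rewrite !in_itv/= andbT => /andP[h1 _]; apply: le_trans t00 (ltW h1).
have mr : measurable_fun (`]t0, t]%classic : set (caratheodory_type (wlength (@idfun R))^*%mu))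
    ((fun s => rho1 (enorm (u s))) : _ -> measurableTypeR R).
  apply: (measurable_funS mpos sub); apply: (@Lmeasurable_mono_comp R _ rho1 (fun s => enorm (u s))).
  - by move=> r s; exact: (classK_mono rho1K.1).
  - by move=> s; exact: enorm_ge0.
  - exact: Lmeasurable_enorm uI.1.
split.
  apply: (@le_trans _ _ (\int[lebR R]_(s in `]t0, t]) ((weight j)^-1%:E * (rho1 (enorm (u s)))%:E))%E).
    apply: ge0_le_integral.
    - exact: mI.
    - by move=> z _; rewrite lee_fin excess_ge0.
    - apply/measurable_EFinP; apply: (measurable_funS mpos sub).
      exact: (measurable_excess vfK (ltW (rad_gt0 j)) uI.1).
    - apply: measurable_funeM; exact/measurable_EFinP.
    - move=> z _; rewrite -EFinM lee_fin; apply: excess_le_weight; first exact: rho1K.1.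
      by move=> s; exact: rho1_ge.
  rewrite (ge0_integralZl_EFin (lebR R) mI); last 3 first.
  - by move=> z _; rewrite lee_fin; apply: (classK_ge0 rho1K.1); exact: enorm_ge0.
  - exact/measurable_EFinP.
  - exact: wi.
  apply: (@le_trans _ _ ((weight j)^-1%:E * E%:E)%E); first by rewrite lee_wpmul2l// lee_fin.
  by rewrite -EFinM lee_fin mulrC ler_pdivrMr// mulrC.
move=> s gs t0s st; apply: (@le_trans _ _ ((weight j)^-1 * rho2 (enorm (u s)))).
  by apply: excess_le_weight; [exact: rho2K.1|move=> r; exact: rho2_ge].
rewrite mulrC ler_pdivrMr// mulrC; apply: le_trans Ek.
rewrite -lee_fin; apply: le_trans sE.
have rs0 : (0 <= (rho2 (enorm (u s)))%:E)%E.
  by rewrite lee_fin; apply: (classK_ge0 rho2K.1); exact: enorm_ge0.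
apply: esum_ge; exists [set s]; last by rewrite fsbig_set1.
split; first exact: finite_set1.
by move=> _ ->; split => //=; rewrite in_itv/= t0s.
Qed.

End EnergyWeights.

Section EnergyThresholds.
Variable R : realType.
Variable kap : int -> R.
Hypothesis kap_gt0 : forall k, 0 < kap k.

(** Running minima over the scales [0, -1, ..., -i] make the thresholds monotone; the initial 1 fits
    them below the threshold at scale 1. *)
Fixpoint kap_min (i : nat) : R :=
  if i is i'.+1 then Num.min (kap_min i') (kap (- i%:Z)) else Num.min 1 (kap 0).

Lemma kap_min_gt0 i : 0 < kap_min i.
Proof. by elim: i => [|i ih] /=; rewrite lt_min kap_gt0 ?ltr01 ?ih. Qed.

Lemma kap_min_le i : kap_min i <= kap (- i%:Z).
Proof. by case: i => [|i] /=; rewrite ge_min lexx orbT. Qed.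

Lemma kap_min_mono i j : (i <= j)%N -> kap_min j <= kap_min i.
Proof.
elim: j => [|j ih]; first by rewrite leqn0 => /eqP ->.
rewrite leq_eqVlt => /predU1P[->//|]; rewrite ltnS => /ih h.
by rewrite /= ge_min h.
Qed.

Definition threshold (k : int) : R := if 0 < k then k%:~R else kap_min `|k|%N.

Lemma threshold_gt0 k : 0 < threshold k.
Proof. by rewrite /threshold; case: ifPn => [|_]; rewrite ?ltr0z// kap_min_gt0. Qed.

Lemma threshold_mono j k : j <= k -> threshold j <= threshold k.
Proof.
move=> jk; rewrite /threshold; have [j0|j0] := ltP 0 j.
  by rewrite (lt_le_trans j0 jk) ler_int.
have [k0|k0] := ltP 0 k; last first.
  by apply: kap_min_mono; rewrite -lez_nat !lez0_abs// lerN2.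
apply: (@le_trans _ _ (kap_min 0)); first exact: kap_min_mono.
by apply: (@le_trans _ _ 1); [rewrite /= ge_min lexx|rewrite ler1z -gtz0_ge1].
Qed.

Lemma threshold_weight k : threshold k <= weight kap k * kap k.
Proof.
rewrite /threshold; case: ifPn => k0; first exact: weight_kap.
rewrite /weight (negbTE k0) mul1r; rewrite -leNgt in k0.
by apply: (le_trans (kap_min_le _)); rewrite lez0_abs// opprK.
Qed.

Lemma threshold_large (N : R) : exists i : nat, N <= threshold i%:Z.
Proof.
exists (Num.truncn `|N|).+1; apply: (le_trans (ler_norm N)).
by rewrite /threshold ltz_nat/= -pmulrn; exact/ltW/truncnS_gt.
Qed.

End EnergyThresholds.

Section Decay.
Variables (R : realType) (n m : nat) (L : Type) (Sigma : L -> impulsive_system R n m).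
Variables (vf vg : R -> R).
Hypothesis vfK : classK vf.
Variables (rad T kap B : int -> R).
Hypotheses (rad_gt0 : forall k, 0 < rad k) (T_gt0 : forall k, 0 < T k).
Hypothesis kap_gt0 : forall k, 0 < kap k.
Hypothesis step : forall k l (t0 t : R) x0 u Tx x, 0 <= t0 -> input u ->
  solution (Sigma l) t0 x0 u Tx x -> enorm x0 <= dyadic R k ->
  t0 <= t -> (t%:E < Tx)%E -> t <= t0 + T k ->
  small_excess Sigma vf vg l u (rad k) (kap k) t0 t ->
  enorm (x t) <= B k /\ (t = t0 + T k -> enorm (x t) <= dyadic R (k - 1)).
Variables (rho1 rho2 alpha : R -> R).
Hypotheses (rho1K : classKinf rho1) (rho2K : classKinf rho2) (alphaK : classKinf alpha).
Hypothesis rho1_ge : forall j s, 0 <= s -> rad j < s -> weight kap j * vf s <= rho1 s.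
Hypothesis rho2_ge : forall j s, 0 <= s -> rad j < s -> weight kap j * vg s <= rho2 s.
Hypothesis alphaB : forall j, alpha (B j) <= threshold kap (j - 1).

(* If the energy [E] lies between consecutive thresholds, the inputs are small
   at all scales above it, so [x] descends to that scale and stays there; then
   [alpha] of the state is below [E] unless [E] is below the threshold at [k]. *)
Lemma energy_dichotomy k l (t0 t : R) x0 u Tx x E : 0 <= t0 -> input u ->
  solution (Sigma l) t0 x0 u Tx x -> t0 <= t -> (t%:E < Tx)%E ->
  (norm_rho rho1 rho2 (imp (Sigma l)) `]t0, t]%classic u <= E%:E)%E ->
  E < alpha (enorm (x t)) ->
  (forall i : nat, (forall p : nat, (i <= p)%N ->
       small_excess Sigma vf vg l u (rad (k + p%:Z)) (kap (k + p%:Z)) t0 t) ->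
     exists s, [/\ t0 <= s, s <= t & enorm (x s) <= dyadic R (k + i%:Z)]) ->
  enorm (x t) <= B k.
Proof.
move=> t00 uI solx t0t tTx nE Ea desc.
have exi : exists i : nat, E <= threshold kap (k + i%:Z).
  have [i hi] := threshold_large kap E.
  exists (i + `|k|)%N; apply: (le_trans hi); apply: threshold_mono => //.
  by rewrite PoszD addrCA lerDl abszE -lerBlDl sub0r -normrN ler_norm.
case: (ex_minnP exi) => i Ei imin.
have sm p : (i <= p)%N ->
    small_excess Sigma vf vg l u (rad (k + p%:Z)) (kap (k + p%:Z)) t0 t.
  move=> ip; apply: (energy_small_excess vfK rho1K rho2K rho1_ge rho2_ge rad_gt0 uI t00 nE).
  apply: (le_trans Ei); apply: le_trans (threshold_weight kap_gt0 _).
  by apply: threshold_mono => //; rewrite lerD2l lez_nat.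
have [s [t0s st xs]] := desc i sm.
have sTx : (s%:E < Tx)%E by apply: le_lt_trans tTx; rewrite lee_fin.
have xt : enorm (x t) <= B (k + i%:Z).
  apply: (invariance vfK rad_gt0 T_gt0 step _ uI (solution_restrict solx t0s sTx) xs st tTx).
    exact: le_trans t0s.
  by apply: small_excess_sub (sm i (leqnn i)) => //; exact: ltW.
(* At a positive index the shift in [alphaB] puts [alpha (enorm (x t))], and with it [E], below the
   threshold one scale lower, against minimality. *)
clear desc xs sm; case: i Ei imin xt => [|i] Ei imin; first by rewrite addr0.
move=> xt; exfalso; have := imin i; rewrite ltnn => H.
suff : E <= threshold kap (k + i%:Z) by move/H.
apply/ltW/(lt_le_trans Ea); apply: (le_trans (classK_mono alphaK.1 (enorm_ge0 _) xt)).
by apply: (le_trans (alphaB _)); rewrite -addrA -addn1 PoszD addrK.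
Qed.

Lemma energy_invariance k l (t0 t : R) x0 u Tx x E : 0 <= t0 -> input u ->
  solution (Sigma l) t0 x0 u Tx x -> t0 <= t -> (t%:E < Tx)%E ->
  (norm_rho rho1 rho2 (imp (Sigma l)) `]t0, t]%classic u <= E%:E)%E ->
  E < alpha (enorm (x t)) -> enorm x0 <= dyadic R k -> enorm (x t) <= B k.
Proof.
move=> t00 uI solx t0t tTx nE Ea x0k.
apply: (energy_dichotomy t00 uI solx t0t tTx nE Ea) => i _.
have [_ xt0 _ _] := solx.
exists t0; split => //; rewrite xt0; apply: (le_trans x0k).
by apply: dyadic_mono; rewrite lerDl.
Qed.

Lemma energy_decay k (N : nat) : exists S, forall l (t0 t : R) x0 u Tx x E,
  0 <= t0 -> input u ->
  solution (Sigma l) t0 x0 u Tx x -> t0 <= t -> (t%:E < Tx)%E ->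
  (norm_rho rho1 rho2 (imp (Sigma l)) `]t0, t]%classic u <= E%:E)%E ->
  E < alpha (enorm (x t)) -> enorm x0 <= dyadic R (k + N%:Z) -> t0 + S <= t ->
  enorm (x t) <= B k.
Proof.
have [S S0 HS] := descent vfK rad_gt0 T_gt0 step N k; exists S.
move=> l t0 t x0 u Tx x E t00 uI solx t0t tTx nE Ea x0k St.
apply: (energy_dichotomy t00 uI solx t0t tTx nE Ea) => i sm.
have [iN|Ni] := leqP i N.
  apply: (HS l t0 t x0 u Tx x t00 uI solx x0k St tTx i iN) => p /andP[ip _].
  exact/sm/ltnW.
have [_ xt0 _ _] := solx.
exists t0; split => //; rewrite xt0; apply: (le_trans x0k).
by apply: dyadic_mono; rewrite lerD2l lez_nat ltnW.
Qed.

End Decay.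

Lemma radii (R : realType) (rho : R -> R) : classKinf rho ->
  exists rad : int -> R,
  [/\ (forall k, 0 < rad k /\ rho (rad k) <= dyadic R k / 8),
      (forall s, 0 <= s -> exists J : nat, forall j, J%:Z <= j -> s <= rad j) &
      (exists2 d, 0 < d & forall j, 0 < j -> d <= rad j)].
Proof.
move=> rhoK.
have M0 k : 0 < dyadic R k / 8 by rewrite divr_gt0 ?dyadic_gt0.
have [rad radP] := choice (fun k => Kinf_radius rhoK (M0 k)).
exists rad; split.
- by move=> k; have [] := radP k.
- move=> s s0; have [J HJ] := dyadic_large (rho (2 * s) * 8).
  exists J => j Jj; have [_ _] := radP j; apply => //.
  by rewrite ler_pdivlMr//; apply: (le_trans HJ); exact: dyadic_mono.
- have [d d0 Hd] := classK_small rhoK.1 (M0 0).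
  (* The factor 2 in [Kinf_radius] turns this into [d / 2 < d], where [rho] is below its level for
     scale 0. *)
  exists (d / 4); first exact: divr_gt0.
  move=> j j0; have [_ _] := radP j; apply; first by rewrite ltW// divr_gt0.
  apply: (@le_trans _ _ (dyadic R 0 / 8)); last first.
    by rewrite ler_pM2r// dyadic_mono// ltW.
  by apply/ltW/Hd; lra.
Qed.

Section Overshoot.
Variables (R : realType) (B : int -> R) (theta : int -> R).
Hypothesis B_mono : forall j k, j <= k -> B j <= B k.
Hypothesis B_small : forall e, 0 < e -> exists k, B k < e.
Hypothesis theta_gt0 : forall k, 0 < theta k.
Hypothesis theta_mono : forall j k, j <= k -> theta j <= theta k.
Hypothesis theta_large : forall N, exists i : nat, N <= theta i%:Z.

(** If [B k < B j] then [k <= j - 1], so the shifted thresholds are still bounded below by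
    [theta k]; this absorbs the loss of one scale and gives positivity and growth. *)
Lemma scale_minorant :
  exists2 alpha, classKinf alpha & forall j, 0 <= B j -> alpha (B j) <= theta (j - 1).
Proof.
pose W r v := exists j, r = B j /\ v = theta (j - 1).
have lift k j : B k < B j -> theta k <= theta (j - 1).
  move=> kj; apply: theta_mono; rewrite lerBrDr lezD1 ltNge.
  by apply/negP => /B_mono; rewrite leNgt kj.
have [| |r r0|N|alpha alphaK Ha] := @Kinf_minorant R W.
- by move=> r v [j [_ ->]]; exact: ltW.
- by exists (B 0, theta (0 - 1)); exists 0.
- have [k kr] := B_small r0; exists (theta k) => // s v [j [-> ->]] rB.
  by apply: lift; exact: lt_le_trans rB.
- have [i hi] := theta_large N; exists (B i%:Z + 1) => s v [j [-> ->]] rB.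
  apply: (le_trans hi); apply: lift; apply: lt_le_trans rB; by rewrite ltrDl.
exists alpha => // j Bj; apply: Ha => //; by exists j.
Qed.

End Overshoot.

(** [beta] decreases in time, so dropping the impulse count only enlarges the bound. *)
Lemma strongly_weakly_iISS (R : realType) (n m : nat) (L : Type)
    (Sigma : L -> impulsive_system R n m) :
  strongly_iISS Sigma -> weakly_iISS Sigma.
Proof.
move=> [beta [alpha [rho1 [rho2 [bKL aK r1K r2K H]]]]].
exists beta, alpha, rho1, rho2; split => // l t0 x0 u Tx x t t00 uI msol It.
apply: (le_trans (H l t0 x0 u Tx x t t00 uI msol It)); apply: leeD => //.
rewrite lee_fin; have [h _] := bKL.2 _ (enorm_ge0 x0).
by apply: h; [have [t0t _] := It; rewrite subr_ge0|rewrite lerDl].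
Qed.

Theorem corollary4p2 (R : realType) (n m : nat) (L : Type)
    (Sigma : L -> impulsive_system R n m)
    (L_nonempty : inhabited L)
    (Sigma_ISS : weakly_ISS Sigma)
    (vphit_f vphit_g eta_f eta_g vphi_f vphi_g : R -> R)
    (N_f N_g O_f O_g P_f P_g : R -> R)
    (vphit_fK : classKinf vphit_f) (vphit_gK : classKinf vphit_g)
    (eta_fK : classKinf eta_f) (eta_gK : classKinf eta_g)
    (vphi_fK : classKinf vphi_f) (vphi_gK : classKinf vphi_g)
    (N_fP : cont_nondecreasing N_f) (N_gP : cont_nondecreasing N_g)
    (O_fP : cont_nondecreasing O_f) (O_gP : cont_nondecreasing O_g)
    (P_fP : cont_nondecreasing P_f) (P_gP : cont_nondecreasing P_g)
    (f_bounds : forall l : L,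
       incr_bounds (flow (Sigma l)) vphit_f eta_f vphi_f N_f O_f P_f)
    (g_bounds : forall l : L,
       incr_bounds (jump (Sigma l)) vphit_g eta_g vphi_g N_g O_g P_g)
    (Lf : R -> R)
    (LfP : cont_nondecreasing Lf)
    (Lf_gt0 : forall M : R, 0 < M -> 0 < Lf M)
    (eta_f_Lip : forall M s : R, 0 <= M -> 0 <= s -> s <= M ->
       eta_f s <= Lf M * s)
    (gammas_UIB : UIB [set imp (Sigma l) | l in [set: L]]) :
  strongly_iISS Sigma /\ weakly_iISS Sigma.
Proof.
suff S : strongly_iISS Sigma by split; [exact: S|exact: strongly_weakly_iISS].
have [beta [rho [bKL rhoK ISS]]] := Sigma_ISS.
have [_ [phi phiP Hphi]] := gammas_UIB.
have nimp_phi l (t0 t : R) : 0 <= t0 -> t0 < t ->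
  (nimp (imp (Sigma l)) `]t0, t]%classic)%:R <= phi (t - t0).
  by move=> t00 t0t; apply: Hphi => //; exists l.
have [rad [radP rad_large rad_pos]] := radii rhoK.
have SB l : flow_jump_bounds vphit_f vphit_g eta_f eta_g vphi_f vphi_g
    N_f N_g O_f O_g P_f P_g (Sigma l) by split.
have [T HT] := choice (fun k => scale_step vphit_fK.1 vphit_gK.1 eta_fK.1 eta_gK.1
  vphi_fK.1 vphi_gK.1 N_fP N_gP O_fP O_gP P_fP P_gP LfP eta_f_Lip SB phiP nimp_phi bKL rhoK
  ISS (dyadic_gt0 R k) (radP k).1 (radP k).2).
have [kap Hkap] := choice HT; move=> {HT}.
pose B k := beta (dyadic R k) 0 + dyadic R k.
have kap_gt0 k : 0 < kap k by have [] := Hkap k.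
have T_gt0 k : 0 < T k by have [] := Hkap k.
have rad_gt0 k : 0 < rad k by have [] := radP k.
have step k l (t0 t : R) x0 u Tx x : 0 <= t0 -> input u ->
    solution (Sigma l) t0 x0 u Tx x -> enorm x0 <= dyadic R k ->
    t0 <= t -> (t%:E < Tx)%E -> t <= t0 + T k ->
    small_excess Sigma vphit_f vphit_g l u (rad k) (kap k) t0 t ->
    enorm (x t) <= B k /\ (t = t0 + T k -> enorm (x t) <= dyadic R (k - 1)).
  move=> t00 uI solx x0k t0t tTx tT sm; have [_ _ H] := Hkap k.
  have [h1 h2] := H l t0 t x0 u Tx x t00 uI solx x0k t0t tTx tT sm.
  split => // /h2 h; apply: (le_trans h).
  by rewrite ler_pdivrMr// mulrC -dyadicD1 subrK.
have [rho1 rho1K rho1_ge] := weighted_majorant kap rad_large rad_pos vphit_fK.1.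
have [rho2 rho2K rho2_ge] := weighted_majorant kap rad_large rad_pos vphit_gK.1.
have b0K := bKL.1 0 (lexx 0).
have dB k : dyadic R k <= B k by rewrite lerDr; exact: (classK_ge0 b0K.1 (ltW (dyadic_gt0 R k))).
have B_ge0 k : 0 <= B k by apply: le_trans (dB k); exact/ltW/dyadic_gt0.
have B_mono j k : j <= k -> B j <= B k.
  move=> jk; have djk := dyadic_mono R jk; apply: lerD => //.
  by apply: (classK_mono b0K.1 _ djk); exact/ltW/dyadic_gt0.
have B_small e : 0 < e -> exists k, B k < e.
  move=> e0; have e2 : 0 < e / 2 by exact: divr_gt0.
  have [d d0 Hd] := classK_small b0K.1 e2.
  have [k] := dyadic_small (ltac:(by rewrite lt_min d0 e2) : 0 < Num.min d (e / 2)).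
  rewrite lt_min => /andP[kd ke]; exists k; rewrite /B [ltRHS]splitr; apply: ltrD => //.
  by apply: Hd => //; exact/ltW/dyadic_gt0.
have [alpha alphaK alphaB] := scale_minorant B_mono B_small (threshold_gt0 kap_gt0)
  (@threshold_mono R kap) (threshold_large kap).
have alphaB' j : alpha (B j) <= threshold kap (j - 1) by exact: alphaB.
have inv := energy_invariance vphit_fK.1 rad_gt0 T_gt0 kap_gt0 step rho1K rho2K
  alphaK rho1_ge rho2_ge alphaB'.
have dec := energy_decay vphit_fK.1 rad_gt0 T_gt0 kap_gt0 step rho1K rho2K
  alphaK rho1_ge rho2_ge alphaB'.
have alpha_mono y k : 0 <= y -> y <= B k -> alpha y <= alpha (B k).
  by move=> y0 yB; exact: (classK_mono alphaK.1 y0 yB).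
have alphaB_small e : 0 < e -> exists k, alpha (B k) <= e.
  move=> e0; have [d d0 Hd] := classK_small alphaK.1 e0.
  by have [k kd] := B_small _ d0; exists k; apply/ltW/Hd.
have norm_ge0 l u (t0 t : R) :
    (0 <= norm_rho rho1 rho2 (imp (Sigma l)) `]t0, t]%classic u)%E.
  apply: adde_ge0.
    by apply: integral_ge0 => s _; rewrite lee_fin; exact: (classK_ge0 rho1K.1 (enorm_ge0 _)).
  by apply: esum_ge0 => s _; rewrite lee_fin; exact: (classK_ge0 rho2K.1 (enorm_ge0 _)).
(* Only states whose [alpha] value exceeds a real bound [E] of the energy are recorded, so [beta]
   alone must dominate them. *)
pose W r s v := exists l (t0 t : R) x0 u Tx x,
  [/\ 0 <= t0, input u, solution (Sigma l) t0 x0 u Tx x, rco t0 Tx t &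
   exists E, [/\ r = enorm x0,
   s = t - t0 + (nimp (imp (Sigma l)) `]t0, t]%classic)%:R, v = alpha (enorm (x t)),
   (norm_rho rho1 rho2 (imp (Sigma l)) `]t0, t]%classic u <= E%:E)%E & E < v]].
have [|r|e e0|r e e0|b bKL' Hb] := @KL_majorant R W.
- move=> r s v [l [t0 [t [x0 [u [Tx [x [t00 uI solx [t0t _] [E [-> -> _ _ _]]]]]]]]]].
  split; first exact: enorm_ge0.
  by apply: addr_ge0 => //; rewrite subr_ge0.
- have [i hi] := dyadic_large r; exists (alpha (B i%:Z)).
  move=> r' s v [l [t0 [t [x0 [u [Tx [x [t00 uI solx [t0t tTx] [E [-> _ -> nE Ea]]]]]]]]]] r'r.
  apply: alpha_mono; first exact: enorm_ge0.
  exact: (inv _ _ _ _ _ _ _ _ _ t00 uI solx t0t tTx nE Ea (le_trans r'r hi)).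
- have [k hk] := alphaB_small _ e0; exists (dyadic R k); first exact: dyadic_gt0.
  move=> r s v [l [t0 [t [x0 [u [Tx [x [t00 uI solx [t0t tTx] [E [-> _ -> nE Ea]]]]]]]]]] rd.
  apply: le_trans hk; apply: alpha_mono; first exact: enorm_ge0.
  exact: (inv _ _ _ _ _ _ _ _ _ t00 uI solx t0t tTx nE Ea rd).
- have [k hk] := alphaB_small _ e0; have [i hi] := dyadic_large r.
  (* Starting [|i - k|] scales above [k] covers the ball of radius [r]. If [t - t0 <= S], at most
     [phi S] impulses occurred, so an argument of at least [S + phi S + 1] forces [t - t0 > S]. *)
  have [S HS] := dec k `|i%:Z - k|%N; exists (S + phi S + 1).
  move=> r' s v [l [t0 [t [x0 [u [Tx [x [t00 uI solx [t0t tTx] [E [-> -> -> nE Ea]]]]]]]]]] r'r Ss.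
  apply: le_trans hk; apply: alpha_mono; first exact: enorm_ge0.
  apply: (HS _ _ _ _ _ _ _ _ t00 uI solx t0t tTx nE Ea).
    apply: (le_trans r'r); apply: (le_trans hi); apply: dyadic_mono.
    by rewrite abszE -lerBlDl ler_norm.
  have [tS|tS] := leP (t - t0) S; last by rewrite -lerBrDl ltW.
  have h := nimp_window phiP nimp_phi l t00 t0t tS.
  have := le_trans Ss (lerD tS h).
  by rewrite gerDl ler10.
exists b, alpha, rho1, rho2; split => // l t0 x0 u Tx x t t00 uI [solx _] It.
set Nr := norm_rho _ _ _ _ _; set s := t - t0 + _.
have s0 : 0 <= s by apply: addr_ge0 => //; rewrite subr_ge0; have [] := It.
have bge0 : 0 <= b (enorm x0) s.
  by have [bK _] := bKL'.1 s s0; exact: (classK_ge0 bK (enorm_ge0 _)).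
(* Either the energy alone dominates, or it is finite and, taken as [E], places the state in [W]. *)
have [h|h] := leP (alpha (enorm (x t)))%:E Nr.
  by apply: (le_trans h); rewrite leeDr.
have Nfin : Nr = (fine Nr)%:E.
  by rewrite fineK// ge0_fin_numE ?norm_ge0//; apply: lt_trans h _; exact: ltry.
apply: (@le_trans _ _ (b (enorm x0) s)%:E); last by rewrite leeDl// norm_ge0.
rewrite lee_fin; apply: Hb.
exists l, t0, t, x0, u, Tx, x; split => //; exists (fine Nr); split => //.
  by rewrite -Nfin lexx.
by rewrite -lte_fin -Nfin.
Qed.
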